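(* For every $\delta>0$ there exist $n_0,\sigma>0$ such that the following holds for all $n,t\in\mathbb N$ with $n\geq n_0$. If $\mathcal H$ is an $n$-vertex hypergraph with maximum degree at most $(1-\delta)tn$ and codegree at most $t$ such that the number of edges $e$ of $\mathcal H$ with $(1-\delta)\sqrt n \leq |V(e)| \leq (1+\delta)\sqrt n$ is at most $(1-\delta)tn$, then $\chi'_\ell(\mathcal H)\leq (1-\sigma)tn$.
   Context: A hypergraph $\mathcal H$ consists of a finite vertex set $V(\mathcal H)$ and a finite set of edges, each edge $e$ equipped with a nonempty set $V(e)\subseteq V(\mathcal H)$; multiple edges with the same vertex set are allowed. $\mathcal H$ is $n$-vertex if $|V(\mathcal H)|=n$. The degree of a vertex is the number of edges containing it; the maximum degree is the largest degree. The codegree of distinct vertices $u,v$ is the number of edges containing both, and the codegree of $\mathcal H$ is the maximum over all pairs of distinct vertices. A proper edge-colouring assigns colours to edges so that distinct edges of the same colour have disjoint vertex sets. For a list assignment $C$ (a set $C(e)$ of colours for each edge $e$), a $C$-edge-colouring is a proper edge-colouring $\phi$ with $\phi(e)\in C(e)$ for all $e$. The list chromatic index $\chi'_\ell(\mathcal H)$ is the least $s$ such that $\mathcal H$ has a $C$-edge-colouring for every list assignment with all $|C(e)|\geq s$. *)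

(* Defs.v *)
From HB Require Import structures.
From mathcomp Require Import all_boot all_order all_algebra.
From mathcomp Require Import reals.
Set Implicit Arguments. Unset Strict Implicit. Unset Printing Implicit Defensive.
Import Order.TTheory GRing.Theory Num.Theory.

(* A hypergraph: finite vertex type V, finite edge type E (multiple edges
   allowed), and vertex sets [vs e] of the edges. *)
Definition hypergraph (V E : finType) (vs : E -> {set V}) : Prop :=
  forall e : E, vs e != set0.

Definition hdegree (V E : finType) (vs : E -> {set V}) (v : V) : nat :=
  #|[set e : E | v \in vs e]|.

Definition hcodegree (V E : finType) (vs : E -> {set V}) (u v : V) : nat :=
  #|[set e : E | (u \in vs e) && (v \in vs e)]|.

(* colours are natural numbers; a list assignment C gives a finite list of
   colours to each edge; |C(e)| = number of distinct colours in C e *)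
Definition proper_edge_colouring (V E : finType) (vs : E -> {set V})
    (phi : E -> nat) : Prop :=
  forall e f : E, e != f -> phi e = phi f -> [disjoint vs e & vs f].

Definition C_edge_colouring (V E : finType) (vs : E -> {set V})
    (C : E -> seq nat) (phi : E -> nat) : Prop :=
  proper_edge_colouring vs phi /\ forall e, phi e \in C e.

(* s lies in the set whose least element is the list chromatic index *)
Definition list_colourable (V E : finType) (vs : E -> {set V}) (s : nat) : Prop :=
  forall C : E -> seq nat, (forall e, s <= size (undup (C e))) ->
    exists phi : E -> nat, C_edge_colouring vs C phi.

(* chi'_l(H) <= x  iff the least s with list_colourable s is <= x,
   i.e. iff some s <= x is list_colourable. *)
Definition list_chromatic_index_le (R : realType) (V E : finType)
    (vs : E -> {set V}) (x : R) : Prop :=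
  exists s : nat, (s%:R <= x)%R /\ list_colourable vs s.

(* Main.v *)
(** Write [D = t n].  The edges are split by size at two constants [r1 << r0], and a random
    set [S] of colours, containing a small fraction of each list, is reserved.

    Edges larger than [r0] are coloured outside [S].  In a minimal counterexample every edge
    meets at least [(1 - sigma) D] others.  If the smallest size [k] is close to [sqrt n] or
    larger, then the hypothesis on the edges of size about [sqrt n] leaves fewer than
    [(1 - sigma) D] edges.  Otherwise the edges of size about [k] cover almost all pairs of
    vertices; all but those of them that meet few of the remaining edges are coloured by
    minimality.  On what is left the neighbourhoods of the line graph are sparse, and one round
    of random colouring saves a constant fraction of [D] compared with a greedy colouring.

    Edges of size between [r1] and [r0] have degree at most [D / r1] and are coloured from [S];
    edges of size at most [r1] meet few edges larger than [r0] and are coloured outside [S].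
    Both times this is Kahn's theorem that a hypergraph of bounded edge size and small codegree
    is list colourable from lists slightly larger than its degree, proved by the semi-random
    method.  Colours act independently in each random step: every edge chooses each of its
    colours with a small probability, and takes it if no edge meeting it made the same choice.
    A colour is discarded at a vertex where its degree did not drop as expected, so that
    the second moment method suffices there; all other quantities are sums over independent
    colours. *)
Require Import Defs.
From HB Require Import structures.
From mathcomp Require Import all_boot all_order all_algebra.
From mathcomp Require Import reals sequences exp.
From mathcomp Require Import ring lra zify.
Set Implicit Arguments. Unset Strict Implicit. Unset Printing Implicit Defensive.
Import Order.TTheory GRing.Theory Num.Theory.

(** If the edges have size about k, the codegree bound keeps degrees below D / (k - 1), so an edge
    meets about D others whatever k is: greedy colouring only just fails, and a constant fraction
    must be gained. The gain has two sources, separated by k = sqrt n. Below it, two neighbours of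
    an edge e meet each other either at a vertex of e, which is rare, or across one of about k^2
    pairs of vertices, each in at most t edges; so about (1 - k^2 / n) D^2 pairs of neighbours are
    not adjacent and may repeat colours. Above it, the bound t n^2 on the sum of |e| (|e| - 1)
    leaves fewer than D edges. At sqrt n neither works: in a projective plane with every line
    repeated t times all t n edges meet. This is what the hypothesis on the window excludes. The
    medium range only opens a gap between the two ranges that share colours: an edge of size at most
    r1 meets at most r1 D / r0 edges larger than r0. Union bounds suffice throughout, because a
    hypergraph with n <= D and degrees at most D has at most D^2 edges, while the failure
    probabilities are exponentially small in D. *)

Section ListColouring.
Variables (E Col : finType) (adj : rel E).
Implicit Types (X Y : {set E}) (A B : E -> {set Col}) (phi : E -> Col).

Definition colours X A phi :=
  (forall e, e \in X -> phi e \in A e) /\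
  (forall e f, e \in X -> f \in X -> adj e f -> phi e <> phi f).

Definition colourable X A := exists phi, colours X A phi.

Lemma colourable0 A : Col -> colourable set0 A.
Proof. by move=> c0; exists (fun=> c0); split=> e; rewrite inE. Qed.

Lemma colourableS X Y A B : X \subset Y -> (forall e, e \in X -> A e \subset B e) ->
  colourable Y A -> colourable X B.
Proof.
move=> /subsetP XY AB [phi [phiA phiP]]; exists phi; split=> [e eX|e f eX fX].
  by apply: (subsetP (AB e eX)); apply/phiA/XY.
by apply: phiP; apply: XY.
Qed.

Hypotheses (adjC : symmetric adj) (adjxx : irreflexive adj).

Lemma colours_union X Y A B phi psi : colours X A phi -> colours Y B psi ->
  (forall e, e \in Y -> B e \subset A e) ->
  (forall e f, e \in Y -> f \in X -> adj e f -> phi f \notin B e) ->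
  colours (X :|: Y) A (fun e => if e \in Y then psi e else phi e).
Proof.
move=> [phiA phiP] [psiB psiP] BA sep; split=> [e|e f]; rewrite !inE.
  by case: ifP => [eY _|_ /orP[/phiA|]//]; apply: (subsetP (BA e eY)); apply: psiB.
case: ifP => eY; case: ifP => fY; rewrite ?orbT ?orbF.
- by move=> _ _; apply: psiP.
- move=> _ fX ef eq_ef; have := sep _ _ eY fX ef.
  by rewrite -eq_ef psiB.
- move=> eX _ ef eq_ef; have := sep f e fY eX; rewrite adjC => /(_ ef).
  by rewrite eq_ef psiB.
- exact: phiP.
Qed.

Definition neighbours X e := [set f in X | adj e f].

Definition avail X A phi e := A e :\: (phi @: neighbours X e).

Lemma card_avail X A phi e : #|A e| - #|neighbours X e| <= #|avail X A phi e|.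
Proof.
rewrite leq_subLR /avail -(cardsID (phi @: neighbours X e) (A e)) leq_add2r.
by apply: leq_trans (subset_leq_card (subsetIr _ _)) (leq_imset_card _ _).
Qed.

Lemma colourable_extend X Y A phi : colours X A phi ->
  colourable Y (avail X A phi) -> colourable (X :|: Y) A.
Proof.
move=> phiX [psi psiY]; eexists; apply: (colours_union phiX psiY) => [e _|e f _ fX ef].
  exact: subsetDl.
by rewrite !inE negb_and negbK imset_f // inE fX.
Qed.

Lemma colourable_greedy X A : Col ->
  (forall e, e \in X -> #|neighbours X e| < #|A e|) -> colourable X A.
Proof.
move=> c0; have [n] := ubnP #|X|; elim: n X => // n IH X; rewrite ltnS => Xn XA.
have [->|[e eX]] := set_0Vmem X; first exact: colourable0.
have nbrS f : neighbours (X :\ e) f \subset neighbours X f.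
  by apply/subsetP => g; rewrite !inE => /andP[/andP[_ ->] ->].
have [|f|phi phiX] := IH (X :\ e).
- by apply: leq_trans Xn; rewrite [in leqRHS](cardsD1 e) eX.
- by rewrite !inE => /andP[_ /XA]; apply/leq_trans/subset_leq_card/nbrS.
rewrite -(setD1K eX) setUC; apply: (colourable_extend phiX).
have /card_gt0P[c cA] : 0 < #|avail (X :\ e) A phi e|.
  apply: leq_trans (card_avail _ _ _ _); rewrite subn_gt0.
  by apply: leq_ltn_trans (XA e eX); apply/subset_leq_card/nbrS.
exists (fun=> c); split=> [f /set1P-> //|f g /set1P-> /set1P->].
by rewrite adjxx.
Qed.

End ListColouring.

Local Open Scope ring_scope.

(** * Product probability spaces *)

Section ProductExpectation.
Variables (R : realType) (I T : finType).
Implicit Types (p : I -> T -> R) (F G : {ffun I -> T} -> R) (w : {ffun I -> T}).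

Definition is_dist p := forall i, (forall x, 0 <= p i x) /\ \sum_x p i x = 1.

Definition weight p w := \prod_i p i (w i).

Definition Ex p F := \sum_w weight p w * F w.

Lemma weight_ge0 p w : is_dist p -> 0 <= weight p w.
Proof. by move=> dp; apply: prodr_ge0 => i _; case: (dp i). Qed.

Lemma Ex_prod p (g : I -> T -> R) :
  Ex p (fun w => \prod_i g i (w i)) = \prod_i \sum_x p i x * g i x.
Proof.
rewrite bigA_distr_bigA; apply: eq_bigr => w _.
by rewrite /weight -big_split.
Qed.

Lemma sum_weight p : is_dist p -> \sum_w weight p w = 1.
Proof.
move=> dp; have := Ex_prod p (fun _ _ => 1).
rewrite /Ex (eq_bigr (weight p)) => [->|w _]; last by rewrite big1_eq mulr1.
by apply: big1 => i _; rewrite -[RHS](dp i).2; apply: eq_bigr => x _; rewrite mulr1.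
Qed.

Lemma Ex_cst p a : is_dist p -> Ex p (fun=> a) = a.
Proof. by move=> dp; rewrite /Ex -mulr_suml sum_weight // mul1r. Qed.

Lemma eq_Ex p F G : F =1 G -> Ex p F = Ex p G.
Proof. by move=> FG; apply: eq_bigr => w _; rewrite FG. Qed.

Lemma le_Ex p F G : is_dist p -> (forall w, F w <= G w) -> Ex p F <= Ex p G.
Proof. by move=> dp FG; apply: ler_sum => w _; rewrite ler_wpM2l ?weight_ge0. Qed.

Lemma Ex_ge0 p F : is_dist p -> (forall w, 0 <= F w) -> 0 <= Ex p F.
Proof. by move=> dp F0; apply: sumr_ge0 => w _; rewrite mulr_ge0 ?weight_ge0. Qed.

Lemma ExD p F G : Ex p (fun w => F w + G w) = Ex p F + Ex p G.
Proof. by rewrite /Ex -big_split; apply: eq_bigr => w _; rewrite mulrDr. Qed.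

Lemma ExZ p a F : Ex p (fun w => a * F w) = a * Ex p F.
Proof. by rewrite /Ex mulr_sumr; apply: eq_bigr => w _; rewrite mulrCA. Qed.

Lemma Ex_sum p (J : Type) (r : seq J) (P : pred J) (F : J -> {ffun I -> T} -> R) :
  Ex p (fun w => \sum_(j <- r | P j) F j w) = \sum_(j <- r | P j) Ex p (F j).
Proof.
rewrite /Ex exchange_big; apply: eq_bigr => w _; exact: mulr_sumr.
Qed.

Lemma Ex_lt1_witness p F : is_dist p -> Ex p F < 1 -> exists w, F w < 1.
Proof.
move=> dp F1; apply/existsP; apply: contraLR F1; rewrite negb_exists => /forallP F1.
rewrite -leNgt -(Ex_cst 1 dp); apply: le_Ex => // w; rewrite leNgt; exact: F1.
Qed.

Definition Pr p (A : pred {ffun I -> T}) := Ex p (fun w => (A w)%:R).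

Lemma le_Pr p (A B : pred {ffun I -> T}) :
  is_dist p -> (forall w, A w -> B w) -> Pr p A <= Pr p B.
Proof.
move=> dp AB; apply: le_Ex => // w; rewrite ler_nat.
by case: (boolP (A w)) => // /AB ->.
Qed.

Lemma markov p (A : pred {ffun I -> T}) F a :
  is_dist p -> 0 < a -> (forall w, 0 <= F w) -> (forall w, A w -> a <= F w) ->
  Pr p A <= Ex p F / a.
Proof.
move=> dp a0 F0 AF; rewrite ler_pdivlMr // mulrC -ExZ; apply: le_Ex => // w.
by case: (boolP (A w)) => [/AF|_]; rewrite ?mulr1 // mulr0.
Qed.

(* The pair (w1, w2) |-> (mix J w1 w2, mix J w2 w1) is a weight-preserving
   involution, which is how conditioning on the coordinates in J is expressed. *)
Definition mix (J : {set I}) (w1 w2 : {ffun I -> T}) : {ffun I -> T} :=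
  [ffun i => if i \in J then w1 i else w2 i].

Lemma Ex_mix p (J : {set I}) F : is_dist p ->
  Ex p F = Ex p (fun w1 => Ex p (fun w2 => F (mix J w1 w2))).
Proof.
move=> dp; pose s (u : {ffun I -> T} * {ffun I -> T}) := (mix J u.1 u.2, mix J u.2 u.1).
have sK : involutive s.
  by case=> a b; congr (_, _); apply/ffunP => i; rewrite !ffunE /= ?ffunE; case: (i \in J).
have -> : Ex p F = \sum_(u : {ffun I -> T} * {ffun I -> T}) weight p u.1 * weight p u.2 * F u.1.
  rewrite -(pair_bigA_idem _ (fun a b => weight p a * weight p b * F a)) /= ?addr0 //.
  apply: eq_bigr => a _; under eq_bigr do rewrite mulrAC.
  by rewrite -mulr_sumr sum_weight // mulr1.
rewrite (reindex_inj (inv_inj sK)) /= /Ex.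
rewrite -(pair_bigA_idem _ (fun a b => weight p (mix J a b) * weight p (mix J b a) * F (mix J a b))) /= ?addr0 //.
apply: eq_bigr => a _; rewrite mulr_sumr; apply: eq_bigr => b _; rewrite mulrA; congr (_ * _).
rewrite /weight -!big_split; apply: eq_bigr => i _ /=; rewrite !ffunE.
by case: ifP => _ //; rewrite mulrC.
Qed.

End ProductExpectation.

(** * Elementary inequalities for exponentials and products *)

Section ExpBounds.
Variable R : realType.
Implicit Types x y : R.

(** Inverting [1 - y <= expR (- y)] bounds the exponential by [(1 - y)^-1], and (1 + y + 2 y^2) (1 -
    y) = 1 + y^2 (1 - 2 y) >= 1. Negative y of any size is allowed, so the same inequality serves
    both tails. *)
Lemma expR_le_quadratic y : y <= 2^-1 -> expR y <= 1 + y + 2 * y ^+ 2.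
Proof.
move=> y2; have h : 1 - y <= expR (- y) by rewrite (expR_ge1Dx (- y)).
have y1 : 0 < 1 - y by lra.
rewrite -[y in expR y]opprK expRN.
apply: (@le_trans _ _ (1 - y)^-1); first by rewrite lef_pV2 // posrE expR_gt0.
rewrite -div1r ler_pdivrMr //.
have -> : (1 + y + 2 * y ^+ 2) * (1 - y) = 1 + y ^+ 2 * (1 - 2 * y) by ring.
by rewrite lerDl mulr_ge0 ?sqr_ge0 //; lra.
Qed.

Lemma weierstrass_prod (J : finType) (P : pred J) (a : J -> R) :
  (forall j, P j -> 0 <= a j <= 1) ->
  1 - \sum_(j | P j) a j <= \prod_(j | P j) (1 - a j).
Proof.
move=> a01; suff [] : 1 - \sum_(j | P j) a j <= \prod_(j | P j) (1 - a j)
   /\ 0 <= \sum_(j | P j) a j /\ \prod_(j | P j) (1 - a j) <= 1 by [].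
elim/big_rec2: _ => [|j x y /a01 /andP[a0 a1] [h1 [h2 h3]]]; first by split; lra.
split; [nra | split; nra].
Qed.

Lemma bernoulli_le (a : R) n : 0 <= a <= 1 -> 1 - n%:R * a <= (1 - a) ^+ n.
Proof.
move=> a01; have := @weierstrass_prod 'I_n predT (fun=> a) (fun _ _ => a01).
by rewrite big_const_ord iter_addr_0 prodr_const card_ord mulr_natl.
Qed.

End ExpBounds.

(** * Exponential moments under bounded differences *)

Section Concentration.
Variables (R : realType) (I T : finType).
Implicit Types (p : I -> T -> R) (F G : {ffun I -> T} -> R) (w : {ffun I -> T}).

Lemma Ex_marginal p (i : I) (g : T -> R) : is_dist p ->
  Ex p (fun w => g (w i)) = \sum_x p i x * g x.
Proof.
move=> dp; have := Ex_prod p (fun j x => if j == i then g x else 1).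
rewrite (bigD1 i) //= [X in _ = _ * X -> _]big1 ?eqxx; last first.
  move=> j /negbTE->; rewrite -[RHS](dp j).2; apply: eq_bigr => x _; exact: mulr1.
rewrite mulr1 => <-; apply: eq_Ex => w.
by rewrite (bigD1 i) //= eqxx big1 ?mulr1 // => j /negbTE->.
Qed.

Definition upd w (i : I) (x : T) : {ffun I -> T} := [ffun j => if j == i then x else w j].

Lemma Ex_avg p i F : is_dist p ->
  Ex p (fun w => \sum_x p i x * F (upd w i x)) = Ex p F.
Proof.
move=> dp; rewrite (Ex_mix [set~ i] F dp); apply: eq_Ex => w.
rewrite -(Ex_marginal i (fun x => F (upd w i x)) dp); apply: eq_Ex => w2; congr F.
by apply/ffunP => j; rewrite !ffunE !inE; case: eqP => // ->.
Qed.

Lemma updC w i j x y : i != j -> upd (upd w i x) j y = upd (upd w j y) i x.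
Proof.
move=> ij; apply/ffunP => k; rewrite !ffunE.
by case: eqP => // ->; rewrite eq_sym (negbTE ij).
Qed.

Lemma updK w i x y : upd (upd w i x) i y = upd w i y.
Proof. by apply/ffunP => k; rewrite !ffunE; case: eqP. Qed.

(** The coordinates in s are averaged out one at a time. Around its average over one coordinate F
    moves by at most c, the linear term of [expR_le_quadratic] has mean zero, and the quadratic term
    costs the factor [expR (2 * c ^+ 2)]. Listing the relevant coordinates keeps the bound
    independent of the size of I. *)
Lemma mcdiarmid p (c : R) (s : seq I) F : is_dist p -> 0 <= c <= 2^-1 ->
  (forall i w x, i \in s -> `|F (upd w i x) - F w| <= c) ->
  (forall i w x, i \notin s -> F (upd w i x) = F w) ->
  Ex p (fun w => expR (F w)) <= expR ((size s)%:R * (2 * c ^+ 2)) * expR (Ex p F).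
Proof.
move=> dp /andP[c0 c2]; elim: s F => [|i s IH] F Fc F0.
  have Fcst w w' : F w = F w'.
    suff H (r : seq I) : F [ffun i => if i \in r then w i else w' i] = F w'.
      rewrite -(H (enum I)); congr F; apply/ffunP => i.
      by rewrite ffunE mem_enum.
    elim: r => [|i r IHr]; first by congr F; apply/ffunP => i; rewrite ffunE.
    rewrite -[RHS]IHr -[RHS](F0 i _ (w i)) //; congr F; apply/ffunP => j.
    by rewrite !ffunE in_cons; case: eqP => // ->.
  rewrite mul0r expR0 mul1r.
  (* An outcome exists because the weights sum to 1, whereas an empty sum is 0. *)
  have [w0 _|no] := pickP (predT : pred {ffun I -> T}); last first.
    by have := sum_weight dp; rewrite big_pred0 // => /esym/eqP; rewrite oner_eq0.
  rewrite (eq_Ex p (fun w => congr1 (@expR R) (Fcst w w0))) Ex_cst //.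
  by rewrite (eq_Ex p (fun w => Fcst w w0)) Ex_cst.
pose G w := \sum_x p i x * F (upd w i x).
have G_near w : `|F w - G w| <= c.
  have -> : F w - G w = \sum_x p i x * (F w - F (upd w i x)).
    under [RHS]eq_bigr do rewrite mulrBr.
    by rewrite sumrB -mulr_suml (dp i).2 mul1r.
  apply: le_trans (ler_norm_sum _ _ _) _.
  rewrite -[leRHS]mul1r -(dp i).2 mulr_suml; apply: ler_sum => x _.
  have px := (dp i).1 x.
  by rewrite normrM ger0_norm // ler_wpM2l // distrC Fc ?mem_head.
have step : Ex p (fun w => expR (F w)) <= expR (2 * c ^+ 2) * Ex p (fun w => expR (G w)).
  rewrite -(Ex_avg i (fun w => expR (F w)) dp) -ExZ; apply: le_Ex => // w.
  have Gi x : G (upd w i x) = G w by apply: eq_bigr => y _; rewrite updK.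
  apply: (@le_trans _ _ (\sum_x p i x * (expR (G w) * (1 + (F (upd w i x) - G w) + 2 * c ^+ 2)))).
    apply: ler_sum => x _; rewrite ler_wpM2l ?(dp i).1 //.
    rewrite -[X in expR X <= _](subrK (G w)) expRD [leRHS]mulrC ler_wpM2r ?expR_ge0 //.
    have := G_near (upd w i x); rewrite Gi => h.
    apply: le_trans (expR_le_quadratic _) _; first by move: h; rewrite ler_norml; lra.
    by rewrite lerD2l ler_wpM2l // -[leLHS]real_normK ?num_real // lerXn2r ?nnegrE.
  rewrite (eq_bigr (fun x => expR (G w) * (p i x * (1 - G w + 2 * c ^+ 2) + p i x * F (upd w i x)))); last by move=> x _; ring.
  rewrite -mulr_sumr big_split /= -mulr_suml (dp i).2 mul1r -/(G w) mulrC.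
  rewrite ler_wpM2r ?expR_ge0 //.
  have -> : 1 - G w + 2 * c ^+ 2 + G w = 1 + 2 * c ^+ 2 by ring.
  exact: expR_ge1Dx.
apply: le_trans step _.
have -> : (size (i :: s))%:R * (2 * c ^+ 2) = 2 * c ^+ 2 + (size s)%:R * (2 * c ^+ 2).
  by rewrite /= -[(size s).+1%:R]natr1; ring.
rewrite expRD -mulrA ler_wpM2l ?expR_ge0 //.
rewrite -(Ex_avg i F dp); apply: IH => [j w x js|j w x js].
  rewrite -sumrB; apply: le_trans (ler_norm_sum _ _ _) _.
  rewrite -[leRHS]mul1r -(dp i).2 mulr_suml; apply: ler_sum => y _.
  have px := (dp i).1 y.
  rewrite -mulrBr normrM ger0_norm // ler_wpM2l //.
  have [->|ij] := eqVneq j i; first by rewrite updK subrr normr0.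
  by rewrite (updC _ _ _ ij) Fc // in_cons js orbT.
apply: eq_bigr => y _; congr (_ * _).
have [->|ij] := eqVneq j i; first by rewrite updK.
by rewrite (updC _ _ _ ij) F0 // in_cons negb_or ij.
Qed.

End Concentration.

(** * Chernoff bounds and the balls-in-bins tail *)

Section Tails.
Variables (R : realType) (I T : finType).
Implicit Types (p : I -> T -> R) (w : {ffun I -> T}).

Definition chance p i (B : pred T) : R := \sum_x p i x * (B x)%:R.

Lemma chance_ge0 p i B : is_dist p -> 0 <= chance p i B.
Proof. by move=> dp; apply: sumr_ge0 => x _; rewrite mulr_ge0 ?(dp i).1. Qed.

Lemma chanceC p i B : is_dist p -> chance p i (fun x => ~~ B x) = 1 - chance p i B.
Proof.
move=> dp; rewrite -(dp i).2 /chance -sumrB; apply: eq_bigr => x _.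
by case: (B x); rewrite /= ?mulr1 ?mulr0 ?subrr ?subr0.
Qed.

Lemma chance_le1 p i B : is_dist p -> chance p i B <= 1.
Proof. by move=> dp; rewrite -subr_ge0 -chanceC // chance_ge0. Qed.

Lemma Ex_prod_in p (A : {set I}) (g : I -> T -> R) : is_dist p ->
  Ex p (fun w => \prod_(i in A) g i (w i)) = \prod_(i in A) \sum_x p i x * g i x.
Proof.
move=> dp; rewrite [RHS]big_mkcond /=.
have := Ex_prod p (fun i x => if i \in A then g i x else 1); rewrite /=.
rewrite [X in _ = X -> _](eq_bigr (fun i => if i \in A then \sum_x p i x * g i x else 1)).
  by move=> <-; apply: eq_Ex => w; rewrite big_mkcond.
move=> i _; case: ifP => // _.
by rewrite -[RHS](dp i).2; apply: eq_bigr => x _; rewrite mulr1.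
Qed.

Lemma card_set_sum (A : {set I}) (P : pred I) :
  #|[set i in A | P i]|%:R = \sum_(i in A) (P i)%:R :> R.
Proof.
rewrite -sum1_card natr_sum; rewrite big_mkcond [RHS]big_mkcond /=.
by apply: eq_bigr => i _; rewrite inE; case: (i \in A) => //; case: (P i).
Qed.

Lemma lower_tail p (A : {set I}) (B : I -> pred T) rho eps : is_dist p ->
  (forall i, i \in A -> rho <= chance p i (B i)) -> 0 <= rho <= 1 -> 0 <= eps <= 1 ->
  Pr p (fun w => #|[set i in A | B i (w i)]|%:R <= (rho - eps) * #|A|%:R)
    <= expR (- (eps ^+ 2 / 8) * #|A|%:R).
Proof.
(* The exponent [2 * l ^+ 2 - l * eps] is least at [l = eps / 4], where it equals
   [- eps ^+ 2 / 8]. *)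
move=> dp rhoB /andP[r0 r1] /andP[e0 e1]; pose l := eps / 4.
have l0 : 0 <= l by rewrite /l; lra.
pose F w : R := \prod_(i in A) expR (- l * (B i (w i))%:R).
have FE w : F w = expR (- l * #|[set i in A | B i (w i)]|%:R).
  by rewrite card_set_sum mulr_sumr expR_sum.
apply: le_trans (@markov _ _ _ _ _ F (expR (- l * ((rho - eps) * #|A|%:R))) dp (expR_gt0 _) _ _) _.
- by move=> w; rewrite FE expR_ge0.
- by move=> w h; rewrite FE ler_expR !mulNr lerN2 ler_wpM2l.
rewrite ler_pdivrMr ?expR_gt0 // -expRD.
rewrite /F (Ex_prod_in A (fun i x => expR (- l * (B i x)%:R)) dp).
apply: (@le_trans _ _ (\prod_(i in A) expR ((2 * l ^+ 2 - l) * rho))).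
  apply: ler_prod => i iA; apply/andP; split.
    by apply: sumr_ge0 => x _; rewrite mulr_ge0 ?expR_ge0 ?(dp i).1.
  have -> : \sum_x p i x * expR (- l * (B i x)%:R) = 1 - (1 - expR (- l)) * chance p i (B i).
    rewrite -[X in _ = X - _](dp i).2 /chance mulr_sumr -sumrB; apply: eq_bigr => x _.
    by case: (B i x); rewrite /= ?(mulr1, mulr0, expR0); ring.
  apply: le_trans (expR_ge1Dx _).
  have h : expR (- l) <= 1 - l + 2 * l ^+ 2.
    by have := @expR_le_quadratic R (- l); rewrite sqrrN; apply; rewrite /l; lra.
  have := rhoB i iA; have := chance_le1 i (B i) dp.
  have : 0 <= 1 - expR (- l) by rewrite subr_ge0 -[leRHS]expR0 ler_expR; lra.
  by nra.
rewrite prodr_const -expRM_natr ler_expR.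
have -> : - (eps ^+ 2 / 8) * #|A|%:R + - l * ((rho - eps) * #|A|%:R)
    = ((2 * l ^+ 2 - l) * rho + 2 * l ^+ 2 * (1 - rho)) * #|A|%:R by rewrite /l; field.
by rewrite ler_wpM2r // lerDl mulr_ge0 ?subr_ge0 // mulr_ge0 // exprn_ge0.
Qed.

Lemma prod_indicator (J : finType) (P : pred J) (b : J -> bool) :
  \prod_(j | P j) (b j)%:R = [forall (j | P j), b j]%:R :> R.
Proof.
case: (boolP [forall (j | P j), b j]) => [/forall_inP h|].
  by rewrite big1 // => j /h ->.
rewrite negb_forall_in => /exists_inP[j Pj /negbTE bj].
by rewrite (bigD1 j) //= bj mul0r.
Qed.

(* Balls-in-bins: indexing the bins by e, the events "bin e stays empty" are
   negatively correlated, because a single coordinate fills at most one bin of S. *)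
Lemma occupancy p (E : finType) (S : {set E}) (H : I -> E -> pred T) q y :
  is_dist p ->
  (forall i x e f, e \in S -> f \in S -> e != f -> H i e x -> ~~ H i f x) ->
  (forall e, e \in S -> \prod_i (1 - chance p i (H i e)) <= q) ->
  0 <= y ->
  Ex p (fun w => (1 + y) ^+ #|[set e in S | [forall i, ~~ H i e (w i)]]|)
    <= (1 + y * q) ^+ #|S|.
Proof.
move=> dp Hdis Hq y0.
have expand (a : E -> R) : \prod_(e in S) (1 + a e) =
    \sum_(J : {set E} | J \subset S) \prod_(e in J) a e.
  pose a' e := if e \in S then a e else 0.
  rewrite big_mkcond /= (eq_bigr (fun e => a' e + 1)); last first.
    by move=> e _; rewrite /a'; case: ifP => _; rewrite ?add0r // addrC.
  rewrite bigA_distr (bigID (fun J : {set E} => J \subset S)) /= [X in _ + X]big1 ?addr0.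
    apply: eq_bigr => J /subsetP JS; rewrite [RHS]big_mkcond /=; apply: eq_bigr => e _.
    by case: ifP => // /JS eS; rewrite /a' eS.
  move=> J /subsetPn[e eJ /negbTE eS].
  by rewrite (bigD1 e) //= eJ /a' eS mul0r.
(* Expanding over subsets J of the bins reduces the exponential moment to the probabilities that all
   bins of J stay empty. *)
have unc w : (1 + y) ^+ #|[set e in S | [forall i, ~~ H i e (w i)]]| =
    \sum_(J : {set E} | J \subset S) y ^+ #|J| * [forall i, [forall (e | e \in J), ~~ H i e (w i)]]%:R.
  transitivity (\prod_(e in S) (1 + y * [forall i, ~~ H i e (w i)]%:R)).
    rewrite -prodr_const big_mkcond [RHS]big_mkcond /=; apply: eq_bigr => e _.
    rewrite inE; case: (e \in S) => //=.
    by case: [forall i, _]; rewrite ?mulr1 ?mulr0 ?addr0.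
  rewrite expand; apply: eq_bigr => J _.
  rewrite big_split /= prodr_const prod_indicator; congr (_ * (nat_of_bool _)%:R).
  apply/forall_inP/forallP => [h i|h e eJ].
    by apply/forall_inP => e /h /forallP.
  by apply/forallP => i; have /forall_inP/(_ e eJ) := h i.
rewrite (eq_Ex p unc) Ex_sum.
have -> : (1 + y * q) ^+ #|S| = \sum_(J : {set E} | J \subset S) y ^+ #|J| * q ^+ #|J|.
  rewrite -prodr_const expand; apply: eq_bigr => J _.
  by rewrite prodr_const exprMn.
apply: ler_sum => J JS; rewrite ExZ ler_wpM2l ?exprn_ge0 //.
rewrite (eq_Ex _ (G := fun w => \prod_i [forall (e | e \in J), ~~ H i e (w i)]%:R)); last first.
  by move=> w; rewrite prod_indicator.
rewrite (Ex_prod p (fun i x => [forall (e | e \in J), ~~ H i e x]%:R)).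
rewrite -prodr_const.
apply: (@le_trans _ _ (\prod_(e in J) \prod_i (1 - chance p i (H i e)))); last first.
  apply: ler_prod => e eJ; rewrite Hq ?(subsetP JS) // andbT.
  by apply: prodr_ge0 => i _; rewrite subr_ge0 chance_le1.
rewrite exchange_big /=; apply: ler_prod => i _; apply/andP; split.
  by apply: sumr_ge0 => x _; rewrite mulr_ge0 ?(dp i).1.
apply: le_trans (weierstrass_prod _); last first.
  by move=> e _; rewrite chance_ge0 ?chance_le1.
rewrite /chance exchange_big -[X in _ <= X - _](dp i).2 -sumrB /=; apply: ler_sum => x _.
rewrite -mulr_sumr -[X in _ <= X - _]mulr1 -mulrBr ler_wpM2l ?(dp i).1 //.
case: (boolP [forall (e | e \in J), ~~ H i e x]) => [/forall_inP h|].
  by rewrite big1 ?subr0 // => e /h /negbTE->.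
rewrite negb_forall_in => /exists_inP[e eJ]; rewrite negbK => He.
rewrite (bigD1 e) //= He big1 ?addr0 ?subrr // => f /andP[fJ fe].
by rewrite (negbTE (Hdis i x e f _ _ _ _)) ?(subsetP JS) // eq_sym.
Qed.

Lemma occupancy_tail p (E : finType) (S : {set E}) (H : I -> E -> pred T) q s a l :
  is_dist p ->
  (forall i x e f, e \in S -> f \in S -> e != f -> H i e x -> ~~ H i f x) ->
  (forall e, e \in S -> \prod_i (1 - chance p i (H i e)) <= q) ->
  0 <= q <= 1 -> #|S|%:R <= s -> 0 <= l <= 2^-1 ->
  Pr p (fun w => q * s + a <= #|[set e in S | [forall i, ~~ H i e (w i)]]|%:R)
    <= expR (2 * l ^+ 2 * s - l * a).
Proof.
move=> dp Hdis Hq /andP[q0 q1] Ss /andP[l0 l2].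
have s0 : 0 <= s by apply: le_trans Ss.
(* With [y = expR l - 1] the moment bounded by [occupancy] is the exponential moment with parameter
   l. *)
pose F w : R := (1 + (expR l - 1)) ^+ #|[set e in S | [forall i, ~~ H i e (w i)]]|.
have FE w : F w = expR (l * #|[set e in S | [forall i, ~~ H i e (w i)]]|%:R).
  by rewrite /F addrC subrK expRM_natr.
apply: le_trans (@markov _ _ _ _ _ F (expR (l * (q * s + a))) dp (expR_gt0 _) _ _) _.
- by move=> w; rewrite FE expR_ge0.
- by move=> w h; rewrite FE ler_expR ler_wpM2l.
rewrite ler_pdivrMr ?expR_gt0 // -expRD.
have y0 : 0 <= expR l - 1 by rewrite subr_ge0 -[leLHS]expR0 ler_expR.
apply: le_trans (occupancy dp Hdis Hq y0) _.
have h1 : 1 + (expR l - 1) * q <= expR ((l + 2 * l ^+ 2) * q).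
  apply: le_trans (expR_ge1Dx _); rewrite lerD2l ler_wpM2r //.
  by have := @expR_le_quadratic R l l2; lra.
apply: (@le_trans _ _ (expR ((l + 2 * l ^+ 2) * q) ^+ #|S|)).
  apply: lerXn2r => //; rewrite nnegrE ?expR_ge0 //.
  by rewrite addr_ge0 // mulr_ge0.
rewrite -expRM_natr ler_expR.
apply: (@le_trans _ _ ((l + 2 * l ^+ 2) * q * s)).
  by rewrite ler_wpM2l // mulr_ge0 // addr_ge0 // mulr_ge0 // exprn_ge0.
have : 2 * l ^+ 2 * s * q <= 2 * l ^+ 2 * s.
  by rewrite -[leRHS]mulr1 ler_wpM2l // mulr_ge0 // mulr_ge0 // exprn_ge0.
lra.
Qed.

End Tails.

(** * Independent coins *)

Section Bernoulli.
Variables (R : realType) (J : finType).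
Implicit Types (h : J -> R) (w : {ffun J -> bool}).

Definition bern h (j : J) (b : bool) : R := if b then h j else 1 - h j.

Lemma bern_dist h : (forall j, 0 <= h j <= 1) -> is_dist (bern h).
Proof.
move=> h01 j; have /andP[h0 h1] := h01 j; split; first by case; rewrite /= ?subr_ge0.
by rewrite big_bool /=; lra.
Qed.

Lemma bern_all_false h (Z : {set J}) : (forall j, 0 <= h j <= 1) ->
  Pr (bern h) (fun w => [forall (z | z \in Z), ~~ w z]) = \prod_(z in Z) (1 - h z).
Proof.
move=> h01; rewrite /Pr.
rewrite (eq_Ex _ (G := fun w => \prod_(z in Z) (~~ w z)%:R)); last first.
  by move=> w; rewrite prod_indicator.
rewrite (Ex_prod_in Z (fun z x => (~~ x)%:R) (bern_dist h01)).
by apply: eq_bigr => z _; rewrite big_bool /= mulr0 mulr1 add0r.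
Qed.

Lemma bern_true_all_false h (z0 : J) (Z : {set J}) : (forall j, 0 <= h j <= 1) -> z0 \notin Z ->
  Pr (bern h) (fun w => w z0 && [forall (z | z \in Z), ~~ w z])
    = h z0 * \prod_(z in Z) (1 - h z).
Proof.
move=> h01 z0Z; rewrite /Pr.
rewrite (eq_Ex _ (G := fun w => \prod_(z in z0 |: Z) ((z == z0) (+) ~~ w z)%:R)); last first.
  move=> w; rewrite prod_indicator; congr (nat_of_bool _)%:R.
  apply/andP/forall_inP => [[wz0 /forall_inP hZ] z|H].
    rewrite in_setU1; case: eqP => [->|_] /=; [by rewrite wz0 | exact: hZ].
  split; first by have := H z0; rewrite setU11 eqxx /= negbK; apply.
  apply/forall_inP => z zZ; have := H z; rewrite setU1r // => /(_ isT).
  by case: eqP => // zz0; rewrite -zz0 zZ in z0Z.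
rewrite (Ex_prod_in _ (fun z x => ((z == z0) (+) ~~ x)%:R) (bern_dist h01)).
rewrite big_setU1 //= big_bool eqxx /= mulr0 mulr1 addr0; congr (_ * _).
apply: eq_bigr => z zZ; rewrite big_bool /=.
have /negbTE-> : z != z0 by apply: contraNneq z0Z => <-.
by rewrite mulr0 mulr1 add0r.
Qed.

End Bernoulli.

(** * The semi-random method *)

Section LineGraph.
Variables (V E : finType) (vs : E -> {set V}).
Implicit Types (X : {set E}) (P : pred E).

Definition meets (e f : E) := ~~ [disjoint vs e & vs f].

Definition adj (e f : E) := (e != f) && meets e f.

Definition star X v := [set e in X | v \in vs e].

Lemma meets_vertexP e f : reflect (exists2 v, v \in vs e & v \in vs f) (meets e f).
Proof. by apply: (iffP pred0Pn) => [[v /andP[ve vf]]|[v ve vf]]; exists v => //; apply/andP. Qed.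

Lemma adjC : symmetric adj.
Proof. by move=> e f; rewrite /adj /meets eq_sym disjoint_sym. Qed.

Lemma adjxx : irreflexive adj.
Proof. by move=> e; rewrite /adj eqxx. Qed.

Lemma card_cover_le (T I : finType) (D : {set I}) (B : {set T}) (F : I -> {set T}) :
  (forall x, x \in B -> exists2 i, i \in D & x \in F i) ->
  (#|B| <= \sum_(i in D) #|F i|)%N.
Proof.
move=> cov; apply: (@leq_trans #|\bigcup_(i in D) F i|).
  by apply/subset_leq_card/subsetP => x /cov[i iD xF]; apply/bigcupP; exists i.
elim/big_rec2: _ => [|i n U _ IH]; first by rewrite cards0.
by apply: leq_trans (leq_card_setU _ _).1 _; rewrite leq_add2l.
Qed.

Lemma card_meets_le X P e :
  (#|[set f in X | P f && meets e f]| <= \sum_(v in vs e) #|[set f in star X v | P f]|)%N.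
Proof.
apply: card_cover_le => f; rewrite inE => /and3P[fX Pf /meets_vertexP[v ve vf]].
by exists v; rewrite // !inE fX vf.
Qed.

End LineGraph.

(** * One random round of the semi-random method *)

Section Bite.
Variables (R : realType) (V E Col : finType) (vs : E -> {set V}).
Variables (F : {set E}) (A : E -> {set Col}) (k L b t : nat) (p x eta s0 : R).

Definition colour_star c v := [set e in F | (v \in vs e) && (c \in A e)].

Hypothesis k_gt0 : (0 < k)%N.
Hypothesis size_le : forall e, e \in F -> (#|vs e| <= k)%N.
Hypothesis codeg_le : forall u v, u != v -> (#|[set e in F | (u \in vs e) && (v \in vs e)]| <= t)%N.
Hypothesis cdeg_le : forall c v, (#|colour_star c v| <= b)%N.
Hypothesis p_bounds : 0 <= p < 1.

(** Since [k * b] bounds the number of conflicts of a colour at an edge, this bounds from below the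
    probability that no conflicting edge chooses the colour; the coins lower every survival
    probability to this value. *)
Definition tau : R := (1 - p) ^+ (k * b).

(** A nonempty edge of F with c in its list is among its own conflicts, so a colour that e tries
    does not survive at e. *)
Definition conflicts c e := [set f in F | (c \in A f) && meets vs e f].

Lemma conflicts_le c e : e \in F -> (#|conflicts c e| <= k * b)%N.
Proof.
move=> eF; apply: leq_trans (card_meets_le vs F (fun f => c \in A f) e) _.
apply: leq_trans (_ : \sum_(v in vs e) b <= _)%N; last first.
  by rewrite sum_nat_const leq_mul2r size_le ?orbT.
apply: leq_sum => v _; apply: leq_trans (cdeg_le c v).
by apply/subset_leq_card/subsetP => f; rewrite !inE -andbA.
Qed.

(* Index (e, false) is the choice of the colour by e, and (e, true) is the coin
   that equalises the survival probabilities of the colour at all edges. *)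
Definition prob c (j : E * bool) : R :=
  if j.2 then (if j.1 \in F then 1 - tau / (1 - p) ^+ #|conflicts c j.1| else 0)
  else if (j.1 \in F) && (c \in A j.1) then p else 0.

Let q0 : 0 < 1 - p.
Proof. by case/andP: p_bounds => _; rewrite subr_gt0. Qed.

Let q1 : 1 - p <= 1.
Proof. by case/andP: p_bounds; lra. Qed.

Let tau_gt0 : 0 < tau.
Proof. exact: exprn_gt0. Qed.

Lemma prob_bounds c j : 0 <= prob c j <= 1.
Proof.
rewrite /prob; case: j => e [] /=; last first.
  by case: ifP => _; rewrite ?lexx ?ler01 //; case/andP: p_bounds => -> /ltW ->.
case: ifP => eF; last by rewrite lexx ler01.
have N0 : 0 < (1 - p) ^+ #|conflicts c e| by exact: exprn_gt0.
apply/andP; split; last by rewrite gerBl divr_ge0 // ltW.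
rewrite subr_ge0 ler_pdivrMr // mul1r.
by rewrite ler_wiXn2l ?conflicts_le // ltW.
Qed.

(** The law of everything that concerns the colour c. A round is a product over colours of these
    spaces, so the tail bounds apply with colours as coordinates. *)
Definition rnd c : {ffun E * bool -> bool} -> R := weight (bern (prob c)).

Lemma rnd_dist : is_dist rnd.
Proof.
move=> c; have d := bern_dist (prob_bounds c).
by split; [move=> w; apply: weight_ge0 | apply: sum_weight].
Qed.

Lemma chance_rnd c B : chance rnd c B = Pr (bern (prob c)) B.
Proof. by []. Qed.

Definition matched c (w : {ffun E * bool -> bool}) e :=
  [&& e \in F, c \in A e, w (e, false) & [forall (f | f \in conflicts c e :\ e), ~~ w (f, false)]].

(** A colour is dropped as soon as a conflicting edge chooses it, whether or not that edge keeps it.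
    This wastes colours, but makes survival a conjunction of independent events. *)
Definition survives c (w : {ffun E * bool -> bool}) e :=
  [forall (f | f \in conflicts c e), ~~ w (f, false)] && ~~ w (e, true).

(** Choices made by edges through v are ignored: a single one of them wipes out the whole star of c
    at v, so the true number of survivors is not concentrated. This upper bound for it is. *)
Definition outer_survivors c (w : {ffun E * bool -> bool}) v :=
  [set e in colour_star c v |
    [forall (f | f \in [set f in conflicts c e | v \notin vs f]), ~~ w (f, false)] && ~~ w (e, true)].

(** A bad colour leaves every list at v, which empties its star there. A small chance of badness,
    absorbed by the lists, thus replaces concentration at all pairs of a colour and a vertex
    simultaneously. *)
Definition bad c w v := s0 < #|outer_survivors c w v|%:R.

Definition new_list (w : {ffun Col -> {ffun E * bool -> bool}}) e :=
  [set c in A e | survives c (w c) e && [forall (v | v \in vs e), ~~ bad c (w c) v]].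

Definition rest (w : {ffun Col -> {ffun E * bool -> bool}}) :=
  [set e in F | [forall c, ~~ matched c (w c) e]].

Lemma matched_disjoint c w e f : matched c w e -> matched c w f -> e != f -> ~~ meets vs e f.
Proof.
move=> /and4P[eF ce we /forall_inP he] /and4P[fF cf wf _] ef; apply/negP => m.
by have := he f; rewrite !inE eq_sym ef fF cf m wf => /(_ isT).
Qed.

(** The colour of a matched edge was chosen by that edge, so it survives at no edge meeting it: the
    remaining edges can be coloured from their new lists without regard to the matched ones. *)
Lemma rest_colouring (c0 : Col) w : exists phi,
  colours (adj vs) (F :\: rest w) A phi /\
  forall e f, e \in rest w -> f \in F :\: rest w -> adj vs e f -> phi f \notin new_list w e.
Proof.
pose phi e := odflt c0 [pick c | matched c (w c) e].
have phiP e : e \in F :\: rest w -> matched (phi e) (w (phi e)) e.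
  rewrite !inE => /andP[+ eF]; rewrite eF /= negb_forall => /existsP[c].
  by rewrite negbK /phi; case: pickP => [c' //|/(_ c) ->].
exists phi; split; first split=> [e /phiP/and4P[]//|e f /phiP me /phiP mf /andP[ef m] eq_ef].
  by move: me; rewrite eq_ef => /matched_disjoint/(_ mf ef)/negP; apply.
move=> e f er /phiP/and4P[fF cf wf _] /andP[ef m]; rewrite inE; apply/negP => /andP[ce /andP[/andP[/forall_inP h _] _]].
by have := h f; rewrite !inE fF cf m wf => /(_ isT).
Qed.

(** The bound separates a condition on the colour c from a condition on the other colours; given the
    first, the second is still random and independent of it. *)
Lemma new_star_sub c v w :
  [set e in rest w | (v \in vs e) && (c \in new_list w e)] \subset
  [set e in outer_survivors c (w c) v | [forall c', (c' != c) ==> ~~ matched c' (w c') e]].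
Proof.
apply/subsetP => e; rewrite inE => /and3P[er ve cn].
case/setIdP: er => eF /forallP unm.
case/setIdP: cn => ce /andP[/andP[/forall_inP h1 h2] _].
apply/setIdP; split; last by apply/forallP => c'; apply/implyP.
apply/setIdP; split; first by rewrite inE eF ve ce.
apply/andP; split=> //.
by apply/forall_inP => f /setIdP[/h1].
Qed.

Lemma new_star_bad c v (w : {ffun Col -> {ffun E * bool -> bool}}) : bad c (w c) v ->
  [set e in rest w | (v \in vs e) && (c \in new_list w e)] = set0.
Proof.
move=> bd; apply/setP => e; rewrite !inE; apply/negP => /and3P[_ ve /andP[_ /andP[_ /forall_inP/(_ v ve)]]].
by rewrite bd.
Qed.

(** The coordinates that must be false for survival: the choices of Z and the coin of e. As one set
    they give a single product. *)
Definition silence (Z : {set E}) e : {set E * bool} :=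
  [set j : E * bool | if j.2 then j.1 == e else j.1 \in Z].

Lemma silenceP (w : {ffun E * bool -> bool}) (Z : {set E}) e :
  [forall (f | f \in Z), ~~ w (f, false)] && ~~ w (e, true)
  = [forall (j | j \in silence Z e), ~~ w j].
Proof.
apply/andP/forall_inP => [[/forall_inP h1 h2] [f []]|h]; rewrite ?inE /=.
- by move=> /eqP->.
- exact: h1.
- split; last by apply: h; rewrite inE /= eqxx.
  by apply/forall_inP => f fZ; apply: h; rewrite inE.
Qed.

Lemma prod_silence c (Z : {set E}) e : Z \subset [set f in F | c \in A f] -> e \in F ->
  \prod_(j in silence Z e) (1 - prob c j)
  = (1 - p) ^+ #|Z| * (tau / (1 - p) ^+ #|conflicts c e|).
Proof.
move=> /subsetP ZF eF.
rewrite (eq_bigl (fun j : E * bool => if j.2 then j.1 == e else j.1 \in Z)); last by move=> j; rewrite inE.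
rewrite -(pair_big_dep predT (fun f s => if s then f == e else f \in Z) (fun f s => 1 - prob c (f, s))) /=.
rewrite (eq_bigr (fun f => (if f \in Z then 1 - p else 1) * (if f == e then tau / (1 - p) ^+ #|conflicts c e| else 1))).
  by rewrite big_split /= -!big_mkcond /= prodr_const big_pred1_eq.
move=> f _; rewrite big_mkcond big_bool /= mulrC /prob /=; congr (_ * _).
  by case: ifP => // /ZF; rewrite inE => ->.
by case: ifP => // /eqP->; rewrite eF opprB addrC subrK.
Qed.

Lemma chance_silence c (Z : {set E}) e : Z \subset [set f in F | c \in A f] -> e \in F ->
  chance rnd c (fun w => [forall (f | f \in Z), ~~ w (f, false)] && ~~ w (e, true))
  = (1 - p) ^+ #|Z| * (tau / (1 - p) ^+ #|conflicts c e|).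
Proof.
move=> ZF eF; rewrite chance_rnd -prod_silence //.
rewrite -(bern_all_false _ (prob_bounds c)); apply: eq_Ex => w.
by rewrite silenceP.
Qed.

Lemma conflicts_sub c e : conflicts c e \subset [set f in F | c \in A f].
Proof. by apply/subsetP => f; rewrite !inE => /and3P[-> ->]. Qed.

Lemma chance_survives c e : e \in F -> chance rnd c (survives c ^~ e) = tau.
Proof.
move=> eF; rewrite (chance_silence (conflicts_sub c e) eF) mulrC divfK //.
by rewrite expf_neq0 // gt_eqF.
Qed.

Lemma chance_matched c e : e \in F -> c \in A e ->
  p * (1 - p) ^+ (k * b) <= chance rnd c (matched c ^~ e).
Proof.
move=> eF ce; rewrite chance_rnd.
pose Z : {set E * bool} := [set j : E * bool | (j.1 \in conflicts c e :\ e) && ~~ j.2].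
have eZ : (e, false) \notin Z by rewrite !inE eqxx.
have := bern_true_all_false (prob_bounds c) eZ.
have -> : Pr (bern (prob c)) (fun w => w (e, false) && [forall (z | z \in Z), ~~ w z])
    = Pr (bern (prob c)) (matched c ^~ e).
  apply: eq_Ex => w; rewrite /matched eF ce /=; congr (nat_of_bool (_ && _))%:R.
  apply/forall_inP/forall_inP => h; first by move=> f fe; apply: h; rewrite inE fe.
  by case=> f s; rewrite inE => /andP[/h + /negbTE /= ->].
move=> ->; rewrite {1}/prob /= eF ce /=; case/andP: p_bounds => p0 p1.
rewrite ler_wpM2l //.
have -> : \prod_(z in Z) (1 - prob c z) = (1 - p) ^+ #|conflicts c e :\ e|.
  rewrite (eq_bigl (fun j : E * bool => (j.1 \in conflicts c e :\ e) && ~~ j.2)); last by move=> j; rewrite inE.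
  rewrite -(pair_big_dep (fun f => f \in conflicts c e :\ e) (fun _ s => ~~ s) (fun f s => 1 - prob c (f, s))) /=.
  rewrite -prodr_const; apply: eq_bigr => f.
  rewrite !inE => /and4P[_ fF cf _].
  by rewrite big_mkcond big_bool /= mul1r /prob /= fF cf.
rewrite ler_wiXn2l // ?ltW //; apply: leq_trans (conflicts_le c eF).
by rewrite subset_leq_card // subsetDl.
Qed.

(** * Variance of the number of survivors at a vertex *)

Section SecondMoment.
Variables (c : Col) (v : V).
Let C := colour_star c v.
Let outer e := [set f in conflicts c e | v \notin vs f].
Let ind (e : E) (w : {ffun E * bool -> bool}) : bool :=
  [forall (f | f \in outer e), ~~ w (f, false)] && ~~ w (e, true).
Let y : R := tau / (1 - p) ^+ #|C|.
Let near e e' := (e == e') || [exists u, [&& u != v, u \in vs e & u \in vs e']].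

Hypothesis x_def : x = (k * k * t)%:R * p.
Hypothesis x_le : x <= 2^-1.

Let outer_sub e : outer e \subset [set f in F | c \in A f].
Proof. by apply/subsetP => f /setIdP[/(subsetP (conflicts_sub c e))]. Qed.

Let y_ge0 : 0 <= y.
Proof. by rewrite divr_ge0 ?exprn_ge0 // ltW. Qed.

Let y_le1 : y <= 1.
Proof.
rewrite ler_pdivrMr ?exprn_gt0 // mul1r (ler_wiXn2l (ltW q0) q1) //.
by apply: leq_trans (cdeg_le c v) _; rewrite leq_pmull.
Qed.

(** The conflicts of an edge through v split into the whole colour star at v and the outer
    conflicts. After equalisation to [tau], leaving out the star gives the same probability y for
    every edge of it. *)
Let prod_outer e : e \in C -> \prod_(j in silence (outer e) e) (1 - prob c j) = y.
Proof.
move=> eC; have eF : e \in F by case/setIdP: eC.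
rewrite (prod_silence (outer_sub e) eF).
have -> : #|conflicts c e| = (#|C| + #|outer e|)%N.
  rewrite -(cardsID [set f | v \in vs f]); congr (_ + _)%N; apply: eq_card => f.
    rewrite !inE; have [/=|] := boolP (v \in vs f); rewrite ?andbF //= andbT => vf.
    have -> : meets vs e f by apply/meets_vertexP; exists v => //; move: eC; rewrite inE => /and3P[].
    by rewrite andbT.
  by rewrite !inE andbC.
have := expf_neq0 #|C| (lt0r_neq0 q0); have := expf_neq0 #|outer e| (lt0r_neq0 q0).
rewrite exprD /y; move: (_ ^+ #|outer e|) (_ ^+ #|C|) => X1 X2 n1 n2; field.
by rewrite n1 n2.
Qed.

Let Ex_ind e : e \in C -> Ex (bern (prob c)) (fun w => (ind e w)%:R) = y.
Proof.
move=> eC; rewrite -(prod_outer eC) -(bern_all_false _ (prob_bounds c)).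
by apply: eq_Ex => w; rewrite /ind silenceP.
Qed.

(** A common outer conflict meets e in u and e' in u'. If u = u', this vertex differs from v, which
    the conflict avoids, and so makes the pair near. Hence u and u' differ: at most [k * k] pairs,
    each in at most t edges. *)
Let outer_cap e e' : e \in C -> e' \in C -> ~~ near e e' ->
  (#|outer e :&: outer e'| <= k * k * t)%N.
Proof.
rewrite negb_or negb_exists => eC e'C /andP[_ /forallP far].
pose D := [set u : V * V | (u.1 \in vs e) && (u.2 \in vs e') && (u.1 != u.2)].
apply: leq_trans (_ : \sum_(u in D) t <= _)%N; last first.
  rewrite sum_nat_const leq_mul2r; apply/orP; right.
  apply: leq_trans (_ : #|setX (vs e) (vs e')| <= _)%N.
    by apply/subset_leq_card/subsetP => u; rewrite !inE => /andP[->].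
  by rewrite cardsX leq_mul // size_le //; [case/setIdP: eC | case/setIdP: e'C].
apply: leq_trans (_ : \sum_(u in D) #|[set f in F | (u.1 \in vs f) && (u.2 \in vs f)]| <= _)%N; last first.
  by apply: leq_sum => u; rewrite inE => /andP[_ ne]; apply: codeg_le.
apply: card_cover_le => f; rewrite !inE.
move=> /andP[/andP[/and3P[fF _ /meets_vertexP[u ue uf]] vf] /andP[/and3P[_ _ /meets_vertexP[u' ue' uf']] _]].
exists (u, u'); rewrite !inE /= ?fF ?uf //= ue ue' /=.
apply/eqP => uu; have := far u; rewrite ue uu ue' /= !andbT negbK => /eqP u'v.
by move: vf; rewrite -u'v uf'.
Qed.

(** The events of a far pair share only the choices of the m common outer conflicts, so their joint
    probability is y^2 / (1 - p)^m. Bernoulli gives (1 - p)^m >= 1 - x, and 1 / (1 - x) <= 1 + 2 x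
    for x at most 1/2. *)
Let Ex_ind2 e e' : e \in C -> e' \in C ->
  Ex (bern (prob c)) (fun w => (ind e w)%:R * (ind e' w)%:R) <= (near e e')%:R + y ^+ 2 * (1 + 2 * x).
Proof.
move=> eC e'C; have d := bern_dist (prob_bounds c).
have x0 : 0 <= x by rewrite x_def mulr_ge0 //; case/andP: p_bounds.
have yx : 0 <= y ^+ 2 * (1 + 2 * x) by rewrite mulr_ge0 ?exprn_ge0 //; lra.
have [nr|far] := boolP (near e e').
  apply: (@le_trans _ _ 1); last by rewrite /=; lra.
  rewrite -[leRHS](Ex_cst 1 d); apply: le_Ex => // w.
  by rewrite -natrM mulnb lern1 leq_b1.
rewrite /= add0r.
have -> : Ex (bern (prob c)) (fun w => (ind e w)%:R * (ind e' w)%:R)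
    = \prod_(j in silence (outer e) e :|: silence (outer e') e') (1 - prob c j).
  rewrite -(bern_all_false _ (prob_bounds c)); apply: eq_Ex => w.
  rewrite -natrM mulnb; congr (nat_of_bool _)%:R; rewrite /ind !silenceP.
  apply/andP/forall_inP => [[/forall_inP h1 /forall_inP h2] j /setUP[/h1|/h2]//|h].
  by split; apply/forall_inP => j js; apply: h; rewrite inE js ?orbT.
set Z1 := silence _ e; set Z2 := silence _ e'.
have -> : \prod_(j in Z1 :|: Z2) (1 - prob c j)
    = y * \prod_(j in Z2 :\: Z1) (1 - prob c j).
  rewrite -(prod_outer eC) (big_setID Z1) /=.
  by rewrite setDUl setDv set0U (setIidPr (subsetUl _ _)).
rewrite expr2 -mulrA ler_wpM2l //.
have cap : \prod_(j in Z2 :&: Z1) (1 - prob c j) = (1 - p) ^+ #|outer e :&: outer e'|.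
  rewrite (eq_bigl (fun j : E * bool => (j.1 \in outer e :&: outer e') && ~~ j.2)); last first.
    case=> f s; rewrite !inE /=; case: s; rewrite /= ?andbF ?andbT; last by rewrite andbC.
    apply/negP => /andP[/eqP-> /eqP ee]; move: far; rewrite /near ee eqxx //.
  rewrite -(pair_big_dep (fun f => f \in outer e :&: outer e') (fun _ s => ~~ s) (fun f s => 1 - prob c (f, s))) /=.
  rewrite -prodr_const; apply: eq_bigr => f.
  rewrite inE => /andP[/(subsetP (outer_sub e))]; rewrite inE => /andP[fF cf] _.
  by rewrite big_mkcond big_bool /= mul1r /prob /= fF cf.
have split2 : y = (1 - p) ^+ #|outer e :&: outer e'| * \prod_(j in Z2 :\: Z1) (1 - prob c j).
  by rewrite -cap -(prod_outer e'C) (big_setID Z1).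
have P0 : 0 <= \prod_(j in Z2 :\: Z1) (1 - prob c j).
  by apply: prodr_ge0 => j _; have /andP[_] := prob_bounds c j; rewrite subr_ge0.
rewrite [leRHS]mulrC split2 mulrA ler_peMl //.
have m_le := outer_cap eC e'C far.
have /andP[p0 p1] := p_bounds.
have h : 1 - x <= (1 - p) ^+ #|outer e :&: outer e'|.
  apply: le_trans (@bernoulli_le R p _ _); last by rewrite p0 ltW.
  by rewrite x_def lerD2l lerN2 ler_wpM2r // ler_nat.
have h1 : 0 <= x * (1 - 2 * x) by rewrite mulr_ge0 //; move: x_le; lra.
have h2 : 0 <= 1 + 2 * x by lra.
have := ler_wpM2l h2 h; lra.
Qed.

Let card_near e : e \in C -> (#|[set e' in C | near e e']| <= (k * t).+1)%N.
Proof.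
move=> eC; have eF : e \in F by case/setIdP: eC.
apply: leq_trans (_ : #|e |: [set e' in C | [exists u, [&& u != v, u \in vs e & u \in vs e']]]| <= _)%N.
  apply/subset_leq_card/subsetP => e'; rewrite !inE => /andP[-> /orP[/eqP->|->]].
    by rewrite eqxx.
  by rewrite orbT.
apply: leq_trans (leq_card_setU _ _).1 _; rewrite cards1 add1n ltnS.
apply: leq_trans (_ : \sum_(u in vs e :\ v) t <= _)%N; last first.
  rewrite sum_nat_const leq_mul2r; apply/orP; right.
  by apply: leq_trans (size_le eF); rewrite subset_leq_card // subsetDl.
apply: leq_trans (_ : \sum_(u in vs e :\ v) #|[set f in F | (u \in vs f) && (v \in vs f)]| <= _)%N; last first.
  by apply: leq_sum => u; rewrite !inE => /andP[uv _]; apply: codeg_le.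
apply: card_cover_le => f; rewrite !inE => /andP[/and3P[fF vf _] /existsP[u /and3P[uv ue uf]]].
by exists u; rewrite !inE ?uv // fF uf.
Qed.

(** Near pairs, at most [(k * t).+1] per edge, are estimated by 1; all others are nearly
    uncorrelated by [Ex_ind2]. *)
Lemma second_moment :
  Ex (bern (prob c)) (fun w => (#|outer_survivors c w v|%:R - y * #|C|%:R) ^+ 2)
  <= #|C|%:R * (k * t).+1%:R + 2 * x * #|C|%:R ^+ 2.
Proof.
have d := bern_dist (prob_bounds c).
have x0 : 0 <= x by rewrite x_def mulr_ge0 //; case/andP: p_bounds.
have SE w : #|outer_survivors c w v|%:R = \sum_(e in C) (ind e w)%:R :> R by rewrite -card_set_sum.
pose m := y * #|C|%:R.
have -> : Ex (bern (prob c)) (fun w => (#|outer_survivors c w v|%:R - y * #|C|%:R) ^+ 2)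
    = \sum_(e in C) \sum_(e' in C) Ex (bern (prob c)) (fun w => (ind e w)%:R * (ind e' w)%:R)
      + (- (2 * m) * \sum_(e in C) Ex (bern (prob c)) (fun w => (ind e w)%:R) + m ^+ 2).
  rewrite (eq_Ex _ (G := fun w => (\sum_(e in C) \sum_(e' in C) (ind e w)%:R * (ind e' w)%:R)
     + ((- (2 * m)) * (\sum_(e in C) (ind e w)%:R) + m ^+ 2))); last first.
    move=> w; rewrite SE -/m.
    have -> : \sum_(e in C) \sum_(e' in C) (ind e w)%:R * (ind e' w)%:R = (\sum_(e in C) (ind e w)%:R) ^+ 2 :> R.
      by rewrite expr2 mulr_suml; apply: eq_bigr => e _; rewrite mulr_sumr.
    by move: (\sum_(e in C) _) => s; ring.
  rewrite !ExD ExZ Ex_cst // !Ex_sum; congr (_ + _).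
  by apply: eq_bigr => e _; rewrite Ex_sum.
rewrite [X in _ * X + _](eq_bigr (fun=> y)); last by move=> e; apply: Ex_ind.
rewrite sumr_const -[y *+ _]mulr_natr -/m.
apply: (@le_trans _ _ (\sum_(e in C) \sum_(e' in C) ((near e e')%:R + y ^+ 2 * (1 + 2 * x)) - m ^+ 2)).
  have -> : - (2 * m) * m + m ^+ 2 = - m ^+ 2 by ring.
  rewrite lerD2r; apply: ler_sum => e eC; apply: ler_sum => e' e'C; exact: Ex_ind2.
apply: (@le_trans _ _ (\sum_(e in C) ((k * t).+1%:R + y ^+ 2 * (1 + 2 * x) * #|C|%:R) - m ^+ 2)).
  rewrite lerD2r; apply: ler_sum => e eC.
  rewrite big_split /= sumr_const -[_ *+ #|C|]mulr_natr lerD2r -card_set_sum ler_nat.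
  exact: card_near.
rewrite sumr_const -[_ *+ #|C|]mulr_natr /m.
have y2 : y ^+ 2 <= 1 by rewrite expr_le1.
have C0 : 0 <= 2 * x * #|C|%:R ^+ 2 by rewrite mulr_ge0 ?exprn_ge0 // mulr_ge0.
have := ler_wpM2r C0 y2; rewrite mul1r.
nra.
Qed.

Lemma chance_bad (a : R) : 0 < a -> s0 = b%:R * (1 - p) ^+ (k.-1 * b) + a ->
  chance rnd c (bad c ^~ v) <= (b%:R * (k * t).+1%:R + 2 * x * b%:R ^+ 2) / a ^+ 2.
Proof.
move=> a0 s0_def; rewrite chance_rnd.
have x0 : 0 <= x by rewrite x_def mulr_ge0 //; case/andP: p_bounds.
have db := cdeg_le c v; rewrite -/C in db.
have /andP[p0 p1] := p_bounds.
(* Here y is (1 - p)^(k b - |C|), so the mean is largest when the star has its full size b. *)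
have yd : y * #|C|%:R <= b%:R * (1 - p) ^+ (k.-1 * b).
  have -> : y = (1 - p) ^+ (k.-1 * b) * (1 - p) ^+ (b - #|C|).
    rewrite /y /tau -exprD -{1}(prednK k_gt0) mulSn.
    have -> : (b + k.-1 * b = k.-1 * b + (b - #|C|) + #|C|)%N by rewrite -addnA subnK // addnC.
    by rewrite [in LHS]exprD mulfK // expf_neq0 // gt_eqF.
  rewrite -mulrA [leRHS]mulrC ler_wpM2l ?exprn_ge0 ?(ltW q0) //.
  apply: (@le_trans _ _ #|C|%:R); last by rewrite ler_nat.
  by rewrite ler_piMl // exprn_ile1 // ltW.
apply: (@le_trans _ _ (Ex (bern (prob c)) (fun w => (#|outer_survivors c w v|%:R - y * #|C|%:R) ^+ 2) / a ^+ 2)).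
  apply: markov => [||w|w bd]; rewrite ?exprn_gt0 ?sqr_ge0 //; first exact: bern_dist (prob_bounds c).
  rewrite lerXn2r ?nnegrE ?ltW //; move: bd; rewrite /bad s0_def; lra.
rewrite ler_pM2r ?invr_gt0 ?exprn_gt0 //; apply: le_trans second_moment _.
by rewrite lerD // ?ler_wpM2l ?mulr_ge0 // ?ler_wpM2r // ?lerXn2r ?nnegrE // ler_nat.
Qed.

End SecondMoment.

(** * Tail bounds for lists, degrees and colour degrees after a round *)

Section Outcome.
Variables (q a l : R).
Hypothesis list_size : forall e, e \in F -> #|A e| = L.
Hypothesis eta_bad : forall c v, chance rnd c (bad c ^~ v) <= eta.
Hypothesis q_bounds : 0 <= q <= 1.
Hypothesis q_bound : (1 - p * (1 - p) ^+ (k * b)) ^+ L.-1 <= q.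
Hypothesis l_bounds : 0 <= l <= 2^-1.

(** A colour stays in the list of e unless it fails to survive or is bad at one of at most k
    vertices, and different colours are independent. *)
Lemma Pr_short_list e eps : e \in F -> 0 <= eps <= 1 -> 0 <= eta -> 0 <= tau - k%:R * eta ->
  Pr rnd (fun w => #|new_list w e|%:R <= (tau - k%:R * eta - eps) * L%:R)
    <= expR (- (eps ^+ 2 / 8) * L%:R).
Proof.
move=> eF eps01 eta0 rho0; rewrite -(list_size eF).
apply: (lower_tail rnd_dist (B := fun c x => survives c x e && [forall (v | v \in vs e), ~~ bad c x v])) => //.
  move=> c ce.
  apply: (@le_trans _ _ (chance rnd c (survives c ^~ e) - \sum_(v in vs e) chance rnd c (bad c ^~ v))).
    rewrite (chance_survives c eF) lerD2l lerN2.
    apply: (@le_trans _ _ (\sum_(v in vs e) eta)); first exact: ler_sum.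
    by rewrite sumr_const -[eta *+ _]mulr_natl ler_wpM2r // ler_nat size_le.
  rewrite /chance exchange_big -sumrB; apply: ler_sum => w _.
  rewrite -mulr_sumr -mulrBr ler_wpM2l ?(rnd_dist c).1 //.
  case: (survives c w e) => /=; last by rewrite sub0r oppr_le0 sumr_ge0.
  case: (boolP [forall (v | v \in vs e), ~~ bad c w v]) => [_|].
    by rewrite gerBl sumr_ge0.
  rewrite negb_forall_in => /exists_inP[v ve]; rewrite negbK => bd.
  by rewrite subr_le0 (bigD1 v) //= bd lerDl sumr_ge0.
rewrite rho0 /=; apply: (@le_trans _ _ tau); first by rewrite gerBl mulr_ge0.
by rewrite exprn_ile1 // ltW.
Qed.

(** One colour is left out so that it can be conditioned on in [Pr_big_colour_star]; it may cost one
    member of the list, hence the exponent [L.-1]. *)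
Lemma prod_unmatched e (c0 : Col) : e \in F ->
  \prod_c (1 - chance rnd c (fun w => (c != c0) && matched c w e)) <= q.
Proof.
move=> eF; have d := rnd_dist; have /andP[p0 p1] := p_bounds.
have m0 : 0 <= (1 - p) ^+ (k * b) by rewrite exprn_ge0 // ltW.
have m1 : (1 - p) ^+ (k * b) <= 1 by rewrite exprn_ile1 // ltW.
have u0 : 0 <= 1 - p * (1 - p) ^+ (k * b) by rewrite subr_ge0 mulr_ile1 // ltW.
have u1 : 1 - p * (1 - p) ^+ (k * b) <= 1 by rewrite gerBl mulr_ge0.
apply: le_trans q_bound.
apply: (@le_trans _ _ (\prod_(c in A e :\ c0) (1 - p * (1 - p) ^+ (k * b)))); last first.
  rewrite prodr_const ler_wiXn2l // -(list_size eF).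
  by rewrite (cardsD1 c0 (A e)); case: (c0 \in A e); rewrite //= leq_pred.
rewrite [leRHS]big_mkcond /=; apply: ler_prod => c _; rewrite subr_ge0 chance_le1 //=.
case: ifP => [|_]; last by rewrite gerBl chance_ge0.
rewrite !inE => /andP[-> ce] /=; rewrite lerD2l lerN2; exact: chance_matched.
Qed.

Lemma prod_unmatched_all e : e \in F -> \prod_c (1 - chance rnd c (matched c ^~ e)) <= q.
Proof.
move=> eF; have d := rnd_dist; have /andP[p0 p1] := p_bounds.
(* Without colours the lists are empty, and the empty product and the power with exponent [L.-1 = 0]
   are both 1. *)
have [c0 _|noc] := pickP Col; last first.
  rewrite big_pred0 //; case/andP: q_bounds => _.
  have L0 : L = 0%N by rewrite -(list_size eF); apply: eq_card0 => c; have := noc c.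
  by move: q_bound; rewrite L0 expr0.
apply: le_trans (prod_unmatched c0 eF); apply: ler_prod => c _.
rewrite subr_ge0 chance_le1 //= lerD2l lerN2.
by apply: ler_sum => w _; rewrite ler_wpM2l ?(d c).1 // ler_nat; case: (c != c0) => /=.
Qed.

Lemma matched_star c v w e f : v \in vs e -> v \in vs f -> e != f -> matched c w e -> ~~ matched c w f.
Proof.
move=> ve vf ef me; apply/negP => mf; have := matched_disjoint me mf ef.
by move/negP; apply; apply/meets_vertexP; exists v.
Qed.

(** Colours are balls and edges at v are bins: a colour is taken by at most one edge through v. *)
Lemma Pr_big_star v Delta : #|star vs F v|%:R <= Delta ->
  Pr rnd (fun w => q * Delta + a <= #|star vs (rest w) v|%:R) <= expR (2 * l ^+ 2 * Delta - l * a).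
Proof.
move=> deg.
have -> : Pr rnd (fun w => q * Delta + a <= #|star vs (rest w) v|%:R)
    = Pr rnd (fun w => q * Delta + a <= #|[set e in star vs F v | [forall c, ~~ matched c (w c) e]]|%:R).
  apply: eq_Ex => w; congr (nat_of_bool (_ <= _%:R))%:R; apply: eq_card => e.
  by rewrite !inE andbAC.
apply: (@occupancy_tail _ _ _ rnd _ (star vs F v) (fun c e x => matched c x e) q Delta a l rnd_dist) => //.
  by move=> c w e f /setIdP[_ ve] /setIdP[_ vf] ef me; exact: (matched_star ve vf ef me).
by move=> e /setIdP[eF _]; apply: prod_unmatched_all.
Qed.

(** Fix everything about the colour c. If c is bad at v the new star is empty. Otherwise at most
    [s0] edges are left, and the other colours leave each of them unmatched with probability at most
    q. *)
Lemma Pr_big_colour_star c v : 0 < a -> 0 <= s0 ->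
  Pr rnd (fun w => q * s0 + a <= #|[set e in rest w | (v \in vs e) && (c \in new_list w e)]|%:R)
    <= expR (2 * l ^+ 2 * s0 - l * a).
Proof.
move=> a0 s00; have /andP[q0' _] := q_bounds; rewrite /Pr (Ex_mix [set c] _ rnd_dist).
rewrite -[leRHS](Ex_cst _ rnd_dist); apply: le_Ex => [|w1]; first exact: rnd_dist.
pose S := outer_survivors c (w1 c) v.
have [bd|/negP nbd] := boolP (bad c (w1 c) v).
  apply: le_trans (expR_ge0 _); rewrite -[leRHS](Ex_cst 0 rnd_dist); apply: le_Ex => [|w2]; first exact: rnd_dist.
  have qa : 0 < q * s0 + a by apply: ltr_pwDr => //; apply: mulr_ge0.
  have bd' : bad c (mix [set c] w1 w2 c) v by rewrite ffunE set11.
  by rewrite (new_star_bad bd') cards0 (lt_geF qa).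
have S_le : #|S|%:R <= s0 by rewrite leNgt; apply/negP.
apply: le_trans (occupancy_tail a (H := fun c' e x => (c' != c) && matched c' x e) rnd_dist _ _ q_bounds S_le l_bounds).
- apply: le_Pr => [|w2 h]; first exact: rnd_dist.
  apply: le_trans h _; rewrite ler_nat; apply: leq_trans (subset_leq_card (new_star_sub _ _ _)) _.
  apply/subset_leq_card/subsetP => e /setIdP[]; rewrite ffunE inE eqxx => eS /forallP h.
  apply/setIdP; split=> //; apply/forallP => c'; have := h c'; rewrite negb_and ffunE inE.
  by case: eqP.
- move=> c' w e f; rewrite !inE => /andP[/and3P[_ ve _] _] /andP[/and3P[_ vf _] _] ef /andP[_ me].
  by rewrite negb_and (matched_star ve vf ef me) orbT.
- by move=> e; rewrite !inE => /andP[/and3P[eF _ _] _]; apply: prod_unmatched.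
Qed.

End Outcome.

End Bite.

Section Misc.
Variable R : realType.

Lemma nat_ge (x : R) : exists n : nat, forall m, (n <= m)%N -> x <= m%:R.
Proof.
exists (Num.truncn x).+1 => m nm; apply: (@le_trans _ _ (Num.truncn x).+1%:R); last by rewrite ler_nat.
by rewrite ltW // truncnS_gt.
Qed.

Lemma exp_beats_poly (C kappa : R) d : 0 <= C -> 0 < kappa ->
  exists L0 : nat, forall L : nat, (L0 <= L)%N -> C * L%:R ^+ d * expR (- (kappa * L%:R)) < 1.
Proof.
move=> C0 k0; have f0 : 0 < d.+1`!%:R :> R by rewrite ltr0n fact_gt0.
have k0' : 0 < kappa ^+ d.+1 by rewrite exprn_gt0.
have [n hn] := nat_ge (C * d.+1`!%:R / kappa ^+ d.+1).
exists n => L /hn h; rewrite expRN ltr_pdivrMr ?expR_gt0 // mul1r.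
have L0 : 0 <= L%:R :> R by [].
apply: lt_le_trans (expR_ge1Dxn d _); last by rewrite mulr_ge0 // ltW.
rewrite ltr_pwDl // ler_pdivlMr // exprMn (exprS L%:R).
move: h; rewrite ler_pdivrMr // => h.
have := ler_wpM2r (exprn_ge0 d L0) h; lra.
Qed.

Lemma sum_lt1 (J : finType) (P : pred J) (F : J -> R) : (forall j, P j -> 0 <= F j) ->
  \sum_(j | P j) F j < 1 -> forall j, P j -> F j < 1.
Proof.
move=> F0 S1 j Pj; apply: le_lt_trans S1; rewrite (bigD1 j) //= lerDl.
by apply: sumr_ge0 => i /andP[/F0].
Qed.

Lemma ind_lt1 (b : bool) : (b%:R < 1 :> R) = ~~ b.
Proof. by case: b; rewrite ?ltxx ?ltr01. Qed.

End Misc.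

(** The estimates for a round assume lists of one common length; surplus colours are thrown away. *)
Definition shrink (T : finType) n (S : {set T}) : {set T} := [set x in take n (enum S)].

Lemma shrink_sub (T : finType) n (S : {set T}) : shrink n S \subset S.
Proof. by apply/subsetP => x; rewrite inE => /mem_take; rewrite mem_enum. Qed.

Lemma card_shrink (T : finType) n (S : {set T}) : (n <= #|S|)%N -> #|shrink n S| = n.
Proof.
move=> nS; rewrite cardsE (card_uniqP _) ?take_uniq ?enum_uniq //.
by rewrite size_takel // -cardE.
Qed.

(** * Evolution of lists and degrees during a round *)

Section Nibble.
Variable R : realType.

Definition codegree_le (V E : finType) (vs : E -> {set V}) (F : {set E}) t :=
  forall u v, u != v -> (#|[set e in F | (u \in vs e) && (v \in vs e)]| <= t)%N.

Lemma codegree_leS (V E : finType) (vs : E -> {set V}) (F F' : {set E}) t :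
  F' \subset F -> codegree_le vs F t -> codegree_le vs F' t.
Proof.
move=> /subsetP FF h u v uv; apply: leq_trans (h u v uv).
by apply/subset_leq_card/subsetP => e /setIdP[/FF eF h']; apply/setIdP.
Qed.

(** Here theta is the expected number of colours an edge tries. Up to small errors lists shrink by
    [tau] and colour stars by at most tau (1 - theta) / (1 - theta (1 - delta)), so relative to the
    lists the stars gain about theta delta. The bound (k + 3) theta <= delta / 2 makes this gain
    beat all terms of order theta^2, and what remains absorbs the random errors. The lower bound on
    Delta makes an additive error [eps * L] negligible for degrees. *)
Lemma nibble_step (k : nat) (delta theta gam B : R) :
  (0 < k)%N -> 0 < delta < 1 -> 0 < theta -> (k%:R + 3) * theta <= delta / 2 ->
  (k%:R + 3) * theta <= 4^-1 -> 0 < gam -> 2 <= B ->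
  exists (eps1 : R) (L0 : nat), 0 < eps1 /\
  forall (V E Col : finType) (c0 : Col) (vs : E -> {set V}) (F : {set E}) (A : E -> {set Col})
    (L t : nat) (Delta : R),
    (forall e, e \in F -> (#|vs e| <= k)%N) -> codegree_le vs F t ->
    t%:R <= eps1 * L%:R -> (L0 <= L)%N ->
    (forall e, e \in F -> #|A e| = L) ->
    (forall c v, #|colour_star vs F A c v|%:R <= (1 - delta) * L%:R) ->
    (forall v, #|star vs F v|%:R <= Delta) -> gam * L%:R <= Delta -> Delta <= B * L%:R ->
    #|F|%:R <= B * L%:R ^+ 3 ->
  exists (L' : nat) (F' : {set E}) (A' : E -> {set Col}) (phi : E -> Col),
    [/\ (L <= 4 * L')%N, (L' <= L)%N, F' \subset F,
        forall e, e \in F' -> A' e \subset A e &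
        [/\ forall e, e \in F' -> #|A' e| = L',
        colours (adj vs) (F :\: F') A phi,
        forall e f, e \in F' -> f \in F :\: F' -> adj vs e f -> phi f \notin A' e,
        forall c v, #|colour_star vs F' A' c v|%:R <= (1 - delta) * L'%:R &
        forall v, #|star vs F' v|%:R <= (1 - theta / 2) * Delta]].
Proof.
move=> k0 /andP[d0 d1] th0 thd th4 g0 B2.
pose K : R := k%:R; have K1 : 1 <= K by rewrite ler1n.
(* The first bound serves the colour stars, the second the vertex degrees, the third is numerical
   slack. *)
pose eps : R := Num.min (Num.min ((1 - delta) * theta * delta / 20) (theta * gam / 4)) (1 / 16).
have d1' : 0 < 1 - delta by rewrite subr_gt0.
have e0 : 0 < eps.
  have dd : 0 < (1 - delta) * theta * delta by rewrite !mulr_gt0.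
  have gg : 0 < theta * gam by rewrite mulr_gt0.
  by rewrite !lt_min; apply/andP; split; [apply/andP; split|]; clear -dd gg; lra.
have e16 : eps <= 1 / 16 by rewrite ge_min lexx orbT.
have eg : eps <= theta * gam / 4 by rewrite ge_min ge_min lexx orbT.
have ed : eps <= (1 - delta) * theta * delta / 20 by rewrite ge_min ge_min lexx.
clearbody eps.
have eps_ge0 := ltW e0; have th_ge0 := ltW th0; have d_ge0 := ltW d0.
have e3 : 0 < eps ^+ 3 by rewrite exprn_gt0.
have th16 : theta <= 1 / 16 by rewrite -/K in th4; clear -th4 th0 K1; nra.
have K_gt0 : 0 < K by clear -K1; lra.
have K_ge0 := ltW K_gt0.
(* Chebyshev with deviation [eps * L] bounds the chance of badness by about k t / (eps^2 L) plus k^2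
   t theta / (eps^2 L) up to constants; it has to be at most eps / k, which costs eps^3 and k^3. *)
pose eps1 := eps ^+ 3 / (8 * K ^+ 3).
have K3 : 0 < K ^+ 3 by rewrite exprn_gt0.
have eps1_gt0 : 0 < eps1 by rewrite divr_gt0 // mulr_gt0.
have B_gt0 : 0 < B by clear -B2; lra.
(* The exponent common to all events: [lower_tail] gives [eps ^+ 2 / 8], and the occupancy tail with
   its best parameter [eps / (4 * B)] gives [eps ^+ 2 / (8 * B)]. *)
pose kappa := eps ^+ 2 / (8 * B).
have kappa0 : 0 < kappa by rewrite divr_gt0 ?exprn_gt0 // mulr_gt0.
have KB0 : 0 <= 3 * K * B by rewrite !mulr_ge0 // ltW.
(* Each of at most B L^3 edges contributes at most 1 + k L + k <= 3 k L events. *)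
have [N1 hN1] := @exp_beats_poly R (3 * K * B) kappa 4 KB0 kappa0.
have [N2 hN2] := @nat_ge R (4 * K / eps ^+ 3).
have [N3 hN3] := @nat_ge R (1 / theta).
have [N4 hN4] := @nat_ge R (1 / eps).
exists eps1, (maxn (maxn N1 N2) (maxn N3 N4)); split=> // V E Col c0 vs F A L t Delta sz cod tL.
rewrite !geq_max => /andP[/andP[/hN1 big1 /hN2 big2] /andP[/hN3 big3 /hN4 big4]].
move=> Asz cdeg deg gD DB FB.
move: big2; rewrite ler_pdivrMr // => big2.
move: big3; rewrite ler_pdivrMr // => big3.
move: big4; rewrite ler_pdivrMr // => big4.
clear N1 N2 N3 N4 hN1 hN2 hN3 hN4.
set N : R := L%:R in big1 big2 big3 big4 gD DB FB cdeg tL.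
have N16 : 16 <= N by clear -big4 e16 e0; nra.
have N0 : 0 < N by clear -N16; lra.
have N_ge0 := ltW N0.
pose p := theta / N; pose b := Num.truncn ((1 - delta) * N).
have dN0 : 0 <= (1 - delta) * N by rewrite mulr_ge0 // ltW.
have bN : b%:R <= (1 - delta) * N by rewrite truncn_le.
have b0 : 0 <= b%:R :> R by [].
have pN : p * N = theta by rewrite /p divfK // gt_eqF.
have p0 : 0 < p by rewrite divr_gt0.
have p_ge0 := ltW p0.
have p16 : p <= 1 / 16 by rewrite /p ler_pdivrMr //; clear -th16 N16; lra.
have pb : 0 <= p < 1 by apply/andP; split; clear -p0 p16; lra.
have cdegb c v : (#|colour_star vs F A c v| <= b)%N by rewrite /b truncn_ge_nat.
clearbody b p.
pose T := tau k b p.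
have p01 : 0 <= p <= 1 by apply/andP; split; clear -pb; lra.
have q_ge0 : 0 <= 1 - p by clear -pb; lra.
have q_le1 : 1 - p <= 1 by clear -pb; lra.
have pbth : p * b%:R <= theta * (1 - delta).
  by rewrite -pN -mulrA [N * _]mulrC; apply: ler_wpM2l.
have thd0 : 0 < theta * delta by rewrite mulr_gt0.
have Tk : 1 - K * theta <= T.
  apply: le_trans (bernoulli_le (k * b) p01); rewrite natrM -/K lerD2l lerN2 -mulrA.
  by apply: ler_wpM2l => //; clear -pbth thd0; lra.
have T34 : 3 / 4 <= T by rewrite -/K in th4; clear -th4 Tk th0; lra.
have T1 : T <= 1 by apply: exprn_ile1.
pose mu := b%:R * (1 - p) ^+ (k.-1 * b).
have r1 : 1 - theta * (1 - delta) <= (1 - p) ^+ b.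
  by apply: le_trans (bernoulli_le b p01); clear -pbth; lra.
have mu0 : 0 <= mu by apply: mulr_ge0 => //; apply: exprn_ge0.
have muT : mu * (1 - theta * (1 - delta)) <= (1 - delta) * N * T.
  apply: (@le_trans _ _ (mu * (1 - p) ^+ b)); first by rewrite ler_wpM2l.
  rewrite /mu /T /tau -mulrA -exprD addnC -mulSn (prednK k0).
  by apply: ler_wpM2r; [apply: exprn_ge0 | exact: bN].
have b_le_N : b%:R <= N by apply: le_trans bN _; apply: ler_piMl => //; clear -d0; lra.
have muN : mu <= N.
  apply: (@le_trans _ _ b%:R) => //.
  by apply: ler_piMr => //; apply: exprn_ile1.
pose a := eps * N; have a0 : 0 < a by rewrite mulr_gt0.
have a_ge0 := ltW a0.
pose s0 := mu + a.
have s00 : 0 <= s0 by apply: addr_ge0.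
have s0N : s0 <= B * N.
  have h1 : eps * N <= 1 * N by apply: ler_wpM2r => //; clear -e16; lra.
  have h2 : 2 * N <= B * N by apply: ler_wpM2r.
  rewrite /s0 /a; clear -h1 h2 muN; lra.
(* An edge has expected number u >= theta - (K + 1) theta^2 of matched colours among [L.-1], and
   expR (- u) <= 1 - u + 2 u^2 adds 2 theta^2. *)
pose q := 1 - theta + (K + 3) * theta ^+ 2.
have K2 : (K + 3) * theta ^+ 2 <= theta / 4.
  by rewrite expr2 mulrA -[theta / 4]mulrC; apply: ler_wpM2r.
have K20 : 0 <= (K + 3) * theta ^+ 2 by rewrite mulr_ge0 ?sqr_ge0 // addr_ge0.
have q01 : 0 <= q <= 1 by rewrite /q; apply/andP; split; clear -K2 K20 th0 th16; lra.
pose r := (1 - p) ^+ (k * b).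
have r0 : 0 <= r by apply: exprn_ge0.
have rle1 : r <= 1 by exact: T1.
have prp : p * r <= p by apply: ler_piMr.
have thr : theta * r <= theta by apply: ler_piMr.
have q_bound : (1 - p * r) ^+ L.-1 <= q.
  pose u := p * r * L.-1%:R.
  have L1 : L.-1%:R = N - 1 by rewrite -subn1 natrB // -(ltr0n R); exact: N0.
  have prN : p * r * (N - 1) = theta * r - p * r by rewrite mulrBr mulr1 mulrAC pN.
  have pr0 : 0 <= p * r by apply: mulr_ge0.
  have u1 : theta - (K + 1) * theta ^+ 2 <= u.
    rewrite /u L1 prN; have h3 : p <= theta ^+ 2.
      rewrite -(ler_pM2r N0) pN expr2 -mulrA (ler_peMr th_ge0) //; clear -big3; lra.
    have h2 := ler_wpM2l th_ge0 Tk.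
    move: h2; rewrite /T /tau -/r; clear -h3 prp; lra.
  have u2 : u <= theta.
    by rewrite /u L1 prN; clear -thr pr0; lra.
  have u3 : 0 <= u by apply: mulr_ge0.
  apply: (@le_trans _ _ (expR (- (p * r)) ^+ L.-1)).
    apply: lerXn2r; rewrite ?nnegrE ?expR_ge0 //; last by rewrite (expR_ge1Dx (- (p * r))).
    clear -prp p16; lra.
  rewrite -expRM_natr mulNr -/u; apply: le_trans (expR_le_quadratic _) _; first by clear -u3; lra.
  have u4 : u ^+ 2 <= theta ^+ 2 by rewrite lerXn2r // nnegrE.
  rewrite sqrrN /q; clear -u1 u4; lra.
pose eta := eps / K.
have eta0 : 0 <= eta by apply: divr_ge0.
have Keta : K * eta = eps by rewrite /eta mulrC divfK // gt_eqF.
have eta_bad c v : chance (rnd vs F A k b p) c (bad vs F A s0 c ^~ v) <= eta.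
  have K2_gt0 : 0 < K ^+ 2 by rewrite exprn_gt0.
  have e3_ge0 := ltW e3.
  have e31 : eps ^+ 3 <= 1 by apply: exprn_ile1 => //; clear -e16; lra.
  have Keps : K ^+ 3 * eps1 = eps ^+ 3 / 8.
    have := lt0r_neq0 K3; rewrite /eps1; move: (K ^+ 3) (eps ^+ 3) => x3 y3 x30; clear -x30.
    by field.
  have tK3 : K ^+ 3 * t%:R <= eps ^+ 3 / 8 * N.
    by rewrite -Keps -mulrA; apply: ler_wpM2l; [apply: ltW | exact: tL].
  have tK2 : K ^+ 2 * t%:R <= eps ^+ 3 / 8 * N.
    apply: le_trans tK3; apply: ler_wpM2r => //.
    by apply: ler_weXn2l.
  have xp : (k * k * t)%:R * p <= eps ^+ 3 / 8 * theta.
    rewrite !natrM -/K -expr2 -pN mulrA [_ * p * N]mulrAC.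
    by apply: ler_wpM2r.
  have et : eps ^+ 3 * theta <= eps ^+ 3 * (1 / 16) by apply: ler_wpM2l.
  have xle : (k * k * t)%:R * p <= 2^-1.
    by apply: le_trans xp _; clear -et e31; lra.
  have := chance_bad k0 sz cod cdegb pb c v erefl xle a0 (erefl s0). move=> hh. apply: le_trans hh _.
  rewrite ler_pdivrMr ?exprn_gt0 // /eta.
  have -> : eps / K * a ^+ 2 = eps ^+ 3 / K * N * N by rewrite /a; ring.
  have x0 : 0 <= (k * k * t)%:R * p by apply: mulr_ge0.
  have kt : (k * t).+1%:R <= eps ^+ 3 / K * (3 / 8) * N.
    rewrite -natr1 natrM -/K.
    have h1 : K * t%:R <= eps ^+ 3 / K * (1 / 8) * N.
      rewrite -[_ * _ * N]mulrA mulrAC ler_pdivlMr //.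
      have -> : K * t%:R * K = K ^+ 2 * t%:R by ring.
      by apply: le_trans tK2 _; rewrite -mulrA mul1r mulrA.
    have h2 : 1 <= eps ^+ 3 / K * (1 / 4) * N.
      rewrite -[_ * _ * N]mulrA mulrAC ler_pdivlMr //.
      clear -big2; lra.
    clear -h1 h2; lra.
  have xK : 2 * ((k * k * t)%:R * p) <= eps ^+ 3 / K * (1 / 8).
    have -> : eps ^+ 3 / K * (1 / 8) = eps ^+ 3 * (1 / 8) / K by ring.
    rewrite ler_pdivlMr //.
    have h : (k * k * t)%:R * p * K <= eps ^+ 3 / 8 * theta.
      rewrite !natrM -/K -pN.
      have -> : K * K * t%:R * p * K = (K ^+ 3 * t%:R) * p by ring.
      have -> : eps ^+ 3 / 8 * (p * N) = (eps ^+ 3 / 8 * N) * p by ring.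
      exact: ler_wpM2r.
    clear -h et e3; lra.
  have e3K : 0 <= eps ^+ 3 / K by apply: divr_ge0.
  apply: (@le_trans _ _ (N * (eps ^+ 3 / K * (3 / 8) * N) + eps ^+ 3 / K * (1 / 8) * N ^+ 2)).
    apply: lerD; first exact: ler_pM.
    by apply: ler_pM; rewrite ?exprn_ge0 ?lerXn2r ?nnegrE ?mulr_ge0.
  have e3N : 0 <= eps ^+ 3 / K * N * N by apply: mulr_ge0 => //; apply: mulr_ge0.
  clear -e3N; lra.
pose l := eps / (4 * B).
have l0 : 0 <= l by rewrite divr_ge0 // mulr_ge0 // ltW.
have l01 : 0 <= l <= 2^-1.
  have B4 : 0 < 4 * B by rewrite mulr_gt0.
  apply/andP; split=> //; rewrite /l ler_pdivrMr //; clear -e16 B2; lra.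
pose f := expR (- (kappa * N)).
have fle s : s <= B * N -> expR (2 * l ^+ 2 * s - l * a) <= f.
  move=> sB; rewrite /f ler_expR.
  have h : 2 * l ^+ 2 * s <= 2 * l ^+ 2 * (B * N) by apply: ler_wpM2l => //; rewrite mulr_ge0 ?sqr_ge0.
  have lB : l * B = eps / 4 by rewrite /l; clear -B_gt0; field; lra.
  have -> : kappa * N = l * (eps / 2) * N by rewrite /kappa /l; clear -B_gt0; field; lra.
  have h2 : 2 * l ^+ 2 * (B * N) = l * (eps / 2) * N.
    have -> : 2 * l ^+ 2 * (B * N) = 2 * l * (l * B) * N by ring.
    by rewrite lB; clear; field.
  rewrite /a; clear -h h2; lra.
have P1 e : e \in F ->
    Pr (rnd vs F A k b p) (fun w => #|new_list vs F A s0 w e|%:R <= (T - K * eta - eps) * N) <= f.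
  move=> eF; have eps01 : 0 <= eps <= 1 by apply/andP; split; clear -e0 e16; lra.
  have Te : 0 <= tau k b p - k%:R * eta by rewrite -/K Keta -/T; clear -T34 e16; lra.
  apply: le_trans (Pr_short_list sz cdegb pb Asz eta_bad eF eps01 eta0 Te) _.
  rewrite /f ler_expR mulNr lerN2 /kappa; apply: ler_wpM2r => //.
  rewrite ler_pM2l ?exprn_gt0 // lef_pV2 ?posrE ?mulr_gt0 //; clear -B2; lra.
have P2 c v : Pr (rnd vs F A k b p)
    (fun w => q * s0 + a <= #|[set e in rest vs F A w | (v \in vs e) && (c \in new_list vs F A s0 w e)]|%:R) <= f.
  apply: le_trans (fle _ s0N).
  exact: (Pr_big_colour_star sz cdegb pb Asz q01 q_bound l01 c v a0 s00).
have P3 v : Pr (rnd vs F A k b p) (fun w => q * Delta + a <= #|star vs (rest vs F A w) v|%:R) <= f.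
  apply: le_trans (fle _ DB).
  exact: (Pr_big_star sz cdegb pb a Asz q01 q_bound l01 (deg v)).
have d := rnd_dist sz cdegb pb.
(* Vertices and colours are reached through the edges containing them, so the number of events
   depends on F alone; elsewhere the stars are empty. *)
pose Phi w : R := \sum_(e in F) (#|new_list vs F A s0 w e|%:R <= (T - K * eta - eps) * N)%R%:R
  + (\sum_(e in F) \sum_(v in vs e) \sum_(c in A e)
      (q * s0 + a <= #|[set e in rest vs F A w | (v \in vs e) && (c \in new_list vs F A s0 w e)]|%:R)%R%:R
  + \sum_(e in F) \sum_(v in vs e) (q * Delta + a <= #|star vs (rest vs F A w) v|%:R)%R%:R).
have [w Phi1] : exists w, Phi w < 1.
  apply: (Ex_lt1_witness d); rewrite !ExD !Ex_sum.
  have f0 : 0 <= f by apply: expR_ge0.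
  apply: (@le_lt_trans _ _ (\sum_(e in F) f + (\sum_(e in F) (K * N * f) + \sum_(e in F) (K * f)))).
    apply: lerD; [exact: ler_sum P1|apply: lerD; apply: ler_sum => e eF].
      rewrite Ex_sum; apply: (@le_trans _ _ (\sum_(v in vs e) N * f)).
        apply: ler_sum => v _; rewrite Ex_sum; apply: (@le_trans _ _ (\sum_(c in A e) f)).
          by apply: ler_sum => c _; apply: P2.
        by rewrite sumr_const -[f *+ _]mulr_natl Asz.
      rewrite sumr_const -[(N * f) *+ _]mulr_natl -mulrA; apply: ler_wpM2r; first exact: mulr_ge0.
      by rewrite ler_nat sz.
    rewrite Ex_sum; apply: (@le_trans _ _ (\sum_(v in vs e) f)).
      by apply: ler_sum => v _; apply: P3.
    by rewrite sumr_const -[f *+ _]mulr_natl ler_wpM2r ?ler_nat ?sz.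
  rewrite !sumr_const -!mulrnDl -[_ *+ #|F|]mulr_natl; apply: le_lt_trans big1.
  have N1 : 1 <= N by clear -N16; lra.
  have KN : 1 * 1 <= K * N by apply: ler_pM.
  have KN' : K * 1 <= K * N by apply: ler_pM.
  have -> : 3 * K * B * N ^+ 4 * expR (- (kappa * N)) = (B * N ^+ 3) * (3 * K * N * f) by rewrite /f; ring.
  apply: ler_pM => //; first by rewrite !addr_ge0 ?mulr_ge0.
  have -> : f + (K * N * f + K * f) = (1 + (K * N + K)) * f by ring.
  by apply: ler_wpM2r => //; clear -KN KN'; lra.
move: Phi1; rewrite /Phi; set X := \sum_(e in F) _; set Y := \sum_(e in F) _; set Z := \sum_(e in F) _ => XYZ.
have X0 : 0 <= X by apply: sumr_ge0.
have Y0 : 0 <= Y by do 3 (apply: sumr_ge0 => ? _).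
have Z0 : 0 <= Z by do 2 (apply: sumr_ge0 => ? _).
have X1 : X < 1 by clear -XYZ Y0 Z0; lra.
have Y1 : Y < 1 by clear -XYZ X0 Z0; lra.
have Z1 : Z < 1 by clear -XYZ X0 Y0; lra.
have S1 e : e \in F -> (T - K * eta - eps) * N < #|new_list vs F A s0 w e|%:R.
  by move=> eF; have := @sum_lt1 R E _ _ (fun e _ => ler0n _ _) X1 e eF; rewrite ind_lt1 -ltNge.
have S2 c v : #|[set e in rest vs F A w | (v \in vs e) && (c \in new_list vs F A s0 w e)]|%:R <= q * s0 + a.
  have qq : 0 <= q by case/andP: q01.
  have [->|[e]] := set_0Vmem [set e in rest vs F A w | (v \in vs e) && (c \in new_list vs F A s0 w e)].
    by rewrite cards0; apply: addr_ge0 => //; apply: mulr_ge0.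
  move=> /setIdP[/setIdP[eF _] /andP[ve /setIdP[ce _]]].
  have h1 := @sum_lt1 R E _ _ (fun e _ => sumr_ge0 _ (fun v _ => sumr_ge0 _ (fun c _ => ler0n _ _))) Y1 e eF.
  have h2 := @sum_lt1 R V _ _ (fun v _ => sumr_ge0 _ (fun c _ => ler0n _ _)) h1 v ve.
  have := @sum_lt1 R Col _ _ (fun c _ => ler0n _ _) h2 c ce.
  by rewrite ind_lt1 -ltNge => /ltW.
have S3 v : #|star vs (rest vs F A w) v|%:R <= q * Delta + a.
  have qq : 0 <= q by case/andP: q01.
  have [->|[e]] := set_0Vmem (star vs (rest vs F A w) v).
    rewrite cards0; apply: addr_ge0 => //.
    by apply: mulr_ge0 => //; apply: le_trans (deg v).
  move=> /setIdP[/setIdP[eF _] ve].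
  have h1 := @sum_lt1 R E _ _ (fun e _ => sumr_ge0 _ (fun v _ => ler0n _ _)) Z1 e eF.
  have := @sum_lt1 R V _ _ (fun c _ => ler0n _ _) h1 v ve.
  by rewrite ind_lt1 -ltNge => /ltW.
(* One eps pays for bad colours, since [K * eta = eps], the other for the deviation. *)
pose L' := Num.truncn ((T - 2 * eps) * N).
have T2 : 5 / 8 <= T - 2 * eps by clear -T34 e16; lra.
have T2' : T - 2 * eps <= 1 by clear -T1 e0; lra.
have T20 : 0 <= T - 2 * eps by clear -T2; lra.
have TN0 : 0 <= (T - 2 * eps) * N by apply: mulr_ge0.
have L'le : L'%:R <= (T - 2 * eps) * N by rewrite truncn_le.
have L'gt : (T - 2 * eps) * N - 1 < L'%:R by rewrite ltrBlDr natr1 truncnS_gt.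
have sub_new e : shrink L' (new_list vs F A s0 w e) \subset new_list vs F A s0 w e := shrink_sub _ _.
have [phi [phiP phiN]] := rest_colouring vs F A s0 c0 w.
exists L', (rest vs F A w), (fun e => shrink L' (new_list vs F A s0 w e)), phi; split.
- rewrite -(ler_nat R) natrM; have h : 5 / 8 * N <= (T - 2 * eps) * N by apply: ler_wpM2r.
  rewrite -/N; clear -h L'gt N16; lra.
- by rewrite -(ler_nat R) -/N; apply: le_trans L'le _; apply: ler_piMl.
- by apply/subsetP => e /setIdP[].
- by move=> e _; apply: subset_trans (sub_new e) _; apply/subsetP => c /setIdP[].
split=> //.
- move=> e /setIdP[eF _]; apply: card_shrink; rewrite -(ler_nat R).
  have := S1 e eF; rewrite Keta => h; apply: le_trans L'le _; apply/ltW.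
  by apply: le_lt_trans h; apply: ler_wpM2r => //; clear; lra.
- move=> e g er gr eg'; apply: contra (phiN e g er gr eg'); exact: (subsetP (sub_new e)).
- move=> c v; apply: le_trans (_ : q * s0 + a <= _).
    apply: le_trans (S2 c v); rewrite ler_nat; apply/subset_leq_card/subsetP => e.
    by case/setIdP=> er /andP[ve ce]; apply/setIdP; rewrite ve (subsetP (sub_new e)).
  (* The second factor cancels against [muT]; the first is the relative gain that absorbs the errors
     and the rounding of L'. *)
  have q_le : q <= (1 - theta * delta / 2) * (1 - theta * (1 - delta)).
    have h1 : theta * ((K + 3) * theta) <= theta * (delta / 2) by apply: ler_wpM2l.
    have h2 : 0 <= theta * theta * delta * (1 - delta) by rewrite !mulr_ge0 // ltW.
    rewrite /q; clear -h1 h2; lra.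
  have td1 : theta * delta <= 1 * 1 by apply: ler_pM => //; [clear -th16; lra | exact: ltW].
  have qmu : q * mu <= (1 - theta * delta / 2) * ((1 - delta) * N * T).
    apply: (@le_trans _ _ ((1 - theta * delta / 2) * (1 - theta * (1 - delta)) * mu)).
      exact: ler_wpM2r.
    by rewrite -mulrA [_ * mu]mulrC; apply: ler_wpM2l => //; clear -td1; lra.
  have qe : q * (eps * N) <= eps * N by apply: ler_piMl => //; case/andP: q01.
  have dL : (1 - delta) * ((T - 2 * eps) * N - 1) <= (1 - delta) * L'%:R by apply: ler_wpM2l; apply: ltW.
  have e1 : eps * N <= (1 - delta) * theta * delta / 20 * N by apply: ler_wpM2r.
  have e2 : 0 <= delta * (eps * N) by rewrite !mulr_ge0.
  have dtd : 0 <= (1 - delta) * theta * delta * N by rewrite !mulr_ge0 // ltW.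
  have Tt : 3 / 4 * ((1 - delta) * theta * delta * N) <= T * ((1 - delta) * theta * delta * N).
    exact: ler_wpM2r.
  apply: le_trans dL; rewrite /s0 /a; clear -qmu qe e1 e2 Tt big4 d0 dtd; lra.
- move=> v; apply: le_trans (S3 v) _.
  have Delta0 : 0 <= Delta by apply: le_trans (deg v).
  have h1 : (K + 3) * theta ^+ 2 * Delta <= theta / 4 * Delta by apply: ler_wpM2r.
  have h2 : eps * N <= theta / 4 * Delta.
    have th40 : 0 <= theta / 4 by rewrite divr_ge0.
    apply: (@le_trans _ _ (theta / 4 * (gam * N))); last exact: ler_wpM2l.
    rewrite mulrA; apply: ler_wpM2r => //; clear -eg; lra.
  rewrite /q /a; clear -h1 h2; lra.
Qed.

End Nibble.

(** * Iteration of the rounds and Kahn's theorem *)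

Section Kahn.
Variable R : realType.

(** S is a random set of colours of density gam. Two Chernoff events per edge fail with probability
    exponentially small in L. *)
Lemma reserve_colours (gam B : R) : 0 < gam <= 2^-1 -> 0 <= B ->
  exists L0 : nat, forall (E Col : finType) (F : {set E}) (A : E -> {set Col}) (L : nat),
    (L0 <= L)%N -> (forall e, e \in F -> (L <= #|A e|)%N) -> #|F|%:R <= B * L%:R ^+ 3 ->
  exists S : {set Col}, forall e, e \in F ->
    gam / 2 * L%:R <= #|A e :&: S|%:R /\ (1 - 2 * gam) * L%:R <= #|A e :\: S|%:R.
Proof.
move=> /andP[g0 g2] B0.
have kap0 : 0 < gam ^+ 2 / 32 by rewrite divr_gt0 ?exprn_gt0.
have B20 : 0 <= 2 * B by rewrite mulr_ge0.
have [L0 hL0] := @exp_beats_poly R (2 * B) (gam ^+ 2 / 32) 3 B20 kap0.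
exists L0 => E Col F A0 L /hL0 big A0L FB; pose A e := shrink L (A0 e).
have AL e : e \in F -> #|A e| = L by move=> eF; rewrite card_shrink ?A0L.
pose p := bern (fun _ : Col => gam).
have g01 (c : Col) : 0 <= gam <= 1 by apply/andP; split; clear -g0 g2; lra.
have d : is_dist p := bern_dist g01.
pose f := expR (- (gam ^+ 2 / 32 * L%:R)).
have P1 e : e \in F -> Pr p (fun w => #|[set c in A e | w c]|%:R <= gam / 2 * L%:R) <= f.
  move=> eF; have := @lower_tail R _ _ p (A e) (fun _ x => x) gam (gam / 2) d.
  rewrite AL //; have -> : gam - gam / 2 = gam / 2 by clear; field.
  have -> : - ((gam / 2) ^+ 2 / 8) * L%:R = - (gam ^+ 2 / 32 * L%:R) by clear; field.
  move=> h; apply: h => //.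
  - by move=> c _; rewrite /chance big_bool /= mulr1 mulr0 addr0.
  - by apply/andP; split; clear -g0 g2; lra.
  - by apply/andP; split; clear -g0 g2; lra.
have P2 e : e \in F -> Pr p (fun w => #|[set c in A e | ~~ w c]|%:R <= (1 - 2 * gam) * L%:R) <= f.
  move=> eF; have := @lower_tail R _ _ p (A e) (fun _ x => ~~ x) (1 - gam) gam d.
  rewrite AL //; have -> : 1 - gam - gam = 1 - 2 * gam by clear; ring.
  move=> h; apply: le_trans (h _ _ _) _; try by apply/andP; split; clear -g0 g2; lra.
    by move=> c _; rewrite /chance big_bool /= mulr1 mulr0 add0r.
  rewrite ler_expR mulNr lerN2; apply: ler_wpM2r => //.
  have := sqr_ge0 gam; clear; lra.
pose Phi w : R := \sum_(e in F) ((#|[set c in A e | w c]|%:R <= gam / 2 * L%:R)%R%:R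
   + (#|[set c in A e | ~~ w c]|%:R <= (1 - 2 * gam) * L%:R)%R%:R).
have [w Phi1] : exists w : {ffun Col -> bool}, Phi w < 1.
  apply: (Ex_lt1_witness d); rewrite Ex_sum.
  apply: (@le_lt_trans _ _ (\sum_(e in F) (f + f))).
    by apply: ler_sum => e eF; rewrite ExD; apply: lerD; [apply: P1 | apply: P2].
  rewrite sumr_const -[(f + f) *+ _]mulr_natl; apply: le_lt_trans big.
  have -> : 2 * B * L%:R ^+ 3 * expR (- (gam ^+ 2 / 32 * L%:R)) = B * L%:R ^+ 3 * (f + f) by rewrite /f; ring.
  by apply: ler_wpM2r => //; rewrite addr_ge0 ?expR_ge0.
exists [set c | w c] => e eF.
have := sum_lt1 (fun e _ => addr_ge0 (ler0n _ _) (ler0n _ _)) Phi1 eF.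
case: (lerP _ (gam / 2 * L%:R)) => [_|h1]; first by rewrite /= ltNge lerDl ler0n.
case: (lerP _ ((1 - 2 * gam) * L%:R)) => [_|h2 _]; first by rewrite /= add0r ltxx.
split; [apply: le_trans (ltW h1) _|apply: le_trans (ltW h2) _];
  rewrite ler_nat; apply/subset_leq_card/subsetP => c /setIdP[/(subsetP (shrink_sub _ _)) cA];
  by rewrite !inE cA ?andbT.
Qed.

(** The lists left at the end shrink along with the degrees and do not appear in the conclusion: the
    leftover edges have small degree compared with the original lists and are finished from reserved
    colours in [kahn]. *)
Lemma nibble_iter (k M : nat) (delta theta gam B : R) :
  (0 < k)%N -> 0 < delta < 1 -> 0 < theta -> (k%:R + 3) * theta <= delta / 2 ->
  (k%:R + 3) * theta <= 4^-1 -> 0 < gam -> 2 <= B ->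
  exists (eps1 : R) (L0 : nat), 0 < eps1 /\
  forall (V E Col : finType) (c0 : Col) (vs : E -> {set V}) (F : {set E}) (A : E -> {set Col})
    (L t : nat) (Delta : R),
    (forall e, e \in F -> (#|vs e| <= k)%N) -> codegree_le vs F t ->
    t%:R <= eps1 * L%:R -> (L0 <= L)%N ->
    (forall e, e \in F -> #|A e| = L) ->
    (forall c v, #|colour_star vs F A c v|%:R <= (1 - delta) * L%:R) ->
    (forall v, #|star vs F v|%:R <= Delta) -> 0 <= Delta ->
    gam * L%:R <= (1 - theta / 2) ^+ M * Delta -> Delta <= B * L%:R ->
    #|F|%:R <= B * L%:R ^+ 3 ->
  exists (F' : {set E}) (phi : E -> Col),
    [/\ F' \subset F, colours (adj vs) (F :\: F') A phi &
        forall v, #|star vs F' v|%:R <= (1 - theta / 2) ^+ M * Delta].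
Proof.
move=> k0 d01 th0 thd th4 g0.
have th16 : 0 <= 1 - theta / 2 <= 1.
  have k1 : 0 <= k%:R * theta by rewrite mulr_ge0 // ltW.
  by apply/andP; split; clear -k1 th4 th0; lra.
have /andP[th_ge0 th_le1] := th16.
elim: M B => [|M IH] B B2.
  exists 1, 0%N; split=> // V E Col c0 vs F A L t Delta sz cod _ _ AL cdeg deg D0 _ _ _.
  exists F, (fun=> c0); split=> //; last by move=> v; rewrite expr0 mul1r.
  by rewrite setDv; split=> e; rewrite inE.
(* A round may divide the list length by 4, and the edge bound is cubic in it: 64 = 4^3. *)
have B64 : 2 <= 64 * B by clear -B2; lra.
have [eps2 [L2 [eps2_gt0 step]]] := nibble_step k0 d01 th0 thd th4 g0 B2.
have [eps3 [L3 [eps3_gt0 iter]]] := IH _ B64.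
exists (Num.min eps2 (eps3 / 4)), (maxn L2 (4 * L3)); split; first by rewrite lt_min eps2_gt0 divr_gt0.
move=> V E Col c0 vs F A L t Delta sz cod tL; rewrite geq_max => /andP[L2L L3L].
move=> AL cdeg deg D0 gD DB FB.
have L_ge0 : 0 <= L%:R :> R by [].
have t2 : t%:R <= eps2 * L%:R.
  by apply: le_trans tL _; apply: ler_wpM2r => //; rewrite ge_min lexx.
have t3 : t%:R <= eps3 / 4 * L%:R.
  by apply: le_trans tL _; apply: ler_wpM2r => //; rewrite ge_min lexx orbT.
have gD' : gam * L%:R <= Delta.
  by apply: le_trans gD _; apply: ler_piMl => //; apply: exprn_ile1.
have [L' [F1 [A1 [phi1 [LL' L'L F1F A1A [A1L col1 sep cdeg1 deg1]]]]]] :=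
  step V E Col c0 vs F A L t Delta sz cod t2 L2L AL cdeg deg gD' DB FB.
have LL'R : L%:R <= 4 * L'%:R :> R by rewrite -natrM ler_nat.
have L'LR : L'%:R <= L%:R :> R by rewrite ler_nat.
have L'_ge0 : 0 <= L'%:R :> R by [].
have B_ge0 : 0 <= B by clear -B2; lra.
have sz1 e : e \in F1 -> (#|vs e| <= k)%N by move=> /(subsetP F1F) /sz.
have cod1 := codegree_leS F1F cod.
have t1 : t%:R <= eps3 * L'%:R.
  have h := ler_wpM2l (ltW eps3_gt0) LL'R; clear -h t3; lra.
have L31 : (L3 <= L')%N by rewrite -(leq_pmul2l (isT : 0 < 4)%N); apply: leq_trans LL'.
have D10 : 0 <= (1 - theta / 2) * Delta by apply: mulr_ge0.
have gD1 : gam * L'%:R <= (1 - theta / 2) ^+ M * ((1 - theta / 2) * Delta).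
  rewrite mulrA -exprSr; apply: le_trans gD; apply: ler_wpM2l => //; exact: ltW.
have DB1 : (1 - theta / 2) * Delta <= 64 * B * L'%:R.
  have h1 : (1 - theta / 2) * Delta <= Delta by apply: ler_piMl.
  have h2 := ler_wpM2l B_ge0 LL'R.
  have h3 : 0 <= B * L'%:R by apply: mulr_ge0.
  clear -h1 h2 h3 DB; lra.
have FB1 : #|F1|%:R <= 64 * B * L'%:R ^+ 3.
  apply: le_trans (_ : #|F|%:R <= _); first by rewrite ler_nat subset_leq_card.
  apply: le_trans FB _; have -> : 64 * B * L'%:R ^+ 3 = B * (4 * L'%:R) ^+ 3 by ring.
  by apply: ler_wpM2l => //; apply: lerXn2r; rewrite ?nnegrE ?mulr_ge0.
have [F2 [phi2 [F2F1 col2 deg2]]] :=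
  iter V E Col c0 vs F1 A1 L' t _ sz1 cod1 t1 L31 A1L cdeg1 deg1 D10 gD1 DB1 FB1.
exists F2, (fun e => if e \in F1 :\: F2 then phi2 e else phi1 e); split.
- exact: subset_trans F2F1 F1F.
- have -> : F :\: F2 = (F :\: F1) :|: (F1 :\: F2).
    apply/setP => e; rewrite !inE.
    have := subsetP F1F e; have := subsetP F2F1 e.
    by case: (e \in F); case: (e \in F1); case: (e \in F2) => // h1 h2; try (by have := h1 isT); try (by have := h2 isT).
  apply: (colours_union (adjC vs) col1 col2) => [e|e g]; rewrite inE => /andP[_ eF1]; first exact: A1A.
  exact: sep.
- by move=> v; rewrite exprSr -mulrA.
Qed.

(* The polynomial bound on the number of edges allows a union bound in place of the
   Lovasz Local Lemma. *)
Theorem kahn (k : nat) (delta B : R) : (0 < k)%N -> 0 < delta < 1 -> 0 <= B ->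
  exists (eps1 : R) (L0 : nat), 0 < eps1 /\
  forall (V E Col : finType) (c0 : Col) (vs : E -> {set V}) (F : {set E}) (A : E -> {set Col})
    (L t : nat),
    (forall e, e \in F -> (#|vs e| <= k)%N) -> codegree_le vs F t ->
    t%:R <= eps1 * L%:R -> (L0 <= L)%N ->
    (forall e, e \in F -> (L <= #|A e|)%N) ->
    (forall v, #|star vs F v|%:R <= (1 - delta) * L%:R) ->
    #|F|%:R <= B * L%:R ^+ 3 ->
  colourable (adj vs) F A.
Proof.
(* Reserving costs [2 * gam = delta / 4] of each list; after rounding, the nibble still has slack
   [delta / 2]. *)
move=> k0 /andP[d0 d1] B0; pose gam := delta / 8; pose K : R := k%:R.
have K1 : 1 <= K by rewrite ler1n.
have K3 : 0 < 4 * (K + 3) by clear -K1; lra.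
pose theta := delta / (4 * (K + 3)).
have th0 : 0 < theta by rewrite divr_gt0.
have thE : (K + 3) * theta = delta / 4 by rewrite /theta; clear -K1; field; lra.
have thd : (K + 3) * theta <= delta / 2 / 2 by rewrite thE; clear -d0; lra.
have th4 : (K + 3) * theta <= 4^-1 by rewrite thE; clear -d1; lra.
have th1 : theta <= 1.
  have h : theta * 1 <= theta * K by apply: ler_wpM2l => //; apply: ltW.
  clear -h th4 th0; lra.
have g0 : 0 < gam by rewrite divr_gt0.
have g2 : 0 < gam <= 2^-1 by rewrite g0 /= /gam; clear -d1; lra.
have C0 : 0 <= 4 * K / gam by rewrite divr_ge0 ?mulr_ge0 ?ltW //; clear -K1; lra.
have th2 : 0 < theta / 2 by rewrite divr_gt0.
have [M hM] := @exp_beats_poly R (4 * K / gam) (theta / 2) 0 C0 th2.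
(* M is chosen so that an edge meets at most K g L <= gam L / 4 leftover edges, fewer than its gam L
   / 2 reserved colours. *)
pose g := (1 - theta / 2) ^+ M.
have g_gt0 : 0 < g by rewrite exprn_gt0 //; clear -th1; lra.
have g_small : K * g <= gam / 4.
  have h : g <= expR (- (theta / 2 * M%:R)).
    rewrite -mulNr expRM_natr; apply: lerXn2r; rewrite ?nnegrE ?expR_ge0 //; first by clear -th1; lra.
    by rewrite (expR_ge1Dx (- (theta / 2))).
  have := hM M (leqnn _); rewrite expr0 mulr1 mulrAC ltr_pdivrMr // mul1r => h2.
  have h3 : K * g <= K * expR (- (theta / 2 * M%:R)) by apply: ler_wpM2l => //; clear -K1; lra.
  clear -h2 h3; lra.
have B8 : 2 <= 8 * B + 2 by clear -B0; lra.
have d2 : 0 < delta / 2 < 1 by apply/andP; split; clear -d0 d1; lra.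
have [eps2 [L2 [eps2_gt0 iter]]] := @nibble_iter k M (delta / 2) theta g (8 * B + 2) k0 d2 th0 thd th4 g_gt0 B8.
have [L3 res] := reserve_colours g2 B0.
have [L4 hL4] := @nat_ge R (4 / delta).
exists (eps2 / 2), (maxn (maxn L3 L4) (2 * L2)).+1; split; first by rewrite divr_gt0.
move=> V E Col c0 vs F A L t sz cod tL LL AL deg FB.
have := ltnW LL; rewrite !geq_max => /andP[/andP[L3L /hL4 L4L] L2L].
have L_gt0 : 0 < L%:R :> R by rewrite ltr0n; apply: leq_ltn_trans LL.
have L_ge0 := ltW L_gt0.
move: L4L; rewrite ler_pdivrMr // => L4L.
have [S hS] := res E Col F A L L3L AL FB.
pose L1 := Num.truncn ((1 - 2 * gam) * L%:R).
have gl0 : 0 <= 1 - 2 * gam by rewrite /gam; clear -d1; lra.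
have glL : 0 <= (1 - 2 * gam) * L%:R by apply: mulr_ge0.
have L1le : L1%:R <= (1 - 2 * gam) * L%:R by rewrite truncn_le.
have L1gt : (1 - 2 * gam) * L%:R - 1 < L1%:R by rewrite ltrBlDr natr1 truncnS_gt.
have L1L : L1%:R <= L%:R :> R.
  by apply: le_trans L1le _; apply: ler_piMl => //; clear -g0; lra.
have dL0 : 0 <= delta * L%:R by rewrite mulr_ge0 // ltW.
have L1d : (1 - delta) * L%:R <= (1 - delta / 2) * L1%:R.
  have h : (1 - delta / 2) * ((1 - 2 * gam) * L%:R - 1) <= (1 - delta / 2) * L1%:R.
    by apply: ler_wpM2l; [clear -d1; lra | apply: ltW].
  have h2 : 0 <= delta * (delta * L%:R) by rewrite mulr_ge0 // ltW.
  move: h; rewrite /gam; clear -h2 L4L d0; lra.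
have L1half : L%:R <= 2 * L1%:R :> R.
  have h : delta * L%:R <= 1 * L%:R by apply: ler_wpM2r => //; apply: ltW.
  have h4 : 4 * 1 <= L%:R * 1 :> R by apply: le_trans (_ : L%:R * delta <= _); [clear -L4L; lra | apply: ler_wpM2l => //; apply: ltW].
  move: L1gt; rewrite /gam; clear -h h4; lra.
pose A1 e := shrink L1 (A e :\: S).
have A1L e : e \in F -> #|A1 e| = L1.
  by move=> /hS[_ h]; apply: card_shrink; rewrite -(ler_nat R); apply: le_trans h.
have cdeg c v : #|colour_star vs F A1 c v|%:R <= (1 - delta / 2) * L1%:R.
  apply: le_trans L1d; apply: le_trans (deg v); rewrite ler_nat.
  by apply/subset_leq_card/subsetP => e /setIdP[eF /andP[ve _]]; rewrite inE eF.
have deg1 v : #|star vs F v|%:R <= L1%:R :> R.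
  apply: le_trans (deg v) _; apply: le_trans L1d _; apply: ler_piMl => //; clear -d0; lra.
have t1 : t%:R <= eps2 * L1%:R.
  have h := ler_wpM2l (ltW eps2_gt0) L1half; clear -h tL; lra.
have L21 : (L2 <= L1)%N.
  have h : 2 * L2%:R <= 2 * L1%:R :> R.
    by apply: le_trans L1half; rewrite -natrM ler_nat.
  rewrite -(ler_nat R); clear -h; lra.
have DB1 : L1%:R <= (8 * B + 2) * L1%:R by apply: ler_peMl => //; clear -B0; lra.
have FB1 : #|F|%:R <= (8 * B + 2) * L1%:R ^+ 3.
  apply: le_trans FB _; apply: (@le_trans _ _ (8 * B * L1%:R ^+ 3)).
    have -> : 8 * B * L1%:R ^+ 3 = B * (2 * L1%:R) ^+ 3 by ring.
    by apply: ler_wpM2l => //; apply: lerXn2r; rewrite ?nnegrE ?mulr_ge0.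
  by apply: ler_wpM2r; [apply: exprn_ge0 | clear; lra].
have [F' [phi [F'F col deg']]] := iter V E Col c0 vs F A1 L1 t L1%:R sz cod t1 L21 A1L cdeg deg1 (ler0n _ _) (lexx _) DB1 FB1.
have [psi psiF] : colourable (adj vs) F' (fun e => A e :&: S).
  apply: (colourable_greedy (adjC vs) (adjxx vs) c0) => e eF'.
  have eF := subsetP F'F e eF'; rewrite -(ltr_nat R).
  apply: lt_le_trans (hS e eF).1.
  apply: (@le_lt_trans _ _ (K * (g * L1%:R))).
    apply: (@le_trans _ _ (\sum_(v in vs e) (g * L1%:R))); last first.
      rewrite sumr_const -[_ *+ #|_|]mulr_natl; apply: ler_wpM2r; first by rewrite mulr_ge0 // ltW.
      by rewrite ler_nat sz.
    apply: (@le_trans _ _ (\sum_(v in vs e) #|star vs F' v|%:R)); last by apply: ler_sum.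
    rewrite -natr_sum ler_nat.
    apply: leq_trans (_ : #|[set f in F' | true && meets vs e f]| <= _)%N.
      by apply/subset_leq_card/subsetP => f /setIdP[fF /andP[_ m]]; rewrite inE fF.
    apply: leq_trans (card_meets_le vs F' predT e) _; apply: leq_sum => v _.
    by apply/subset_leq_card/subsetP => f /setIdP[].
  have h1 : K * (g * L1%:R) <= gam / 4 * L%:R.
    rewrite mulrA; apply: ler_pM => //; rewrite mulr_ge0 ?ltW //; clear -K1; lra.
  have h2 : 0 < gam * L%:R by rewrite mulr_gt0.
  clear -h1 h2; lra.
have A1A e : A1 e \subset A e :\: S := shrink_sub _ _.
have [phiA phiP] := col.
exists (fun e => if e \in F' then psi e else phi e).
have -> : F = (F :\: F') :|: F'.
  by apply/setP => e; have := subsetP F'F e; rewrite !inE; case: (e \in F'); case: (e \in F) => // ->.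
apply: (colours_union (adjC vs) _ psiF) => [|e _|e f _ fF _].
- by split=> // e eF; have := subsetP (A1A e) _ (phiA e eF); rewrite inE => /andP[].
- exact: subsetIl.
- by have := subsetP (A1A f) _ (phiA f fF); rewrite !inE => /andP[/negbTE-> _]; rewrite andbF.
Qed.

End Kahn.

(** * Colouring locally sparse graphs *)

Section NaiveColouring.
Variables (R : realType) (E Col T : finType) (adj : rel E).
Variables (X : {set E}) (A : E -> {set Col}) (l : nat).
Variables (rho : E -> T -> R) (pick_colour : E -> T -> option Col) (p : R).
Implicit Types (w : {ffun E -> T}) (c : Col).

Hypotheses (adjC : symmetric adj) (adjxx : irreflexive adj).
Hypothesis list_size : forall e, e \in X -> #|A e| = l.
Hypothesis rho_dist : is_dist rho.
Hypothesis pick_chance : forall e c, e \in X ->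
  chance rho e (fun x => pick_colour e x == Some c) = p * (c \in A e)%:R.
Hypothesis p_def : p * (10 * l)%:R = 1.
Hypothesis l_gt0 : (0 < l)%N.
Hypothesis deg_le : forall e, e \in X -> #|neighbours adj X e|%:R <= 5 / 4 * l%:R :> R.

Let p_gt0 : 0 < p.
Proof.
have L : 0 < (10 * l)%:R :> R by rewrite ltr0n muln_gt0.
by rewrite -(pmulr_lgt0 _ L) p_def.
Qed.

Let pl : p * l%:R = 1 / 10.
Proof. by move: p_def; rewrite natrM; lra. Qed.

Let p_le1 : p <= 1.
Proof.
have l1 : 1 <= l%:R :> R by rewrite ler1n.
have := ler_wpM2l (ltW p_gt0) l1; have := pl; lra.
Qed.

Definition kept w := [set f in X | [exists c, (pick_colour f (w f) == Some c) &&
  [forall (g | g \in neighbours adj X f), pick_colour g (w g) != Some c]]].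

Definition picked_colour (c0 : Col) w f := odflt c0 (pick_colour f (w f)).

Lemma kept_colours (c0 : Col) w :
  (forall f c, f \in X -> pick_colour f (w f) = Some c -> c \in A f) ->
  colours adj (kept w) A (picked_colour c0 w).
Proof.
move=> inA; split=> [f|f g]; rewrite inE.
  by case/andP=> fX /existsP[c /andP[/eqP fc _]]; rewrite /picked_colour fc; apply: inA.
case/andP=> fX /existsP[c /andP[/eqP fc /forall_inP h]]; rewrite inE => /andP[gX /existsP[c' /andP[/eqP gc' _]]] fg.
rewrite /picked_colour fc gc' /= => cc'; have := h g; rewrite inE gX fg => /(_ isT).
by rewrite gc' cc' eqxx.
Qed.

Section AtEdge.
Variable e : E.
Hypothesis eX : e \in X.
Let nb := neighbours adj X e.

Let nbX f : f \in nb -> f \in X. Proof. by rewrite inE => /andP[]. Qed.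

Definition pickers w c := [set f in nb | pick_colour f (w f) == Some c].

(* A lucky colour saves one colour at e, provided that its pickers keep it. *)
Definition lucky w c :=
  if c \in A e then (#|pickers w c| == 2) && [forall (f | f \in pickers w c), [forall (g | g \in pickers w c), ~~ adj f g]]
  else #|pickers w c| == 1%N.

(** Only edges outside the neighbourhood of e occur here: a neighbour of e that tries a lucky colour
    is itself one of its pickers, and the pickers are not adjacent. Hence luck depends on the
    outcomes inside the neighbourhood, and once these are fixed spoiling depends on the outcomes
    outside. *)
Definition spoilers w := [set h in X :\: nb | [exists c, [&& pick_colour h (w h) == Some c, lucky w c &
  [exists f, (f \in pickers w c) && adj h f]]]].

Definition saved w := [set c | lucky w c && (pickers w c \subset kept w)].

(** A lucky colour that is not saved has a spoiler, and an edge picks at most one colour, so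
    different lost colours have different spoilers. *)
Lemma lucky_le_saved w : (#|[set c | lucky w c]| <= #|saved w| + #|spoilers w|)%N.
Proof.
pose S : {set Col} := [set c | [exists h, (h \in spoilers w) && (pick_colour h (w h) == Some c)]].
have S_le : (#|S| <= #|spoilers w|)%N.
  have someI : injective (@Some Col) by move=> x y [].
  rewrite -(card_imset _ someI).
  apply: leq_trans (leq_imset_card (fun h => pick_colour h (w h)) (spoilers w)).
  apply/subset_leq_card/subsetP => _ /imsetP[c cS ->]; move: cS; rewrite inE => /existsP[h /andP[hs /eqP <-]].
  exact: imset_f.
apply: leq_trans (_ : #|saved w :|: S| <= _)%N; last first.
  by apply: leq_trans (leq_card_setU _ _).1 _; rewrite leq_add2l.
apply/subset_leq_card/subsetP => c; rewrite inE => lc; rewrite !inE lc /=.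
have [//|/subsetPn[f fc]] := boolP (pickers w c \subset kept w).
move: (fc); rewrite inE => /andP[fnb /eqP fpc]; rewrite inE (nbX fnb) negb_exists => /forallP/(_ c).
rewrite fpc eqxx negb_forall_in => /exists_inP[g]; rewrite inE negbK => /andP[gX fg] gpc.
apply/existsP; exists g; rewrite gpc andbT inE; apply/andP; split; last first.
  by apply/existsP; exists c; rewrite gpc lc; apply/existsP; exists f; rewrite fc adjC.
rewrite !inE gX andbT; apply/negP => eg.
have gc : g \in pickers w c by rewrite inE gpc inE gX eg.
move: lc; rewrite /lucky; case: ifP => _.
  by move=> /andP[_ /forall_inP/(_ f fc)/forall_inP/(_ g gc)]; rewrite fg.
move=> /cards1P[a Ea]; move: fc gc fg; rewrite Ea !inE => /eqP-> /eqP->.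
by rewrite adjxx.
Qed.

(** Colour by colour: a saved colour of [A e] is used by two neighbours and blocks one colour, a
    saved colour outside [A e] is used by one neighbour and blocks none. *)
Lemma saved_gain (c0 : Col) w :
  (#|A e :&: picked_colour c0 w @: neighbours adj (kept w) e| + #|saved w| <= #|neighbours adj (kept w) e|)%N.
Proof.
pose K := neighbours adj (kept w) e; rewrite -/K.
pose cls c := [set f in K | picked_colour c0 w f == c].
have -> : #|K| = (\sum_c #|cls c|)%N.
  rewrite -sum1_card (partition_big (picked_colour c0 w) predT) //=.
  by apply: eq_bigr => c _; rewrite -sum1_card; apply: eq_bigl => f; rewrite [RHS]in_set.
have cardE' (B : {set Col}) : #|B| = (\sum_c (c \in B))%N.
  by rewrite -sum1_card big_mkcond; apply: eq_bigr => d _; case: (d \in B).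
rewrite !cardE' -big_split /=; apply: leq_sum => c _.
have sav : c \in saved w -> pickers w c \subset cls c.
  rewrite inE => /andP[_ /subsetP pk]; apply/subsetP => f fp; rewrite inE.
  move: (fp); rewrite inE => /andP[+ /eqP fc]; rewrite inE => /andP[fX ef].
  by rewrite /picked_colour fc eqxx andbT inE pk.
have nonempty : c \in A e :&: picked_colour c0 w @: K -> (0 < #|cls c|)%N.
  rewrite inE => /andP[_ /imsetP[f fK ->]]; apply/card_gt0P; exists f; by rewrite inE fK eqxx.
case: (boolP (c \in saved w)) => [cs|_].
  have := subset_leq_card (sav cs); move: cs; rewrite inE => /andP[+ _].
  rewrite /lucky [c \in _ :&: _]inE; case: (c \in A e) => /=; last by move=> /eqP->.
  by move=> /andP[/eqP-> _]; apply: leq_trans; rewrite addn1 ltnS leq_b1.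
by rewrite addn0; case: (boolP (c \in _)) => [/nonempty|_].
Qed.

Lemma greedy_condition (c0 : Col) w :
  (#|nb| < l + #|saved w|)%N ->
  (#|neighbours adj (X :\: kept w) e| < #|avail adj (kept w) A (picked_colour c0 w) e|)%N.
Proof.
move=> h; have := saved_gain c0 w; set K := neighbours adj (kept w) e => gain.
have dE : (#|nb| = #|K| + #|neighbours adj (X :\: kept w) e|)%N.
  rewrite -(cardsID (kept w)); congr (_ + _)%N; apply: eq_card => f; rewrite !inE.
    by case: (adj e f); rewrite ?andbF //= !andbT; case: (f \in X); rewrite //= andbT.
  by case: (adj e f); rewrite ?andbF ?andbT.
have lE := list_size eX; rewrite -(cardsID (picked_colour c0 w @: K) (A e)) in lE.
rewrite /avail -/K; move: gain lE h; rewrite dE; clear; lia.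
Qed.

Let d_le : #|nb|%:R <= 5 / 4 * l%:R :> R. Proof. exact: deg_le. Qed.

Let pd : p * #|nb|%:R <= 1 / 8.
Proof. by have := ler_wpM2l (ltW p_gt0) d_le; have := pl; lra. Qed.

(** The other neighbours must avoid c, which has probability at least 1 - p d >= 1/2 because d
    neighbours with [p * d <= 1 / 8] are involved. *)
Lemma Pr_pickers c (Q : {set E}) : Q \subset nb -> (forall f, f \in Q -> c \in A f) ->
  p ^+ #|Q| / 2 <= Pr rho (fun w => pickers w c == Q).
Proof.
move=> Qnb QA.
have -> : Pr rho (fun w => pickers w c == Q)
    = Ex rho (fun w => \prod_(f in nb) ((f \in Q) == (pick_colour f (w f) == Some c))%:R).
  apply: eq_Ex => w; rewrite prod_indicator; congr (nat_of_bool _)%:R.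
  apply/eqP/forall_inP => [<- f fnb|h]; first by rewrite inE fnb eqxx.
  apply/setP => f; rewrite inE; case: (boolP (f \in nb)) => [/h/eqP-> //|fn].
  by apply/esym/negbTE; apply: contra fn; apply: (subsetP Qnb).
rewrite (Ex_prod_in nb (fun f x => ((f \in Q) == (pick_colour f x == Some c))%:R) rho_dist).
apply: (@le_trans _ _ (\prod_(f in nb) (if f \in Q then p else 1 - p))); last first.
  apply: ler_prod => f fnb; have pf := pick_chance c (nbX fnb).
  case: (boolP (f \in Q)) => fQ.
    rewrite (ltW p_gt0) /=; move: pf; rewrite (QA f fQ) mulr1 /chance => {1}<-.
    by apply: ler_sum => x _.
  rewrite subr_ge0 p_le1 /=.
  apply: (@le_trans _ _ (chance rho f (fun x => ~~ (pick_colour f x == Some c)))); last first.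
    by apply: ler_sum => x _; case: (pick_colour f x == Some c).
  rewrite chanceC // pf lerD2l lerN2 -[leRHS]mulr1 ler_wpM2l ?(ltW p_gt0) //.
  by case: (c \in A f).
rewrite (big_setID Q) /= (setIidPr Qnb).
rewrite (eq_bigr (fun=> p)); last by move=> f ->.
rewrite [X in _ <= _ * X](eq_bigr (fun=> 1 - p)); last by move=> f; rewrite inE => /andP[/negbTE->].
rewrite !prodr_const; apply: ler_wpM2l; first by rewrite exprn_ge0 // ltW.
have p01 : 0 <= p <= 1 by rewrite (ltW p_gt0) p_le1.
apply: le_trans (bernoulli_le _ p01).
have h : p * #|nb :\: Q|%:R <= p * #|nb|%:R.
  by apply: ler_wpM2l; [exact: ltW | rewrite ler_nat subset_leq_card // subsetDl].
have := pd; lra.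
Qed.

Definition far_pairs := [set u : E * E | [&& u.1 \in nb, u.2 \in nb, u.1 != u.2 & ~~ adj u.1 u.2]].

Lemma Pr_lucky_out c : c \notin A e ->
  p / 2 * #|[set f in nb | c \in A f]|%:R <= Pr rho (fun w => lucky w c).
Proof.
move=> ce; apply: (@le_trans _ _ (\sum_(f in [set f in nb | c \in A f]) Pr rho (fun w => pickers w c == [set f]))).
  rewrite mulr_natr -sumr_const; apply: ler_sum => f; rewrite inE => /andP[fnb cf].
  have := @Pr_pickers c [set f]; rewrite cards1 expr1 sub1set; apply => // g.
  by rewrite inE => /eqP->.
rewrite -Ex_sum; apply: le_Ex => // w; rewrite /lucky (negbTE ce).
have [/cards1P[a ->]|h] := boolP (#|pickers w c| == 1%N).
  rewrite (eq_bigr (fun f => (f == a)%:R)); last first.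
    move=> f _; congr (nat_of_bool _)%:R; apply/eqP/eqP => [/esym/set1_inj //|-> //].
  case: (boolP (a \in [set f in nb | c \in A f])) => aB.
    by rewrite (bigD1 a) //= eqxx big1 ?addr0 // => f /andP[_ /negbTE->].
  rewrite big1 ?ler0n // => f fB; case: eqP => // fa; by rewrite -fa fB in aB.
rewrite big1 // => f _; case: eqP => // pf; by rewrite pf cards1 in h.
Qed.

(** Pairs are ordered, so each pair of pickers is counted twice; this halves the constant of
    [Pr_pickers]. *)
Lemma Pr_lucky_in c : c \in A e ->
  p ^+ 2 / 4 * #|[set u in far_pairs | (c \in A u.1) && (c \in A u.2)]|%:R <= Pr rho (fun w => lucky w c).
Proof.
move=> ce; set O := [set u in far_pairs | _].
have -> : p ^+ 2 / 4 * #|O|%:R = 2^-1 * (p ^+ 2 / 2 * #|O|%:R) by field.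
rewrite ler_pdivrMl //.
apply: (@le_trans _ _ (\sum_(u in O) Pr rho (fun w => pickers w c == [set u.1; u.2]))).
  rewrite mulr_natr -sumr_const; apply: ler_sum => u.
  rewrite !inE => /andP[/and4P[u1 u2 u12 _] /andP[c1 c2]].
  have := @Pr_pickers c [set u.1; u.2]; rewrite cards2 u12; apply.
    by apply/subsetP => f; rewrite !inE => /orP[] /eqP->; rewrite ?u1 ?u2.
  by move=> f; rewrite !inE => /orP[] /eqP->.
rewrite -Ex_sum -ExZ; apply: le_Ex => // w; rewrite /lucky ce.
have [no|[[a b] /setIdP[abO /eqP pab]]] := set_0Vmem [set u in O | pickers w c == [set u.1; u.2]].
  rewrite big1 ?mulr_ge0 // => u uO; case: eqP => // pu.
  by have := in_set0 u; rewrite -no inE uO pu eqxx.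
move: abO; rewrite !inE /= => /andP[/and4P[a1 b1 ab nab] _].
have -> : (#|pickers w c| == 2) && [forall (f | f \in pickers w c), [forall (g | g \in pickers w c), ~~ adj f g]].
  rewrite pab /= cards2 ab /=; apply/forall_inP => f; rewrite !inE => /orP[] /eqP->;
    apply/forall_inP => g; rewrite !inE => /orP[] /eqP->; rewrite ?adjxx // adjC //.
rewrite mulr1; apply: (@le_trans _ _ (\sum_(u in [set (a, b); (b, a)]) 1)); last first.
  by rewrite sumr_const ler_nat cards2; case: (_ != _).
rewrite [leRHS]big_mkcond [leLHS]big_mkcond /=; apply: ler_sum => u _; rewrite [u \in [set _; _]]inE !in_set1.
case: ifP => uO; last by case: ifP => _; rewrite ?ler01.
rewrite pab /=; case: eqP => [E2|_]; last by case: ifP => _; rewrite ?ler01.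
move: uO; rewrite !inE => /andP[/and4P[_ _ u12 _] _].
have := set21 u.1 u.2; have := set22 u.1 u.2; rewrite -E2 !inE /= => h2 h1.
suff -> : (u == (a, b)) || (u == (b, a)) by [].
by rewrite -!pair_eqE /=; case/orP: h1 h2 u12 => /eqP-> /orP[] /eqP->; rewrite ?eqxx ?orbT.
Qed.

(** Either the lists of the neighbours mostly agree with [A e], and non-adjacent pairs share many
    colours of it, or they contain many colours outside it, each a chance of luck on its own. The
    sum [Bs] of the excesses measures the disagreement: it costs p^2 |nb| Bs / 2 among the pairs,
    and since [p * #|nb|] is at most 1/8 this is less than the p Bs / 2 gained outside. *)
Lemma Ex_lucky : p ^+ 2 / 4 * l%:R * #|far_pairs|%:R <= Ex rho (fun w => #|[set c | lucky w c]|%:R).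
Proof.
have -> : Ex rho (fun w => #|[set c | lucky w c]|%:R) = \sum_c Pr rho (fun w => lucky w c).
  rewrite -Ex_sum; apply: eq_Ex => w; rewrite -sum1_card natr_sum big_mkcond /=.
  by apply: eq_bigr => c _; rewrite inE; case: (lucky w c).
pose bb f : R := #|A f :\: A e|%:R.
pose Bs : R := \sum_(f in nb) bb f.
have Bs0 : 0 <= Bs by apply: sumr_ge0.
have out_sum : \sum_(c | c \notin A e) #|[set f in nb | c \in A f]|%:R = Bs :> R.
  rewrite /Bs (eq_bigr (fun c => \sum_(f in nb) (c \in A f)%:R)); last by move=> c _; exact: card_set_sum.
  rewrite exchange_big /=; apply: eq_bigr => f _; rewrite /bb -sum1_card natr_sum.
  rewrite big_mkcond [RHS]big_mkcond /=; apply: eq_bigr => c _; rewrite inE.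
  by case: (c \in A e) => //=; case: (c \in A f).
have in_sum : l%:R * #|far_pairs|%:R - 2 * #|nb|%:R * Bs
    <= \sum_(c in A e) #|[set u in far_pairs | (c \in A u.1) && (c \in A u.2)]|%:R :> R.
  rewrite (eq_bigr (fun c => \sum_(u in far_pairs) ((c \in A u.1) && (c \in A u.2))%:R)); last by move=> c _; exact: card_set_sum.
  rewrite exchange_big /=.
  apply: (@le_trans _ _ (\sum_(u in far_pairs) (l%:R - (bb u.1 + bb u.2)))); last first.
    apply: ler_sum => u; rewrite !inE => /and4P[/andP[u1 _] /andP[u2 _] _ _].
    rewrite -card_set_sum lerBlDr /bb -!natrD ler_nat.
    have c1 : #|A e :\: A u.1| = #|A u.1 :\: A e|.
      have := cardsID (A u.1) (A e); have := cardsID (A e) (A u.1).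
      by rewrite !list_size // setIC => <- /addnI.
    have c2 : #|A e :\: A u.2| = #|A u.2 :\: A e|.
      have := cardsID (A u.2) (A e); have := cardsID (A e) (A u.2).
      by rewrite !list_size // setIC => <- /addnI.
    rewrite -c1 -c2 -(list_size eX).
    apply: leq_trans (_ : #|[set c in A e | (c \in A u.1) && (c \in A u.2)] :|: ((A e :\: A u.1) :|: (A e :\: A u.2))| <= _)%N.
      apply/subset_leq_card/subsetP => c ce; rewrite !inE ce /= !andbT.
      by case: (c \in A u.1); case: (c \in A u.2).
    apply: leq_trans (leq_card_setU _ _).1 _; rewrite leq_add2l; exact: (leq_card_setU _ _).1.
  rewrite sumrB sumr_const -[_ *+ #|far_pairs|]mulr_natr lerD2l lerN2.
  have far_le (G : E * E -> R) : (forall u, 0 <= G u) ->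
      \sum_(u in far_pairs) G u <= \sum_(f in nb) \sum_(g in nb) G (f, g).
    move=> G0; rewrite pair_big /= big_mkcond [leRHS]big_mkcond /=; apply: ler_sum => -[f g] _.
    rewrite inE /=; case: (f \in nb); case: (g \in nb) => //=; by case: ifP.
  rewrite big_split /= mulrAC mulr2n mulrDl mul1r mulrDl.
  apply: lerD; apply: le_trans (far_le _ _) _ => //=.
    by rewrite (eq_bigr (fun f => bb f * #|nb|%:R)) -?mulr_suml // => f _; rewrite sumr_const -[_ *+ _]mulr_natr.
  by rewrite sumr_const -[_ *+ _]mulr_natr.
rewrite (bigID (mem (A e))) /=.
apply: (@le_trans _ _ (p ^+ 2 / 4 * (l%:R * #|far_pairs|%:R - 2 * #|nb|%:R * Bs) + p / 2 * Bs)).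
  have h1 : (p * #|nb|%:R) * (p * Bs) <= 1 / 8 * (p * Bs).
    by apply: ler_wpM2r; [rewrite mulr_ge0 // ltW | exact: pd].
  have h2 : 0 <= p * Bs by rewrite mulr_ge0 // ltW.
  lra.
apply: lerD.
  apply: (@le_trans _ _ (p ^+ 2 / 4 * \sum_(c in A e) #|[set u in far_pairs | (c \in A u.1) && (c \in A u.2)]|%:R)).
    by apply: ler_wpM2l in_sum; rewrite divr_ge0 // exprn_ge0 // ltW.
  by rewrite mulr_sumr; apply: ler_sum => c; apply: Pr_lucky_in.
rewrite -out_sum mulr_sumr; apply: ler_sum => c; exact: Pr_lucky_out.
Qed.

(** A new outcome at one edge affects only its old and its new colour, hence the count by at most 2,
    and only the at most 5 l / 4 neighbours of e matter. *)
Lemma mcdiarmid_lucky lam : 0 <= lam <= 2^-1 ->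
  Ex rho (fun w => expR (- (lam / 2 * #|[set c | lucky w c]|%:R)))
  <= expR (5 / 2 * lam ^+ 2 * l%:R - lam / 2 * Ex rho (fun w => #|[set c | lucky w c]|%:R)).
Proof.
move=> /andP[lam0 lam2]; have lam01 : 0 <= lam <= 2^-1 by rewrite lam0.
pose F (w : {ffun E -> T}) : R := - (lam / 2) * #|[set c | lucky w c]|%:R.
have lucky_diff w w' f c : (forall g, g != f -> w g = w' g) ->
    pick_colour f (w f) != Some c -> pick_colour f (w' f) != Some c -> lucky w c = lucky w' c.
  move=> ww n1 n2; suff E1 : pickers w c = pickers w' c by rewrite /lucky E1.
  apply/setP => g; rewrite !inE; have [->|gf] := eqVneq g f; last by rewrite ww.
  by rewrite (negbTE n1) (negbTE n2).
have card_diff w w' f : (forall g, g != f -> w g = w' g) ->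
    (#|[set c | lucky w c]| <= #|[set c | lucky w' c]| + 2)%N.
  move=> ww; pose D x : {set Col} := if pick_colour f x is Some c then [set c] else set0.
  have D1 x : (#|D x| <= 1)%N by rewrite /D; case: pick_colour => [c|]; rewrite ?cards1 ?cards0.
  have DP x c : c \notin D x -> pick_colour f x != Some c.
    by rewrite /D; case: pick_colour => [c'|] //; rewrite inE; apply: contra => /eqP[->].
  apply: leq_trans (_ : #|[set c | lucky w' c] :|: (D (w f) :|: D (w' f))| <= _)%N.
    apply/subset_leq_card/subsetP => c; rewrite inE => lc; rewrite in_setU.
    case: (boolP (c \in D (w f) :|: D (w' f))) => [_|]; first by rewrite orbT.
    rewrite in_setU negb_or => /andP[/DP n1 /DP n2]; by rewrite inE -(lucky_diff _ _ _ _ ww n1 n2) lc.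
  apply: leq_trans (leq_card_setU _ _).1 _; rewrite leq_add2l.
  by apply: leq_trans (leq_card_setU _ _).1 _; apply: (@leq_add _ _ 1 1).
have F_diff f w x : `|F (upd w f x) - F w| <= lam.
  have ww g : g != f -> upd w f x g = w g by rewrite ffunE => /negbTE->.
  have h1 := card_diff _ _ f ww; have h2 := card_diff _ _ f (fun g gf => esym (ww g gf)).
  move: h1 h2; rewrite -!(ler_nat R) !natrD => h1 h2.
  have l2 : 0 <= lam / 2 by rewrite divr_ge0.
  rewrite /F -mulrBr normrM normrN (ger0_norm l2).
  have h3 : `|#|[set c | lucky (upd w f x) c]|%:R - #|[set c | lucky w c]|%:R| <= 2 :> R.
    by rewrite ler_norml; apply/andP; split; lra.
  have := ler_wpM2l l2 h3; lra.
have F0 f w x : f \notin enum nb -> F (upd w f x) = F w.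
  rewrite mem_enum => fnb; congr (_ * _%:R); apply: eq_card => c; rewrite !inE.
  suff E1 : pickers (upd w f x) c = pickers w c by rewrite /lucky E1.
  apply/setP => g; rewrite [LHS]inE [RHS]inE ffunE; have [->|//] := eqVneq g f.
  by rewrite (negbTE fnb).
have := @mcdiarmid R E T rho lam (enum nb) F rho_dist lam01 (fun f w x _ => F_diff f w x) (fun f w x => F0 f w x).
rewrite -cardE -expRD ExZ => h.
apply: (@le_trans _ _ (Ex rho (fun w => expR (F w)))).
  by apply: le_Ex => // w; rewrite ler_expR /F mulNr.
apply: le_trans h _; rewrite ler_expR mulNr lerD2r.
have := ler_wpM2r (_ : 0 <= 2 * lam ^+ 2) d_le; rewrite mulr_ge0 ?sqr_ge0 // => /(_ isT).
lra.
Qed.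

(** With the neighbourhood fixed the potential spoilers act independently. A lucky colour has at
    most 2 pickers, with at most 5 l / 4 neighbours each, so it is spoiled by at most 2 (5 l / 4) p
    = 1/4 edges on average; [expR lam - 1 <= 2 * lam] turns this into the factor 1/2. *)
Lemma Ex_spoilers lam w1 : 0 <= lam <= 2^-1 ->
  Ex rho (fun w2 => expR (lam * #|spoilers (mix nb w1 w2)|%:R))
  <= expR (lam / 2 * #|[set c | lucky w1 c]|%:R).
Proof.
move=> /andP[lam0 lam2].
have pkE w2 c : pickers (mix nb w1 w2) c = pickers w1 c.
  by apply/setP => f; rewrite [LHS]inE [RHS]inE ffunE; case: (f \in nb).
have lkE w2 c : lucky (mix nb w1 w2) c = lucky w1 c by rewrite /lucky pkE.
pose blk h c := lucky w1 c && [exists f, (f \in pickers w1 c) && adj h f].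
pose sp h x := [exists c, (pick_colour h x == Some c) && blk h c].
rewrite (eq_Ex _ (G := fun w2 => \prod_(h in X :\: nb) expR (lam * (sp h (w2 h))%:R))); last first.
  move=> w2; rewrite -expR_sum -mulr_sumr -card_set_sum; congr (expR (_ * _%:R)).
  apply: eq_card => h; rewrite 2!inE; case: (boolP (h \in X :\: nb)) => //= hnb.
  apply: eq_existsb => c; rewrite lkE pkE ffunE.
  by move: hnb; rewrite inE => /andP[/negbTE->].
rewrite (Ex_prod_in _ (fun h x => expR (lam * (sp h x)%:R)) rho_dist).
pose q h : R := \sum_c (blk h c)%:R * p.
apply: (@le_trans _ _ (\prod_(h in X :\: nb) expR (2 * lam * q h))).
  apply: ler_prod => h hX; apply/andP; split.
    by apply: sumr_ge0 => x _; rewrite mulr_ge0 ?expR_ge0 ?(rho_dist h).1.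
  have -> : \sum_x rho h x * expR (lam * (sp h x)%:R) = 1 + (expR lam - 1) * chance rho h (sp h).
    rewrite -[X in _ = X + _](rho_dist h).2 /chance mulr_sumr -big_split /=; apply: eq_bigr => x _.
    by case: (sp h x); rewrite /= ?(mulr1, mulr0, expR0); ring.
  apply: le_trans (expR_ge1Dx _); rewrite lerD2l.
  apply: ler_pM; rewrite ?chance_ge0 //.
  - by rewrite subr_ge0 -[leLHS]expR0 ler_expR.
  - have := expR_le_quadratic lam2; have := ler_wpM2l lam0 lam2; rewrite expr2; lra.
  - rewrite /q; apply: (@le_trans _ _ (\sum_c (blk h c)%:R * chance rho h (fun x => pick_colour h x == Some c))).
      rewrite /chance; under [leRHS]eq_bigr do rewrite mulr_sumr.
      rewrite exchange_big /=; apply: ler_sum => x _.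
      case: (boolP (sp h x)) => [/existsP[c /andP[hc bc]]|_].
        rewrite (bigD1 c) //= hc bc mulr1 mul1r lerDl; apply: sumr_ge0 => c' _.
        by rewrite !mulr_ge0 ?(rho_dist h).1.
      by rewrite mulr0; apply: sumr_ge0 => c' _; rewrite !mulr_ge0 ?(rho_dist h).1.
    apply: ler_sum => c _; apply: ler_wpM2l => //; rewrite pick_chance; last by move: hX; rewrite inE => /andP[].
    by rewrite -[leRHS]mulr1; apply: ler_wpM2l; [exact: ltW | case: (c \in A h)].
rewrite -expR_sum ler_expR -mulr_sumr.
suff h : \sum_(h in X :\: nb) q h <= 1 / 4 * #|[set c | lucky w1 c]|%:R.
  have := ler_wpM2l (_ : 0 <= 2 * lam) h; rewrite mulr_ge0 // => /(_ isT); lra.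
rewrite exchange_big /= -sum1_card natr_sum mulr_sumr [leRHS]big_mkcond /=.
apply: ler_sum => c _; rewrite inE -mulr_suml.
case: (boolP (lucky w1 c)) => [lc|nlc]; last first.
  by rewrite big1 ?mul0r // => h _; rewrite /blk (negbTE nlc).
rewrite mulr1.
have pk2 : (#|pickers w1 c| <= 2)%N.
  by move: lc; rewrite /lucky; case: ifP => _; [case/andP=> /eqP-> | move/eqP->].
have cnt : \sum_(h in X :\: nb) (blk h c)%:R <= 2 * (5 / 4 * l%:R) :> R.
  rewrite -card_set_sum.
  apply: (@le_trans _ _ (\sum_(f in pickers w1 c) #|neighbours adj X f|%:R)).
    rewrite -natr_sum ler_nat; apply: card_cover_le => h; rewrite inE => /andP[hX /andP[_ /existsP[f /andP[fp hf]]]].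
    exists f => //; rewrite inE adjC hf andbT; by move: hX; rewrite inE => /andP[].
  apply: (@le_trans _ _ (\sum_(f in pickers w1 c) 5 / 4 * l%:R)).
    by apply: ler_sum => f; rewrite inE => /andP[/nbX fX _]; apply: deg_le.
  rewrite sumr_const -[_ *+ #|_|]mulr_natl; apply: ler_wpM2r; last by rewrite ler_nat.
  by rewrite mulr_ge0 // divr_ge0.
have := ler_wpM2r (ltW p_gt0) cnt; have := pl; lra.
Qed.

Lemma saved_tail zeta s : 0 < zeta <= 1 -> zeta * l%:R <= Ex rho (fun w => #|[set c | lucky w c]|%:R) ->
  s <= zeta / 8 * l%:R ->
  Pr rho (fun w => #|saved w|%:R <= s) <= expR (- (zeta ^+ 2 / 80 * l%:R)).
Proof.
(* The exponent 5/2 lam^2 - lam zeta / 2 + lam zeta / 8, times l, becomes - zeta^2 l / 80. *)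
move=> /andP[z0 z1] EL sl; pose lam := zeta / 20.
have lam0 : 0 <= lam by rewrite divr_ge0 // ltW.
have lam01 : 0 <= lam <= 2^-1 by rewrite lam0 /=; rewrite /lam; lra.
pose F w : R := expR (lam * #|spoilers w|%:R - lam * #|[set c | lucky w c]|%:R).
apply: le_trans (@markov _ _ _ _ _ F (expR (- (lam * s))) rho_dist (expR_gt0 _) _ _) _.
- by move=> w; apply: expR_ge0.
- move=> w h; rewrite /F ler_expR -mulrBr -mulrN; apply: ler_wpM2l => //.
  have := lucky_le_saved w; rewrite -(ler_nat R) natrD => h2; lra.
rewrite ler_pdivrMr ?expR_gt0 // -expRD.
apply: (@le_trans _ _ (Ex rho (fun w => expR (- (lam / 2 * #|[set c | lucky w c]|%:R))))).
  rewrite (Ex_mix nb F rho_dist); apply: le_Ex => // w1.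
  apply: (@le_trans _ _ (expR (- (lam * #|[set c | lucky w1 c]|%:R)) * Ex rho (fun w2 => expR (lam * #|spoilers (mix nb w1 w2)|%:R)))).
    rewrite -ExZ; apply: le_Ex => // w2; rewrite -expRD ler_expR addrC lerD2r lerN2.
    apply: ler_wpM2l => //; rewrite ler_nat; apply: eq_leq; apply: eq_card => c; rewrite !inE.
    suff pkE : pickers (mix nb w1 w2) c = pickers w1 c by rewrite /lucky pkE.
    by apply/setP => f; rewrite [LHS]inE [RHS]inE ffunE; case: (f \in nb).
  apply: (@le_trans _ _ (expR (- (lam * #|[set c | lucky w1 c]|%:R)) * expR (lam / 2 * #|[set c | lucky w1 c]|%:R))).
    by apply: ler_wpM2l; [exact: expR_ge0 | exact: Ex_spoilers].
  by rewrite -expRD ler_expR; lra.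
apply: le_trans (mcdiarmid_lucky lam01) _; rewrite ler_expR.
have h1 := ler_wpM2l lam0 EL; have h2 := ler_wpM2l lam0 sl.
move: h1 h2; rewrite /lam => h1 h2.
have : 0 <= zeta ^+ 2 * l%:R by rewrite mulr_ge0 ?sqr_ge0.
lra.
Qed.

End AtEdge.
End NaiveColouring.

Theorem sparse_colourable (R : realType) (zeta B : R) : 0 < zeta <= 1 -> 0 <= B ->
  exists (eta : R) (L0 : nat), 0 < eta /\
  forall (E Col : finType) (c0 : Col) (adj : rel E) (X : {set E}) (A : E -> {set Col}) (l : nat),
    symmetric adj -> irreflexive adj -> (L0 <= l)%N ->
    (forall e, e \in X -> (l <= #|A e|)%N) ->
    (forall e, e \in X -> #|neighbours adj X e|%:R <= (1 + eta) * l%:R) ->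
    (forall e, e \in X -> zeta * l%:R ^+ 2 <= #|far_pairs adj X e|%:R \/ (#|neighbours adj X e| < l)%N) ->
    #|X|%:R <= B * l%:R ^+ 3 ->
  colourable adj X A.
Proof.
(* With [p * l = 1 / 10], [Ex_lucky] yields zeta l / 400 lucky colours; an eighth of them is safely
   saved and pays for the excess eta in the degree. *)
move=> /andP[z0 z1] B0; pose zeta1 := zeta / 400; pose eta := zeta1 / 8.
have zz0 : 0 < zeta1 by rewrite divr_gt0.
have kap0 : 0 < zeta1 ^+ 2 / 80 by rewrite divr_gt0 ?exprn_gt0.
have [L0 hL0] := @exp_beats_poly R B (zeta1 ^+ 2 / 80) 3 B0 kap0.
exists eta, L0.+1; split; first by rewrite divr_gt0.
move=> E Col c0 adj X A0 l adjC adjxx Ll A0l deg sparse XB.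
have big := hL0 l (ltnW Ll); have l_gt0 : (0 < l)%N by apply: leq_ltn_trans Ll.
have lR : 0 < l%:R :> R by rewrite ltr0n.
pose A e := shrink l (A0 e).
have AA0 e : A e \subset A0 e := shrink_sub _ _.
have AL e : e \in X -> #|A e| = l by move=> /A0l h; rewrite card_shrink.
suff : colourable adj X A by apply: colourableS.
pose m := (10 * l)%N; pose p : R := m%:R^-1.
have mR : m%:R != 0 :> R by rewrite pnatr_eq0 -lt0n muln_gt0.
pose rho (e : E) (x : 'I_m) : R := p.
have rho_dist : is_dist rho.
  move=> e; split; first by move=> x; rewrite /rho invr_ge0.
  by rewrite sumr_const card_ord /rho -[_ *+ m]mulr_natr mulVf.
(* Of 10 l equally likely outcomes the first l name the colours of the list and the others leave the
   edge idle. *)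
pose pick_colour (e : E) (x : 'I_m) : option Col := if (x < l)%N then Some (nth c0 (enum (A e)) x) else None.
have pick_in e x c : e \in X -> pick_colour e x = Some c -> c \in A e.
  move=> eX; rewrite /pick_colour; case: ifP => // xl [<-]; rewrite -mem_enum mem_nth //.
  by rewrite -cardE AL.
have pick_chance e c : e \in X -> chance rho e (fun x => pick_colour e x == Some c) = p * (c \in A e)%:R.
  move=> eX; rewrite /chance -mulr_sumr; congr (_ * _).
  have [ce|nce] := boolP (c \in A e); last first.
    by rewrite big1 // => x _; case: eqP => // /(pick_in _ _ _ eX) ce; rewrite ce in nce.
  have ce' : c \in enum (A e) by rewrite mem_enum.
  have il : (index c (enum (A e)) < l)%N by rewrite -(AL e eX) cardE index_mem.
  have im : (index c (enum (A e)) < m)%N by apply: leq_trans il _; rewrite /m leq_pmull.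
  rewrite (bigD1 (Ordinal im)) //= /pick_colour /= il nth_index // eqxx big1 ?addr0 // => x.
  move=> xi; case: ifP => // xl; case: eqP => // -[xc]; case/eqP: xi; apply: val_inj => /=.
  by rewrite -xc index_uniq ?enum_uniq // -cardE AL.
have p_def : p * (10 * l)%:R = 1 by rewrite mulVf.
have e4 : eta <= 1 / 4 by rewrite /eta /zeta1; clear -z1 z0; lra.
have deg' e : e \in X -> #|neighbours adj X e|%:R <= 5 / 4 * l%:R :> R.
  move=> /deg h; apply: le_trans h _; apply: ler_wpM2r; first exact: ltW.
  by clear -e4; lra.
pose f := expR (- (zeta1 ^+ 2 / 80 * l%:R)).
pose bd (e : E) (w : {ffun E -> 'I_m}) := #|saved adj X A pick_colour e w|%:R <= eta * l%:R.
have tail e : e \in X -> zeta * l%:R ^+ 2 <= #|far_pairs adj X e|%:R -> Pr rho (bd e) <= f.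
  move=> eX far; have z01 : 0 < zeta1 <= 1 by rewrite zz0 /=; rewrite /zeta1; clear -z1 z0; lra.
  apply: (saved_tail adjC adjxx rho_dist pick_chance p_def l_gt0 deg' eX z01); last exact: lexx.
  apply: le_trans (Ex_lucky adjC adjxx AL rho_dist pick_chance p_def l_gt0 deg' eX).
  have pl : p * l%:R = 1 / 10 by move: p_def; rewrite natrM; clear; lra.
  have h : (p * l%:R) ^+ 2 * l%:R * zeta / 4 <= p ^+ 2 / 4 * l%:R * #|far_pairs adj X e|%:R.
    have -> : (p * l%:R) ^+ 2 * l%:R * zeta / 4 = p ^+ 2 / 4 * l%:R * (zeta * l%:R ^+ 2) by clear; field.
    by apply: ler_wpM2l => //; rewrite mulr_ge0 // divr_ge0 // sqr_ge0.
  by apply: le_trans h; rewrite pl /zeta1; clear; lra.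
pose sparseb e := zeta * l%:R ^+ 2 <= #|far_pairs adj X e|%:R.
have [w Phi1] : exists w : {ffun E -> 'I_m}, \sum_(e in X) (sparseb e && bd e w)%:R < 1 :> R.
  apply: (Ex_lt1_witness rho_dist); rewrite Ex_sum; apply: le_lt_trans big.
  apply: (@le_trans _ _ (\sum_(e in X) f)); last first.
    rewrite sumr_const -[_ *+ #|X|]mulr_natl; apply: ler_wpM2r => //; exact: expR_ge0.
  apply: ler_sum => e eX; have [sp|nsp] := boolP (sparseb e); first exact: tail.
  by rewrite Ex_cst ?expR_ge0.
have good e : e \in X -> (#|neighbours adj X e| < l + #|saved adj X A pick_colour e w|)%N.
  move=> eX; case: (sparse e eX) => [sp|]; last by move=> h; apply: leq_trans h _; rewrite leq_addr.
  have := sum_lt1 (fun e _ => ler0n _ _) Phi1 eX; rewrite ind_lt1 /sparseb sp /= -ltNge => h.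
  rewrite -(ltr_nat R) natrD; apply: le_lt_trans (deg e eX) _.
  by rewrite mulrDl mul1r ltrD2l.
have kept_sub : kept adj X pick_colour w \subset X by apply/subsetP => g /setIdP[].
have col := kept_colours adj c0 (fun g c gX => @pick_in g (w g) c gX).
have -> : X = kept adj X pick_colour w :|: (X :\: kept adj X pick_colour w).
  by apply/setP => g; rewrite !in_setU in_setD; have := subsetP kept_sub g; case: (g \in kept _ _ _ _) => // ->.
apply: (colourable_extend adjC col); apply: (colourable_greedy adjC adjxx c0) => e.
rewrite in_setD => /andP[_ eX]. exact: (greedy_condition AL eX c0 (good e eX)).
Qed.

(** * Hypergraphs with large edges *)

Section Counting.
Variables (R : realType) (V E : finType) (vs : E -> {set V}).
Implicit Types (X : {set E}) (U : {set V}).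

Lemma sum_star X (U : {set V}) (g : E -> V -> R) :
  \sum_(v in U) \sum_(e in star vs X v) g e v = \sum_(e in X) \sum_(v in vs e :&: U) g e v.
Proof.
rewrite (exchange_big_dep (mem X)) /=; last by move=> v e _ /setIdP[].
apply: eq_bigr => e eX; apply: eq_bigl => v; by rewrite !inE eX andbC.
Qed.

Lemma sum_card_star X U : \sum_(v in U) #|star vs X v|%:R = \sum_(e in X) #|vs e :&: U|%:R :> R.
Proof.
have := sum_star X U (fun _ _ => 1); under eq_bigr do rewrite sumr_const.
by under [X in _ = X -> _]eq_bigr do rewrite sumr_const.
Qed.

Lemma sum_star_cap X t v U : codegree_le vs X t -> v \notin U ->
  \sum_(e in star vs X v) #|vs e :&: U|%:R <= t%:R * #|U|%:R :> R.
Proof.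
move=> cod vU; rewrite -sum_card_star mulr_natr -sumr_const; apply: ler_sum => u uU.
rewrite ler_nat; have uv : u != v by apply: contraNneq vU => <-.
apply: leq_trans (cod u v uv); apply/subset_leq_card/subsetP => e.
by rewrite !inE => /andP[/andP[-> ->] ->].
Qed.

Lemma sum_star_size X t v : codegree_le vs X t ->
  \sum_(e in star vs X v) (#|vs e|%:R - 1) <= t%:R * #|V|%:R :> R.
Proof.
move=> cod; apply: (@le_trans _ _ (t%:R * #|[set~ v]|%:R)); last first.
  by rewrite -!natrM ler_nat leq_mul2l max_card orbT.
have vU : v \notin [set~ v] by rewrite setC11.
apply: le_trans (sum_star_cap cod vU).
apply: ler_sum => e; rewrite inE => /andP[_ ve].
rewrite lerBlDr natr1 ler_nat (cardsD1 v) ve add1n ltnS.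
by apply/subset_leq_card/subsetP => u; rewrite !inE andbC.
Qed.

Lemma neighbours_le X e :
  #|neighbours (adj vs) X e|%:R <= \sum_(v in vs e) #|star vs X v|%:R :> R.
Proof.
rewrite -natr_sum ler_nat; apply: card_cover_le => f; rewrite inE => /and3P[fX _ /meets_vertexP[v ve vf]].
by exists v; rewrite // inE fX.
Qed.

Lemma card_le_sum_star X : (forall e, vs e != set0) -> #|X|%:R <= \sum_v #|star vs X v|%:R :> R.
Proof.
move=> vs0; rewrite -natr_sum ler_nat.
apply: leq_trans (_ : \sum_(v in [set: V]) #|star vs X v| <= _)%N.
  apply: card_cover_le => e eX; have /set0Pn[v ve] := vs0 e.
  by exists v; rewrite ?inE ?eX.
by rewrite big_mkcond; apply: leq_sum => v _; case: ifP.
Qed.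

End Counting.

(** * Stability: structure when every edge has nearly maximal degree sum *)

Section Core.
Variables (R : realType) (V E : finType) (vs : E -> {set V}) (X : {set E}) (t k : nat).
Variables (sigma eta mu : R) (estar : E).
Let D : R := t%:R * #|V|%:R.
Let n : R := #|V|%:R.
Let K : R := k%:R.
Let q : R := D / (K - 1).
Let x v : R := #|star vs X v|%:R.

Hypothesis cod : codegree_le vs X t.
Hypothesis size_ge : forall e, e \in X -> (k <= #|vs e|)%N.
Hypothesis starX : estar \in X.
Hypothesis star_size : #|vs estar| = k.
Hypothesis core : forall e, e \in X -> (1 - sigma) * D <= \sum_(v in vs e) x v.
Hypotheses (t_gt0 : (0 < t)%N) (mu0 : 0 < mu) (mu1 : mu <= 1 / 100).
Hypotheses (eta_def : eta = mu ^+ 4 / 10) (sigma_def : sigma = eta ^+ 2).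
Hypotheses (k_big : 1 <= K * eta ^+ 2) (n_big : 1 <= n * eta).

Definition big_edges (a : R) := [set e in X | (1 + a) * K < #|vs e|%:R].

(** An edge through v takes |e| - 1 of the D incidences that codegree t allows at v, and a long edge
    takes at least a K more than k - 1. The case a = 0 is the degree bound [x v <= q]. *)
Lemma star_big a v : 0 <= a -> x v * (K - 1) + a * K * #|star vs (big_edges a) v|%:R <= D.
Proof.
move=> a0; apply: le_trans (sum_star_size R v cod).
have -> : x v * (K - 1) = \sum_(e in star vs X v) (K - 1).
  by rewrite sumr_const -[RHS]mulr_natl.
have -> : #|star vs (big_edges a) v|%:R = \sum_(e in star vs X v) ((1 + a) * K < #|vs e|%:R)%R%:R :> R.
  rewrite -card_set_sum; congr _%:R; apply: eq_card => e; by rewrite !inE andbAC.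
rewrite mulr_sumr -big_split /=; apply: ler_sum => e; rewrite inE => /andP[eX _].
have ke : K <= #|vs e|%:R by rewrite ler_nat size_ge.
case: ltP => [h|_]; rewrite ?mulr1 ?mulr0; lra.
Qed.

Let eta_gt0 : 0 < eta. Proof. by rewrite eta_def divr_gt0 // exprn_gt0. Qed.

Let mu_pow : mu ^+ 4 <= mu / 100.
Proof.
have m2 : mu * mu <= mu * (1 / 100) by rewrite ler_wpM2l // ltW.
have mm : 0 <= mu * mu by rewrite mulr_ge0 // ltW.
have m3 : (mu * mu) * (mu * mu) <= (mu * mu) * 1 by apply: ler_wpM2l => //; apply: le_trans m2 _; have := mu1; lra.
have -> : mu ^+ 4 = (mu * mu) * (mu * mu) by ring.
lra.
Qed.

Let eta_small : eta <= mu / 1000. Proof. by rewrite eta_def; have := mu_pow; lra. Qed.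

Let sigma_small : sigma <= eta / 1000.
Proof.
rewrite sigma_def expr2; have := ler_wpM2l (ltW eta_gt0) eta_small.
have := ler_wpM2l (ltW eta_gt0) mu1; have := eta_gt0; lra.
Qed.

Let K_big : 1000 <= K * eta.
Proof.
have K0 : 0 <= K by [].
have h : K * eta ^+ 2 <= K * eta * (1 / 1000).
  rewrite expr2 mulrA; apply: ler_wpM2l; first by rewrite mulr_ge0 // ltW.
  have := eta_small; have := mu1; have := mu0; lra.
have := k_big; lra.
Qed.

Let K_gt2 : 1000 <= K.
Proof.
have K0 : 0 <= K by [].
have e1 : eta <= 1 by have := eta_small; have := mu1; have := mu0; lra.
have := ler_wpM2l K0 e1; have := K_big; lra.
Qed.

Let V0 : (0 < #|V|)%N.
Proof.
have : 0 < n by rewrite -(pmulr_lgt0 n eta_gt0); have := n_big; lra.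
by rewrite ltr0n.
Qed.

Let D_gt0 : 0 < D. Proof. by rewrite mulr_gt0 // ltr0n. Qed.

Let q_gt0 : 0 < q. Proof. by rewrite divr_gt0 //; have := K_gt2; lra. Qed.

Let qK : q * (K - 1) = D. Proof. by rewrite /q divfK //; have := K_gt2; lra. Qed.

Let x_le_q v : x v <= q.
Proof.
rewrite /q ler_pdivlMr; last by have := K_gt2; lra.
by have := star_big v (lexx 0); rewrite mul0r mul0r addr0.
Qed.

Let q_le : q * K <= D * (1 + eta / 100).
Proof.
have h : q * 1 <= q * (K * eta / 1000) by apply: ler_wpM2l; [exact: ltW | have := K_big; lra].
have h2 : q <= q * (K - 1) * (eta / 500).
  have h3 : q * eta * 2 <= q * eta * K.
    by apply: ler_wpM2l; [rewrite mulr_ge0 // ltW | have := K_gt2; lra].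
  lra.
rewrite qK in h2; have := qK; have := mulr_gt0 D_gt0 eta_gt0; lra.
Qed.

(** The k vertices of the smallest edge have degree sum at least (1 - sigma) D, while each degree is
    at most D / (K - 1). So there is almost no room for long edges, and an average vertex lies on
    nearly D / K short ones. *)
Lemma heavy_vertex : exists2 v0, v0 \in vs estar &
  (1 - 3 * eta) * D <= K * #|star vs (X :\: big_edges eta) v0|%:R.
Proof.
pose y v : R := #|star vs (big_edges eta) v|%:R.
pose z v : R := #|star vs (X :\: big_edges eta) v|%:R.
have xyz v : x v = y v + z v.
  rewrite /x /y /z -natrD -(cardsID (big_edges eta) (star vs X v)); congr (_ + _)%N%:R.
    by apply: eq_card => e; rewrite !inE; case: (e \in X); rewrite /= ?andbF //; exact: andbC.
  by apply: eq_card => e; rewrite !inE andbA.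
have ysum : eta * K * \sum_(v in vs estar) y v <= D + (K - 1) * sigma * D.
  have h : \sum_(v in vs estar) (x v * (K - 1) + eta * K * y v) <= \sum_(v in vs estar) D.
    by apply: ler_sum => v _; apply: star_big; apply: ltW.
  move: h; rewrite sumr_const star_size big_split /= -mulr_suml -mulr_sumr -[D *+ k]mulr_natl -/K => h.
  have h2 : (1 - sigma) * D * (K - 1) <= (\sum_(v in vs estar) x v) * (K - 1).
    by apply: ler_wpM2r (core starX); have := K_gt2; lra.
  lra.
have zsum : (1 - 3 * eta) * D <= \sum_(v in vs estar) z v.
  have zE : \sum_(v in vs estar) z v = \sum_(v in vs estar) x v - \sum_(v in vs estar) y v.
    by rewrite -sumrB; apply: eq_bigr => v _; rewrite xyz; ring.
  have ybound : \sum_(v in vs estar) y v <= 2 * eta * D.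
    have eK : 0 < eta * K by rewrite mulr_gt0 //; have := K_gt2; lra.
    rewrite -(ler_pM2l eK); apply: le_trans ysum _.
    have h1 : 1 * D <= K * eta ^+ 2 * D by apply: ler_wpM2r => //; exact: ltW.
    have h2 : 0 <= eta ^+ 2 * D by rewrite mulr_ge0 ?sqr_ge0 // ltW.
    have -> : eta * K * (2 * eta * D) = 2 * (K * eta ^+ 2 * D) by ring.
    rewrite sigma_def; lra.
  have h0 := core starX.
  have h3 : sigma * D <= eta * D by apply: ler_wpM2r; [exact: ltW | have := sigma_small; have := eta_gt0; lra].
  rewrite zE; lra.
apply/exists_inP; apply: contraT; rewrite negb_exists_in => /forall_inP no.
have : \sum_(v in vs estar) K * z v < \sum_(v in vs estar) (1 - 3 * eta) * D.
  apply: ltr_sum; last by move=> v /no; rewrite -ltNge.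
  have : (0 < #|vs estar|)%N.
    by rewrite star_size -(ltr0n R); have := K_gt2; rewrite -/K; lra.
  by move=> /card_gt0P[v ve]; apply/hasP; exists v => //; rewrite mem_index_enum.
rewrite sumr_const star_size -mulr_sumr -[_ *+ k]mulr_natl -/K.
have := ler_wpM2l (_ : 0 <= K) zsum; rewrite ler0n => /(_ isT); lra.
Qed.

Let K_ge0 : 0 <= K. Proof. by []. Qed.

Let q_small : q <= eta * D / 400.
Proof.
have h : q * 1000 <= q * (K * eta) by apply: ler_wpM2l; [exact: ltW | exact: K_big].
have h2 := ler_wpM2r (ltW eta_gt0) q_le.
have h3 : D * eta * eta <= D * eta * 1.
  apply: ler_wpM2l; first by rewrite mulr_ge0 // ltW.
  by have := eta_small; have := mu1; have := mu0; lra.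
have := mulr_gt0 D_gt0 eta_gt0; lra.
Qed.

Let def_ge0 u : 0 <= q - x u. Proof. by rewrite subr_ge0. Qed.

(** The short edges Z at [v0] cover almost every other vertex almost t times, because |Z| (K - 1) is
    nearly D = t n. By [core] the degrees on each of them fall short of q by little in total;
    summing over Z bounds t times the whole deficit. *)
Lemma deficit_sum : \sum_u (q - x u) <= 7 * eta * n * q.
Proof.
have [v0 v0star heavy] := heavy_vertex; set Z := star vs (X :\: big_edges eta) v0 in heavy.
have ZX f : f \in Z -> f \in X by rewrite !inE => /andP[/andP[_ ->]].
have Zsize f : f \in Z -> #|vs f|%:R <= (1 + eta) * K.
  by rewrite !inE => /andP[/andP[+ fX] _]; rewrite fX /= -leNgt.
have eD := mulr_gt0 eta_gt0 D_gt0.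
have Zdef f : f \in Z -> \sum_(u in vs f) (q - x u) <= 2 * eta * D.
  move=> fZ; rewrite sumrB sumr_const -[q *+ _]mulr_natl.
  have h1 := core (ZX f fZ).
  have h2 : #|vs f|%:R * q <= (1 + eta) * K * q by apply: ler_wpM2r; [exact: ltW | exact: Zsize].
  have e1 : 0 <= 1 + eta by have := eta_gt0; lra.
  have h3 := ler_wpM2l e1 q_le.
  have h4 : sigma * D <= eta / 1000 * D by apply: ler_wpM2r; [exact: ltW | exact: sigma_small].
  have h5 : eta * D * eta <= eta * D * 1.
    by apply: ler_wpM2l; [exact: ltW | have := eta_small; have := mu1; have := mu0; lra].
  lra.
pose U := [set~ v0].
have c_le u : u \in U -> #|star vs Z u|%:R <= t%:R :> R.
  rewrite !inE => uv; rewrite ler_nat; apply: leq_trans (cod uv).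
  by apply/subset_leq_card/subsetP => f; rewrite !inE => /andP[/andP[/andP[_ ->] ->] ->].
have S1 : \sum_(u in U) #|star vs Z u|%:R * (q - x u) <= q * (2 * eta * D).
  rewrite (eq_bigr (fun u => \sum_(f in star vs Z u) (q - x u))); last first.
    by move=> u _; rewrite sumr_const -[RHS]mulr_natl.
  rewrite (sum_star vs Z U (fun _ u => q - x u)).
  apply: (@le_trans _ _ (\sum_(f in Z) 2 * eta * D)).
    apply: ler_sum => f fZ; apply: le_trans (Zdef f fZ).
    rewrite [leLHS]big_mkcond [leRHS]big_mkcond /=; apply: ler_sum => u _.
    by rewrite inE; case: (u \in vs f); case: (u \in U).
  rewrite sumr_const -[_ *+ #|Z|]mulr_natl; apply: ler_wpM2r; first by have := eD; lra.
  apply: le_trans (x_le_q v0); rewrite ler_nat; apply/subset_leq_card/subsetP => f fZ.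
  by rewrite inE (ZX f fZ); move: fZ; rewrite inE => /andP[].
have S2 : #|Z|%:R * (K - 1) <= \sum_(u in U) #|star vs Z u|%:R.
  rewrite sum_card_star mulr_natl -sumr_const; apply: ler_sum => f fZ.
  rewrite lerBlDr natr1 ler_nat; apply: leq_trans (size_ge (ZX f fZ)) _.
  rewrite (cardsD1 v0); have -> : v0 \in vs f by move: fZ; rewrite inE => /andP[].
  by rewrite add1n ltnS; apply/subset_leq_card/subsetP => u; rewrite !inE andbC.
(* Replacing the cover multiplicity by t costs at most q for each missing incidence. *)
have S3 : \sum_(u in U) t%:R * (q - x u) <= q * (2 * eta * D) + q * (D - #|Z|%:R * (K - 1)).
  apply: (@le_trans _ _ (\sum_(u in U) #|star vs Z u|%:R * (q - x u) + \sum_(u in U) (t%:R - #|star vs Z u|%:R) * q)).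
    rewrite -big_split /=; apply: ler_sum => u uU.
    have h := ler_wpM2l (_ : 0 <= t%:R - #|star vs Z u|%:R) (_ : q - x u <= q).
    have h1 := h (ltac:(by rewrite subr_ge0 c_le)) (ltac:(by rewrite gerBl)).
    by move: h1; rewrite mulrBl; lra.
  apply: lerD => //; rewrite -mulr_suml mulrC; apply: ler_wpM2l; first exact: ltW.
  rewrite sumrB; apply: lerB => //.
  rewrite sumr_const -[_ *+ #|U|]mulr_natr; apply: ler_wpM2l => //.
  by rewrite ler_nat max_card.
have tD : t%:R <= eta * D.
  have t0 : 0 <= t%:R :> R by [].
  have := ler_wpM2l t0 n_big; rewrite /D -/n; lra.
have t0 : 0 < t%:R :> R by rewrite ltr0n.
rewrite -(ler_pM2l t0) mulr_sumr (bigD1 v0) //=.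
have S4 : t%:R * (q - x v0) <= eta * D * q.
  by apply: ler_pM => //; rewrite gerBl.
have -> : \sum_(i | i != v0) t%:R * (q - x i) = \sum_(u in U) t%:R * (q - x u).
  by apply: eq_bigl => u; rewrite !inE.
have S5 : q * (D - #|Z|%:R * (K - 1)) <= q * (4 * eta * D).
  apply: ler_wpM2l; first exact: ltW.
  have Zq : #|Z|%:R <= q.
    apply: le_trans (x_le_q v0); rewrite ler_nat; apply/subset_leq_card/subsetP => f fZ.
    by rewrite inE (ZX f fZ); move: fZ; rewrite inE => /andP[].
  have := q_small; move: heavy; lra.
have -> : t%:R * (7 * eta * n * q) = 7 * eta * D * q by rewrite /D -/n; ring.
lra.
Qed.

Let y u : R := #|star vs (big_edges mu) u|%:R.

Let muK : 1000 <= mu * K / 1000.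
Proof. by have := ler_wpM2l K_ge0 eta_small; have := K_big; lra. Qed.

(** By [star_big], long edges at a vertex force a deficit in its degree. *)
Lemma big_edges_sum : K * (mu * \sum_u y u) <= 7 * eta * n * D.
Proof.
have h : \sum_u mu * K * y u <= \sum_u (K - 1) * (q - x u).
  apply: ler_sum => u _; have := star_big u (ltW mu0); have := qK; rewrite -/(y u); lra.
rewrite -!mulr_sumr in h.
have K1 : 0 <= K - 1 by have := K_gt2; lra.
have h2 := ler_wpM2l K1 deficit_sum.
have -> : 7 * eta * n * D = (K - 1) * (7 * eta * n * q) by rewrite -qK; ring.
lra.
Qed.

Definition bad_vertices := [set u | mu * D < K * y u].

(** Markov. Of the fourth power of mu in eta, two factors are spent on the excess length and on the
    threshold for badness, and two remain. *)
Lemma card_bad_vertices : #|bad_vertices|%:R <= mu ^+ 2 * n.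
Proof.
have h : \sum_(u in bad_vertices) mu * D <= K * \sum_u y u.
  rewrite mulr_sumr [leRHS](bigID (mem bad_vertices)) /=.
  apply: ler_wpDr; first by apply: sumr_ge0 => u _; rewrite mulr_ge0.
  by apply: ler_sum => u; rewrite inE => /ltW.
rewrite sumr_const -[_ *+ #|_|]mulr_natr in h.
have h2 := ler_wpM2l (ltW mu0) h; have h3 := big_edges_sum.
have m2 : 0 < mu * mu * D := mulr_gt0 (mulr_gt0 mu0 mu0) D_gt0.
rewrite -(ler_pM2l m2).
have -> : mu * mu * D * (mu ^+ 2 * n) = mu ^+ 4 * n * D by ring.
move: h3; rewrite eta_def => h3.
have n0 : 0 <= mu ^+ 4 * n * D by rewrite !mulr_ge0 ?exprn_ge0 // ltW.
lra.
Qed.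

Definition bad_edges := [set e in X | (#|vs e|%:R <= (1 + mu) * K) && (mu * K < #|vs e :&: bad_vertices|%:R)].

(** A bad edge at v contains more than mu K / 2 bad vertices besides v, and each of these shares at
    most t edges with v. *)
Lemma star_bad_edges v : K * #|star vs bad_edges v|%:R <= 2 * mu * D.
Proof.
have codB : codegree_le vs bad_edges t by apply: codegree_leS cod; apply/subsetP => e /setIdP[].
have vB : v \notin bad_vertices :\ v by rewrite !inE eqxx.
have h := @sum_star_cap R V E vs _ _ _ _ codB vB.
have h2 : #|star vs bad_edges v|%:R * (mu * K / 2) <= t%:R * (mu ^+ 2 * n).
  apply: (@le_trans _ _ (t%:R * #|bad_vertices :\ v|%:R)); last first.
    apply: ler_wpM2l => //; apply: le_trans card_bad_vertices.
    by rewrite ler_nat subset_leq_card // subsetDl.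
  apply: le_trans h; rewrite mulr_natl -sumr_const; apply: ler_sum => e.
  rewrite !inE => /andP[/and3P[_ _ eb] _].
  have h3 : #|vs e :&: bad_vertices|%:R <= #|vs e :&: (bad_vertices :\ v)|%:R + 1 :> R.
    rewrite natr1 ler_nat (cardsD1 v (vs e :&: bad_vertices)) -add1n leq_add ?leq_b1 //.
    apply/subset_leq_card/subsetP => u; rewrite !inE => /andP[-> /andP[-> ->]] //.
  have := muK; lra.
have -> : 2 * mu * D = 2 / mu * (t%:R * (mu ^+ 2 * n)).
  by rewrite /D -/n expr2; have := lt0r_neq0 mu0; move=> m0; field.
have -> : K * #|star vs bad_edges v|%:R = 2 / mu * (#|star vs bad_edges v|%:R * (mu * K / 2)).
  by have := lt0r_neq0 mu0; move=> m0; field.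
by apply: ler_wpM2l h2; rewrite divr_ge0 // ltW.
Qed.

(** Discarded edges are long or rich in bad vertices. On a good edge few vertices are bad, and at
    the others long edges are rare by definition; the edges rich in bad vertices are rare
    everywhere. *)
Theorem core_good_edges : exists2 G : {set E}, G \subset X & [/\ G != set0,
  forall e, e \in G -> #|vs e|%:R <= (1 + mu) * K,
  forall e, e \in G -> \sum_(v in vs e) #|star vs (X :\: G) v|%:R <= 8 * mu * D,
  forall e, e \in G -> \sum_(v in vs e) x v <= (1 + 2 * mu) * D &
  forall v, x v * K <= 2 * D].
Proof.
have emu : eta <= mu by have := eta_small; have := mu0; lra.
have e1 : eta <= 1 by have := mu1; lra.
have De : D * eta <= D * 1 by apply: ler_wpM2l => //; exact: ltW.
have q2 : q * K <= 2 * D by have := q_le; have := D_gt0; lra.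
have xq v : x v * K <= 2 * D by apply: le_trans q2; apply: ler_wpM2r.
have muD := mulr_gt0 mu0 D_gt0.
pose G := [set e in X | (#|vs e|%:R <= (1 + mu) * K) && (#|vs e :&: bad_vertices|%:R <= mu * K)].
exists G; first by apply/subsetP => e /setIdP[].
have XG : X :\: G = big_edges mu :|: bad_edges.
  apply/setP => e; rewrite !inE; case: (e \in X); rewrite ?andbF //= andbT negb_and -!ltNge.
  by case: ltP.
split=> //.
(* At [v0] there are about D / K short edges, but at most 2 mu D / K edges rich in bad vertices, so
   some edge is good. *)
- have [v0 v0star heavy] := heavy_vertex; apply: contraTneq (star_bad_edges v0) => G0.
  rewrite -ltNge.
  apply: (@lt_le_trans _ _ (K * #|star vs (X :\: big_edges eta) v0|%:R)).
    apply: lt_le_trans heavy; have h := ler_wpM2r (ltW D_gt0) mu1.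
    have h2 := ler_wpM2r (ltW D_gt0) emu; have := D_gt0; lra.
  apply: ler_wpM2l => //; rewrite ler_nat; apply/subset_leq_card/subsetP => e.
  rewrite !inE => /andP[/andP[+ eX] ->]; rewrite eX /= andbT -leNgt => es.
  have em : #|vs e|%:R <= (1 + mu) * K.
    by apply: le_trans es _; apply: ler_wpM2r => //; lra.
  rewrite em /= ltNge; apply/negP => eb; have := in_set0 e; rewrite -G0 !inE eX em eb //.
- by move=> e /setIdP[_ /andP[]].
- move=> e /setIdP[eX /andP[es eb]]; rewrite XG.
  apply: (@le_trans _ _ (\sum_(v in vs e) (y v + #|star vs bad_edges v|%:R))).
    apply: ler_sum => v _; rewrite -natrD ler_nat.
    apply: leq_trans (leq_card_setU _ _).1; apply/subset_leq_card/subsetP => f.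
    by rewrite !inE => /andP[/orP[] -> ->]; rewrite ?orbT.
  have K_gt0 : 0 < K by have := K_gt2; lra.
  have e2 : #|vs e|%:R <= 3 / 2 * K.
    by apply: le_trans es _; apply: ler_wpM2r => //; have := mu1; lra.
  rewrite big_split /= -(ler_pM2l K_gt0) mulrDr !mulr_sumr.
  have hb : \sum_(v in vs e) K * #|star vs bad_edges v|%:R <= K * (3 * mu * D).
    apply: (@le_trans _ _ (\sum_(v in vs e) 2 * mu * D)).
      by apply: ler_sum => v _; apply: star_bad_edges.
    rewrite sumr_const -[_ *+ #|_|]mulr_natl.
    have := ler_wpM2r (ltW muD) e2; lra.
  have hy : \sum_(v in vs e) K * y v <= K * (7 / 2 * mu * D).
    rewrite (bigID (mem bad_vertices)) /=.
    apply: (@le_trans _ _ (\sum_(v in vs e :&: bad_vertices) 2 * D + \sum_(v in vs e) mu * D)).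
      apply: lerD.
        rewrite (eq_bigl (fun v => v \in vs e :&: bad_vertices)); last by move=> v; rewrite in_setI.
        apply: ler_sum => v _; rewrite mulrC; apply: le_trans (xq v); apply: ler_wpM2r => //.
        rewrite ler_nat; apply/subset_leq_card/subsetP => f; rewrite !inE.
        by move=> /andP[/andP[-> _] ->].
      rewrite [leLHS]big_mkcond [leRHS]big_mkcond /=; apply: ler_sum => v _.
      case: (v \in vs e) => //=; rewrite inE -leNgt; case: ifP => // _; exact: ltW.
    rewrite !sumr_const -[_ *+ #|_ :&: _|]mulr_natl -[_ *+ #|vs e|]mulr_natl.
    have h1 := ler_wpM2r (ltW D_gt0) eb; have h2 := ler_wpM2r (ltW muD) e2; lra.
  have := mulr_gt0 K_gt0 muD; lra.
- move=> e /setIdP[eX /andP[es eb]].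
  apply: (@le_trans _ _ (\sum_(v in vs e) q)); first by apply: ler_sum.
  rewrite sumr_const -[_ *+ #|_|]mulr_natl.
  apply: (@le_trans _ _ ((1 + mu) * K * q)); first by apply: ler_wpM2r es; exact: ltW.
  have m1 : 0 <= 1 + mu by have := mu0; lra.
  have h := ler_wpM2l m1 q_le.
  have h2 : mu * D * eta <= mu * D * 1 by apply: ler_wpM2l e1; exact: ltW.
  have h3 : eta * D <= mu * D by apply: ler_wpM2r; [exact: ltW | exact: emu].
  lra.
Qed.

End Core.

(** * Edge counts near sqrt n and sparsity of neighbourhoods *)

Section LargeEdges.
Variable R : realType.

(** The sum of |e| (|e| - 1) is at most n D. With e1 = delta^2 / 6 an edge in the window contributes
    at least (1 - 3 e1) n and any other, being longer, at least (1 + delta) n, so (1 + delta) |X| <=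
    D + (delta + 3 e1) |W|. The hypothesis on the window wins delta^2 D, of which e1 gives back only
    half. *)
Lemma huge_count (delta : R) (V E : finType) (vs : E -> {set V}) (X : {set E}) (t : nat) :
  let n : R := #|V|%:R in let s := Num.sqrt n in
  0 < delta <= 1 / 10 -> codegree_le vs X t -> 1 <= s * (delta ^+ 2 / 6) ->
  (forall e, e \in X -> (1 - delta ^+ 2 / 6) * s <= #|vs e|%:R) ->
  #|[set e in X | ((1 - delta) * s <= #|vs e|%:R) && (#|vs e|%:R <= (1 + delta) * s)]|%:R
    <= (1 - delta) * (t%:R * n) ->
  #|X|%:R <= (1 - delta ^+ 2 / 4) * (t%:R * n).
Proof.
move=> n s /andP[d0 d1] cod s1 big win.
have n0 : 0 <= n by [].
have ss : s * s = n by rewrite -expr2 sqr_sqrtr.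
pose e1 := delta ^+ 2 / 6; have e10 : 0 < e1 by rewrite divr_gt0 // exprn_gt0.
have dd : delta ^+ 2 <= delta / 10.
  by rewrite expr2; have := ler_wpM2l (ltW d0) d1; clear; lra.
have e1d : e1 <= delta / 60 by rewrite /e1; clear -dd; lra.
have s0 : 0 < s.
  by rewrite -(pmulr_lgt0 _ e10); apply: lt_le_trans s1.
have s_ge0 := ltW s0; have e1_ge0 := ltW e10.
have n_gt0 : 0 < n by rewrite -ss mulr_gt0.
pose D := t%:R * n; have D0 : 0 <= D by rewrite mulr_ge0.
pose W := [set e in X | ((1 - delta) * s <= #|vs e|%:R) && (#|vs e|%:R <= (1 + delta) * s)].
have vol : \sum_(e in X) #|vs e|%:R * (#|vs e|%:R - 1) <= n * D.
  apply: (@le_trans _ _ (\sum_(v in [set: V]) \sum_(e in star vs X v) (#|vs e|%:R - 1))).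
    rewrite sum_star; apply: ler_sum => e _.
    by rewrite setIT sumr_const -[leRHS]mulr_natl.
  apply: (@le_trans _ _ (\sum_(v in [set: V]) D)).
    by apply: ler_sum => v _; apply: sum_star_size.
  by rewrite sumr_const cardsT -[_ *+ _]mulr_natl.
have low : \sum_(e in X) n * ((1 + delta) - (delta + 3 * e1) * (e \in W)%:R)
    <= \sum_(e in X) #|vs e|%:R * (#|vs e|%:R - 1).
  apply: ler_sum => e eX; have b := big e eX; rewrite -/e1 in b.
  have s1' : 1 <= s * e1 by [].
  have prod_ge (a c : R) : 0 <= a -> a * s <= c -> 1 <= a * s -> a * s * (a * s - 1) <= c * (c - 1).
    by move=> a0 h h1; apply: ler_pM; [rewrite mulr_ge0 // ltW | rewrite subr_ge0 | exact: h | rewrite lerD2r].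
  have a1s : 1 <= (1 - e1) * s.
    have : s * e1 <= s * (1 - e1) by apply: ler_wpM2l; [exact: ltW | clear -e1d d1 d0; lra].
    by clear -s1'; lra.
  rewrite inE eX /=; have [sm|bg] := leP #|vs e|%:R ((1 + delta) * s).
    have -> : (1 - delta) * s <= #|vs e|%:R.
      by apply: le_trans b; apply: ler_wpM2r; [exact: ltW | clear -e1d d0; lra].
    rewrite /= mulr1; have p1 : 0 <= 1 - e1 by clear -e1d d1 d0; lra.
    apply: le_trans (prod_ge _ _ p1 b a1s).
    have h : 0 <= s * (s * e1 - 1) by apply: mulr_ge0; [exact: ltW | clear -s1'; lra].
    have h2 : 0 <= s * s * e1 * e1 := mulr_ge0 (mulr_ge0 (mulr_ge0 s_ge0 s_ge0) e1_ge0) e1_ge0.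
    have h3 : 0 <= s * e1 := mulr_ge0 s_ge0 e1_ge0.
    rewrite -ss; clear -h h2 h3; lra.
  rewrite andbF mulr0 subr0.
  have p1 : 0 <= 1 + delta by clear -d0; lra.
  have a2s : 1 <= (1 + delta) * s.
    apply: le_trans a1s _; apply: ler_wpM2r; [exact: ltW | clear -e10 d0; lra].
  apply: le_trans (prod_ge _ _ p1 (ltW bg) a2s).
  have h : 0 <= s * (s * e1 - 1) by apply: mulr_ge0; [exact: ltW | clear -s1'; lra].
  have h1 : 0 <= (1 + delta) * (s * (s * e1 - 1)) by rewrite mulr_ge0.
  have h2 : 0 <= (1 + delta) * (s * s * (delta - e1)).
    apply: mulr_ge0 => //; apply: (mulr_ge0 (mulr_ge0 s_ge0 s_ge0)); clear -e1d d0; lra.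
  rewrite -ss; clear -h1 h2; lra.
have := le_trans low vol; rewrite -mulr_sumr ler_pM2l // sumrB sumr_const -mulr_sumr.
have -> : \sum_(e in X) (e \in W)%:R = #|W|%:R :> R.
  rewrite -(card_set_sum R X (fun e => e \in W)); congr _%:R; apply: eq_card => e; rewrite !inE.
  by case: (e \in X).
rewrite -[_ *+ #|X|]mulr_natr => h.
have h2 : (delta + 3 * e1) * #|W|%:R <= (delta + 3 * e1) * ((1 - delta) * D).
  by apply: ler_wpM2l win; clear -d0 e10; lra.
have d2 : 0 < 1 + delta by clear -d0; lra.
rewrite -(ler_pM2l d2); apply: (@le_trans _ _ (D + (delta + 3 * e1) * ((1 - delta) * D))).
  by clear -h h2; lra.
have -> : D + (delta + 3 * e1) * ((1 - delta) * D) = (1 + (delta + 3 * e1) * (1 - delta)) * D by ring.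
rewrite -/D [leRHS]mulrA; apply: ler_wpM2r => //; rewrite /e1.
have h3 : 0 <= delta ^+ 2 * (1 - delta) by rewrite mulr_ge0 ?sqr_ge0 //; clear -d1; lra.
have h4 : 0 <= delta ^+ 3 by rewrite exprn_ge0 // ltW.
clear -h3 h4; lra.
Qed.

(** Adjacent neighbours f, g of e either share a vertex of e, at most Q choices of g for each vertex
    of f in e, or g joins a vertex of e to another vertex of f, at most M^2 pairs in t edges each.
    All other pairs of distinct neighbours are far. *)
Lemma far_pairs_ge (V E : finType) (vs : E -> {set V}) (G : {set E}) (t : nat) (Q S M : R) e :
  codegree_le vs G t -> e \in G -> 0 <= M -> 0 <= Q ->
  (forall v, #|star vs G v|%:R <= Q) -> \sum_(v in vs e) #|star vs G v|%:R <= S ->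
  (forall f, f \in G -> #|vs f|%:R <= M) ->
  forall d : R, d = #|neighbours (adj vs) G e|%:R ->
  d ^+ 2 - d - Q * S - d * M ^+ 2 * t%:R <= #|far_pairs (adj vs) G e|%:R.
Proof.
move=> cod eG M0 Q0 HQ HS HM d; set nb := neighbours (adj vs) G e => dE.
have nbG f : f \in nb -> f \in G by case/setIdP.
have each f : f \in nb -> #|[set g in nb | adj vs f g]|%:R <= Q * #|vs f :&: vs e|%:R + M ^+ 2 * t%:R.
  move=> fnb; pose P := [set u : V * V | [&& u.1 \in vs e, u.2 \in vs f & u.1 != u.2]].
  apply: (@le_trans _ _ (\sum_(v in vs f :&: vs e) #|star vs G v|%:R
    + \sum_(u in P) #|[set g in G | (u.1 \in vs g) && (u.2 \in vs g)]|%:R)).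
    rewrite -!natr_sum -natrD ler_nat.
    apply: leq_trans (_ : #|(\bigcup_(v in vs f :&: vs e) star vs G v) :|: \bigcup_(u in P) [set g in G | (u.1 \in vs g) && (u.2 \in vs g)]| <= _)%N.
      apply/subset_leq_card/subsetP => g; rewrite inE => /andP[gnb /andP[_ /meets_vertexP[v vf vg]]].
      move: (gnb); rewrite inE => /andP[gG /andP[_ /meets_vertexP[u ue ug]]].
      rewrite inE; have [uv|uv] := eqVneq u v.
        apply/orP; left; apply/bigcupP; exists v; last by rewrite inE gG.
        by rewrite inE vf -uv.
      apply/orP; right; apply/bigcupP; exists (u, v); rewrite !inE /= ?ue ?vf //.
      by rewrite gG ug.
    apply: leq_trans (leq_card_setU _ _).1 _; apply: leq_add;
      by apply: card_cover_le => g /bigcupP[i iP gi]; exists i.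
  apply: lerD.
    apply: (@le_trans _ _ (\sum_(v in vs f :&: vs e) Q)); first by apply: ler_sum.
    by rewrite sumr_const -[_ *+ _]mulr_natr.
  apply: (@le_trans _ _ (\sum_(u in P) t%:R)).
    by apply: ler_sum => u; rewrite inE => /and3P[_ _ ne]; rewrite ler_nat cod.
  rewrite sumr_const -[_ *+ _]mulr_natl; apply: ler_wpM2r => //.
  apply: (@le_trans _ _ #|setX (vs e) (vs f)|%:R).
    by rewrite ler_nat; apply/subset_leq_card/subsetP => u; rewrite !inE => /and3P[-> ->].
  by rewrite cardsX natrM expr2; apply: ler_pM => //; apply: HM => //; apply: nbG.
have tot : \sum_(f in nb) #|[set g in nb | adj vs f g]|%:R <= Q * S + d * M ^+ 2 * t%:R.
  apply: (@le_trans _ _ (\sum_(f in nb) (Q * #|vs f :&: vs e|%:R + M ^+ 2 * t%:R))).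
    by apply: ler_sum.
  rewrite big_split /= -mulr_sumr sumr_const -[_ *+ #|nb|]mulr_natl -dE mulrA lerD2r.
  apply: ler_wpM2l => //; apply: le_trans HS; rewrite sum_card_star.
  rewrite [leLHS]big_mkcond [leRHS]big_mkcond /=; apply: ler_sum => f _.
  by case: ifP => [/nbG ->|_] //; case: ifP.
have sq : d ^+ 2 <= #|far_pairs (adj vs) G e|%:R + d + \sum_(f in nb) #|[set g in nb | adj vs f g]|%:R.
  have -> : d ^+ 2 = #|setX nb nb|%:R by rewrite cardsX natrM expr2 dE.
  rewrite dE.
  rewrite -natr_sum -!natrD ler_nat.
  pose B := [set u : E * E | [&& u.1 \in nb, u.2 \in nb & adj vs u.1 u.2]].
  have BE : (#|B| <= \sum_(f in nb) #|[set g in nb | adj vs f g]|)%N.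
    apply: leq_trans (_ : \sum_(f in nb) #|[set (f, g) | g in [set g in nb | adj vs f g]]| <= _)%N.
      apply: card_cover_le => -[f g]; rewrite inE /= => /and3P[fn gn fg].
      by exists f => //; apply/imsetP; exists g => //; rewrite inE gn.
    by apply: leq_sum => f _; apply: leq_imset_card.
  apply: leq_trans (leq_add (leqnn _) BE).
  apply: leq_trans (_ : #|far_pairs (adj vs) G e :|: [set (f, f) | f in nb] :|: B| <= _)%N.
    apply/subset_leq_card/subsetP => -[f g]; rewrite in_setX /= => /andP[fn gn].
    have [fa|fa] := boolP (adj vs f g).
      by apply/setUP; right; rewrite in_set /= fn gn.
    apply/setUP; left; apply/setUP; have [<-|fg] := eqVneq f g.
      by right; apply: imset_f.
    by left; rewrite in_set /= fn gn fg.
  apply: leq_trans (leq_card_setU _ _).1 _; rewrite leq_add2r.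
  apply: leq_trans (leq_card_setU _ _).1 _; rewrite leq_add2l; exact: leq_imset_card.
by clear -tot sq; lra.
Qed.

End LargeEdges.

(** * Colouring the large edges *)

Section LargeEdgesColouring.
Variable R : realType.

Theorem large_edges_colourable (delta : R) : 0 < delta <= 1 / 10 ->
  exists (sigma : R) (r n0 : nat), [/\ 0 < sigma, sigma <= delta / 8 &
  forall (V E Col : finType) (c0 : Col) (vs : E -> {set V}) (X : {set E}) (A : E -> {set Col}) (t : nat),
    let n : R := #|V|%:R in let s := Num.sqrt n in
    (forall e, vs e != set0) -> codegree_le vs X t -> (0 < t)%N -> (n0 <= #|V|)%N ->
    (forall e, e \in X -> (r <= #|vs e|)%N) ->
    #|[set e in X | ((1 - delta) * s <= #|vs e|%:R) && (#|vs e|%:R <= (1 + delta) * s)]|%:R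
      <= (1 - delta) * (t%:R * n) ->
    (forall e, e \in X -> (1 - sigma) * (t%:R * n) <= #|A e|%:R) ->
  colourable (adj vs) X A].
Proof.
move=> /andP[d0 d1]; have d01 : 0 < delta <= 1 / 10 by rewrite d0.
pose d1' := delta ^+ 2 / 6.
have d1'0 : 0 < d1' by rewrite divr_gt0 // exprn_gt0.
have dd : delta ^+ 2 <= delta / 10.
  by rewrite expr2; have := ler_wpM2l (ltW d0) d1; clear; lra.
have d1'1 : d1' <= 1 / 600 by rewrite /d1'; clear -dd d1; lra.
have z01 : 0 < d1' / 2 <= 1 by apply/andP; split; clear -d1'0 d1'1; lra.
have B0 : 0 <= 8 :> R by [].
have [etaS [L0 [etaS0 sparse]]] := sparse_colourable z01 B0.
(* The first bound lets (1 + etaS) (1 - 10 mu) reach 1 + 2 mu, the second keeps all errors in the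
   count of far pairs below the gain [d1']. *)
pose mu := Num.min (etaS / 30) (d1' / 100).
have mu0 : 0 < mu by rewrite lt_min; apply/andP; split; apply: divr_gt0.
have mu_eta : mu <= etaS / 30 by rewrite ge_min lexx.
have mu_d : mu <= d1' / 100 by rewrite ge_min lexx orbT.
clearbody mu.
have mu1 : mu <= 1 / 100 by clear -mu_d d1'1; lra.
have mu_ge0 := ltW mu0.
pose eta := mu ^+ 4 / 10; pose sigma := eta ^+ 2.
have mu4 : mu ^+ 4 <= mu / 100.
  have m3 : mu ^+ 3 <= 1 / 100.
    apply: (le_trans _ mu1); rewrite exprS; apply: ler_piMr => //; apply: exprn_ile1 => //; clear -mu1; lra.
  have -> : mu ^+ 4 = mu * mu ^+ 3 by ring.
  by have := ler_wpM2l mu_ge0 m3; clear; lra.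
have eta0 : 0 < eta by rewrite divr_gt0 // exprn_gt0.
have eta_mu : eta <= mu / 1000 by rewrite /eta; clear -mu4; lra.
have sigma0 : 0 < sigma by rewrite exprn_gt0.
have sigma_eta : sigma <= eta.
  by rewrite /sigma expr2; apply: ler_piMr; [exact: ltW | clear -eta_mu mu1; lra].
have sigma_mu : sigma <= mu / 1000 by apply: le_trans eta_mu.
have [N1 hN1] := @nat_ge R (1 / sigma).
have [N2 hN2] := @nat_ge R (1 / eta).
have [N3 hN3] := @nat_ge R ((1 / d1') ^+ 2).
have [N4 hN4] := @nat_ge R (2 / mu).
have [N5 hN5] := @nat_ge R (2 * L0%:R + 2).
exists sigma, N1, (maxn (maxn N2 N3) (maxn N4 N5)); split=> //.
  by move: d1'0; rewrite /d1' => h; clear -sigma_mu mu_d dd h; rewrite /d1' in mu_d; lra.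
move=> V E Col c0 vs X A t n s vs0 cod t_gt0.
rewrite !geq_max => /andP[/andP[/hN2 n2 /hN3 n3] /andP[/hN4 n4 /hN5 n5]] size_r win lists.
rewrite -/n in n2 n3 n4 n5.
clear N2 N3 N4 N5 hN2 hN3 hN4 hN5.
move: n2 n4; rewrite !ler_pdivrMr // => n2 n4.
have n_ge2 : 2 <= n.
  by have L00 : 0 <= L0%:R :> R by []; clear -n5 L00; lra.
have n_gt0 : 0 < n by clear -n_ge2; lra.
have s1 : 1 <= s * d1'.
  have inv0 : 0 <= 1 / d1' by rewrite divr_ge0 // ltW.
  rewrite -ler_pdivrMr // /s -(ger0_norm inv0) -sqrtr_sqr.
  by rewrite ler_psqrt // nnegrE ?sqr_ge0 // ltW.
pose D := t%:R * n.
have t1 : 1 <= t%:R :> R by rewrite ler1n.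
have nD : n <= D by apply: ler_peMl => //; exact: ltW.
have D_gt0 : 0 < D by apply: lt_le_trans nD.
have D_ge0 := ltW D_gt0.
have [m] := ubnP #|X|; elim: m X cod size_r win lists => // m IH X cod size_r win lists Xm.
have winS (Y : {set E}) : Y \subset X ->
    #|[set e in Y | ((1 - delta) * s <= #|vs e|%:R) && (#|vs e|%:R <= (1 + delta) * s)]|%:R
    <= (1 - delta) * (t%:R * n).
  move=> /subsetP YX; apply: le_trans win; rewrite ler_nat; apply/subset_leq_card/subsetP => e.
  by move=> /setIdP[/YX eX h]; apply/setIdP.
have IHS (Y : {set E}) : Y \proper X -> colourable (adj vs) Y A.
  move=> YX; have YX' := proper_sub YX; apply: IH.
  - exact: codegree_leS YX' cod.
  - by move=> e /(subsetP YX'); apply: size_r.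
  - exact: winS.
  - by move=> e /(subsetP YX'); apply: lists.
  - by apply: leq_trans (proper_card YX) _.
have [->|[e0 e0X]] := set_0Vmem X; first exact: colourable0.
(* An edge with more colours than neighbours can be coloured last. *)
have [/exists_inP[e eX few]|] := boolP [exists (e | e \in X), (#|neighbours (adj vs) X e| < #|A e|)%N].
  have [phi col] := IHS (X :\ e) (properD1 eX).
  rewrite -(setD1K eX) setUC; apply: (colourable_extend (adjC vs) col).
  apply: (colourable_greedy (adjC vs) (adjxx vs) c0) => f /set1P->.
  have -> : neighbours (adj vs) [set e] e = set0.
    by apply/setP => g; rewrite !inE; case: eqP => // ->; rewrite adjxx.
  rewrite cards0; apply: leq_trans (card_avail _ _ _ _ _); rewrite subn_gt0.
  apply: leq_ltn_trans few; apply/subset_leq_card/subsetP => g; rewrite !inE.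
  by move=> /andP[/andP[_ ->] ->].
rewrite negb_exists_in => /forall_inP many.
pose estar := [arg min_(e < e0 in X) #|vs e|].
have [starX star_min] : estar \in X /\ forall e, e \in X -> (#|vs estar| <= #|vs e|)%N.
  by rewrite /estar; case: arg_minnP.
pose k := #|vs estar|.
have nb_many e : e \in X -> (1 - sigma) * D <= #|neighbours (adj vs) X e|%:R.
  move=> eX; apply: le_trans (lists e eX) _; rewrite ler_nat leqNgt; exact: many.
have core e : e \in X -> (1 - sigma) * D <= \sum_(v in vs e) #|star vs X v|%:R.
  by move=> eX; apply: le_trans (nb_many e eX) _; apply: neighbours_le.
(* In this case X has fewer edges than each neighbourhood is required to have. *)
have [huge|] := leP ((1 - d1') * s) k%:R.
  have big e : e \in X -> (1 - delta ^+ 2 / 6) * s <= #|vs e|%:R.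
    by move=> eX; apply: le_trans huge _; rewrite ler_nat star_min.
  have XD := huge_count d01 cod s1 big win.
  have h : (1 - sigma) * D <= (1 - delta ^+ 2 / 4) * D.
    apply: le_trans (nb_many _ starX) _; apply: le_trans XD; rewrite ler_nat subset_leq_card //.
    by apply/subsetP => f /setIdP[].
  exfalso; move: h; rewrite ler_pM2r // => h.
  move: d1'0 mu_d sigma_mu; rewrite /d1'; clear -h mu0; lra.
move=> ks; pose K : R := k%:R.
have Ksig : 1 <= K * eta ^+ 2.
  by rewrite -ler_pdivrMr //; apply: hN1; apply: size_r.
have [G GX [G0 Gsize Gout Gdeg Gstar]] :=
  core_good_edges cod star_min starX erefl core t_gt0 mu0 mu1 erefl erefl Ksig n2.
rewrite -/K -/D -/n in Gsize Gout Gdeg Gstar.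
have YX : X :\: G \proper X.
  rewrite properE subsetDl /=; apply/subsetPn; have /set0Pn[g gG] := G0.
  by exists g; [apply: (subsetP GX) | rewrite inE gG].
have [phi col] := IHS _ YX.
have -> : X = (X :\: G) :|: G.
  by apply/setP => e; have := subsetP GX e; rewrite !inE; case: (e \in G); case: (e \in X) => // ->.
apply: (colourable_extend (adjC vs) col).
(* The edges outside G are coloured first; an edge of G meets at most 8 mu D of them. *)
pose l := Num.truncn ((1 - sigma - 8 * mu) * D).
have lD0 : 0 <= (1 - sigma - 8 * mu) * D.
  by apply: mulr_ge0 => //; clear -sigma_mu mu1; lra.
have lle : l%:R <= (1 - sigma - 8 * mu) * D by rewrite truncn_le.
have lgt : (1 - sigma - 8 * mu) * D - 1 < l%:R by rewrite ltrBlDr natr1 truncnS_gt.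
have muD : 2 <= mu * D by have := ler_wpM2l mu_ge0 nD; clear -n4; lra.
have sD : sigma * D <= mu / 1000 * D by apply: ler_wpM2r.
have sD0 : 0 <= sigma * D by rewrite mulr_ge0 // ltW.
have l_ge : (1 - 10 * mu) * D <= l%:R by clear -lgt muD sD; lra.
have l_le : l%:R <= D by clear -lle sD0 muD; lra.
have mD1 : mu * D <= 1 / 100 * D by apply: ler_wpM2r.
have l_half : D <= 2 * l%:R by clear -l_ge mD1 D_ge0; lra.
have K4 : 4 <= mu * K.
  have K0 : 0 <= K by [].
  have h1 := ler_wpM2l K0 eta_mu.
  have h2 : K * eta ^+ 2 <= K * eta * (1 / 1000).
    rewrite expr2 mulrA; apply: ler_wpM2l; first by rewrite mulr_ge0 // ltW.
    clear -eta_mu mu1 mu0; lra.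
  clear -h1 h2 Ksig; lra.
have K_gt0 : 0 < K.
  by rewrite -(pmulr_rgt0 K mu0); clear -K4; lra.
have starG v : #|star vs G v|%:R <= #|star vs X v|%:R :> R.
  by rewrite ler_nat; apply/subset_leq_card/subsetP => e; rewrite !inE => /andP[/(subsetP GX) -> ->].
have dG e : e \in G -> #|neighbours (adj vs) G e|%:R <= (1 + 2 * mu) * D.
  move=> eG; apply: le_trans (neighbours_le R vs G e) _; apply: le_trans (Gdeg e eG).
  by apply: ler_sum => v _; apply: starG.
apply: (sparse E Col c0 (adj vs) G _ l (adjC vs) (adjxx vs)).
- rewrite -(ler_nat R); clear -l_half n5 nD; lra.
- move=> e eG; apply: leq_trans (card_avail _ _ _ _ _).
  have out : #|neighbours (adj vs) (X :\: G) e|%:R <= 8 * mu * D.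
    by apply: le_trans (neighbours_le R vs _ e) _; apply: Gout.
  have la := lists e (subsetP GX e eG).
  have h : (l + #|neighbours (adj vs) (X :\: G) e| <= #|A e|)%N.
    by rewrite -(ler_nat R) natrD; apply: (le_trans _ la); rewrite -/D; clear -out lle; lra.
  by rewrite -(leq_add2r #|neighbours (adj vs) (X :\: G) e|) subnK // (leq_trans _ h) // leq_addl.
- move=> e eG; apply: le_trans (dG e eG) _.
  have h1 : (1 + etaS) * ((1 - 10 * mu) * D) <= (1 + etaS) * l%:R.
    by apply: ler_wpM2l => //; clear -etaS0; lra.
  have h2 : 30 * mu * D <= etaS * D by apply: ler_wpM2r => //; clear -mu_eta; lra.
  have h3 : etaS * (mu * D) <= etaS * (1 / 100 * D) by apply: ler_wpM2l => //; exact: ltW.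
  have h4 : 0 <= etaS * D by rewrite mulr_ge0 // ltW.
  clear -h1 h2 h3 h4 muD; lra.
- move=> e eG; case: (ltnP #|neighbours (adj vs) G e| l) => [|ld]; [by right | left].
  (* This is where k < (1 - d1') sqrt n enters: the pairs across an edge account for at most (1 -
     d1') D adjacent neighbours, leaving a fraction of about d1' far pairs. *)
  have Kn : K ^+ 2 * t%:R <= (1 - d1') * D.
    have p0 : 0 <= 1 - d1' by clear -d1'1; lra.
    have h1 : K ^+ 2 <= ((1 - d1') * s) ^+ 2.
      apply: lerXn2r; rewrite ?nnegrE ?(ltW K_gt0) ?(ltW ks) //.
      by apply: mulr_ge0 => //; apply: sqrtr_ge0.
    have h2 : (1 - d1') ^+ 2 <= 1 - d1'.
      by rewrite expr2; apply: ler_piMl => //; clear -d1'0; lra.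
    move: h1; rewrite exprMn /s sqr_sqrtr ?(ltW n_gt0) // => h1.
    have h3 := ler_wpM2r (ltW n_gt0) h2.
    have -> : (1 - d1') * D = (1 - d1') * n * t%:R by rewrite /D; ring.
    by apply: ler_wpM2r => //; apply: le_trans h1 h3.
  have M0 : 0 <= (1 + mu) * K by rewrite mulr_ge0 ?(ltW K_gt0) //; clear -mu0; lra.
  have Q0 : 0 <= 2 * D / K by rewrite divr_ge0 ?mulr_ge0 // ltW.
  have HQ v : #|star vs G v|%:R <= 2 * D / K.
    by apply: le_trans (starG v) _; rewrite ler_pdivlMr.
  have HS : \sum_(v in vs e) #|star vs G v|%:R <= (1 + 2 * mu) * D.
    by apply: le_trans (Gdeg e eG); apply: ler_sum => v _; apply: starG.
  pose d : R := #|neighbours (adj vs) G e|%:R.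
  apply: le_trans (far_pairs_ge (codegree_leS GX cod) eG M0 Q0 HQ HS Gsize (erefl d)).
  have dl : l%:R <= d by rewrite ler_nat.
  have dD : d <= (1 + 2 * mu) * D by apply: dG.
  have d_ge : (1 - 10 * mu) * D <= d by apply: le_trans dl.
  have D2 : 0 <= D * D by rewrite mulr_ge0.
  have muDD : 2 * D <= mu * (D * D) by rewrite [leRHS](mulrA mu D D); apply: ler_wpM2r.
  have mm : mu * mu <= mu * (1 / 100) by apply: ler_wpM2l.
  have mm0 : 0 <= mu * mu by rewrite mulr_ge0.
  have sq1 : (1 - 20 * mu) * (D * D) <= d ^+ 2.
    apply: (@le_trans _ _ (((1 - 10 * mu) * D) ^+ 2)).
      have -> : ((1 - 10 * mu) * D) ^+ 2 = ((1 - 20 * mu) + 100 * (mu * mu)) * (D * D) by ring.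
      apply: ler_wpM2r => //; clear -mm0; lra.
    apply: lerXn2r => //; rewrite nnegrE //.
    apply: mulr_ge0 => //; clear -mu1; lra.
  have dsmall : d <= mu * (D * D).
    apply: le_trans dD _; apply: le_trans muDD; clear -mD1 D_ge0; lra.
  have QS : 2 * D / K * ((1 + 2 * mu) * D) <= mu * (D * D).
    have h1 : 2 * D / K <= mu / 2 * D.
      rewrite ler_pdivrMr //; have := ler_wpM2r D_ge0 K4; clear; lra.
    have h2 : (1 + 2 * mu) * D <= 2 * D by clear -mD1 D_ge0; lra.
    have h3 : 0 <= (1 + 2 * mu) * D by apply: mulr_ge0 => //; clear -mu0; lra.
    have := ler_pM Q0 h3 h1 h2; clear; lra.
  have dM : d * ((1 + mu) * K) ^+ 2 * t%:R <= (1 - d1' + 5 * mu) * (D * D).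
    have h1 : d * (1 + mu) ^+ 2 <= (1 + 5 * mu) * D.
      have h0 : 0 <= (1 + mu) ^+ 2 := sqr_ge0 _.
      have := ler_wpM2r h0 dD.
      have -> : (1 + 2 * mu) * D * (1 + mu) ^+ 2 = (1 + 4 * mu + 5 * (mu * mu) + 2 * (mu * mu) * mu) * D by ring.
      move=> h; apply: le_trans h _; apply: ler_wpM2r => //.
      have m3 : mu * mu * mu <= mu * mu * (1 / 100) by apply: ler_wpM2l.
      clear -mm mm0 m3 mu0; lra.
    have -> : d * ((1 + mu) * K) ^+ 2 * t%:R = (d * (1 + mu) ^+ 2) * (K ^+ 2 * t%:R) by ring.
    have h2 : 0 <= d * (1 + mu) ^+ 2 by rewrite mulr_ge0 ?sqr_ge0 // /d.
    have h3 : 0 <= K ^+ 2 * t%:R by rewrite mulr_ge0 ?sqr_ge0.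
    apply: le_trans (ler_pM h2 h3 h1 Kn) _.
    have -> : (1 + 5 * mu) * D * ((1 - d1') * D) = (1 - d1' + 5 * mu - 5 * (mu * d1')) * (D * D) by ring.
    apply: ler_wpM2r => //.
    have : 0 <= mu * d1' by rewrite mulr_ge0 // ltW.
    clear; lra.
  have l2 : d1' / 2 * l%:R ^+ 2 <= d1' / 2 * (D * D).
    apply: ler_wpM2l; first by rewrite divr_ge0 // ltW.
    by rewrite expr2; apply: ler_pM.
  have dDD : 100 * mu * (D * D) <= d1' * (D * D) by apply: ler_wpM2r => //; clear -mu_d; lra.
  have mDD : 0 <= mu * (D * D) by rewrite mulr_ge0.
  clear -sq1 dsmall QS dM l2 dDD mDD; lra.
- apply: (@le_trans _ _ (\sum_v #|star vs G v|%:R)); first exact: card_le_sum_star.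
  apply: (@le_trans _ _ (\sum_(v : V) D)).
    apply: ler_sum => v _; apply: le_trans (starG v) _.
    have := Gstar v; have : 2 <= K by clear -K4 mu1 K_gt0 mu0; nra.
    have x0 : 0 <= #|star vs X v|%:R :> R by [].
    move=> K2 h; have := ler_wpM2l x0 K2; clear -h; lra.
  rewrite sumr_const -[_ *+ _]mulr_natl -/n.
  have D1 : 1 <= D by clear -n_ge2 nD; lra.
  apply: (@le_trans _ _ (D * D)); first exact: ler_wpM2r.
  have h1 : D * D <= D * D * D by apply: ler_peMr => //; rewrite mulr_ge0.
  have -> : 8 * l%:R ^+ 3 = (2 * l%:R) * (2 * l%:R) * (2 * l%:R) :> R by ring.
  apply: le_trans h1 _; apply: ler_pM => //; first by rewrite mulr_ge0.
  exact: ler_pM.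
Qed.

End LargeEdgesColouring.

(** * Combining the three ranges of edge sizes *)

(** Only finitely many natural numbers occur in the lists, so they embed in an ordinal type, which
    contains 0 and thus a default colour. *)
Lemma list_colourableW (V E : finType) (vs : E -> {set V}) (s : nat) :
  (forall (Col : finType) (c0 : Col) (A : E -> {set Col}),
    (forall e, (s <= #|A e|)%N) -> colourable (adj vs) [set: E] A) ->
  list_colourable vs s.
Proof.
move=> col C Cs; pose N := (\max_(e : E) \max_(c <- C e) c)%N.
have leN e c : c \in C e -> (c < N.+1)%N.
  move=> ce; rewrite ltnS; apply: leq_trans (leq_bigmax e).
  exact: leq_bigmax_seq.
pose A e : {set 'I_N.+1} := [set c | val c \in C e].
have As e : (s <= #|A e|)%N.
  apply: leq_trans (Cs e) _; rewrite cardE -(size_map val); apply: uniq_leq_size; first exact: undup_uniq.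
  move=> c; rewrite mem_undup => ce; apply/mapP; exists (Ordinal (leN e c ce)) => //.
  by rewrite mem_enum inE.
have [phi [phiA phiP]] := col _ ord0 A As.
exists (fun e => val (phi e)); split=> [e f ef eq_ef|e]; last by have := phiA e; rewrite !inE => ->.
apply: contraT => m; case: (phiP e f); rewrite ?inE // /adj ?ef //; exact: val_inj.
Qed.

(** * Interplay of large, medium and small edges *)

Section Glue.
Variable R : realType.

Lemma star_le_large (V E : finType) (vs : E -> {set V}) (X : {set E}) (t r : nat) v :
  codegree_le vs X t -> (forall e, e \in X -> (r < #|vs e|)%N) ->
  r%:R * #|star vs X v|%:R <= t%:R * #|V|%:R :> R.
Proof.
move=> cod size_r; apply: le_trans (sum_star_size R v cod).
rewrite mulr_natr -sumr_const; apply: ler_sum => e /setIdP[/size_r re _].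
by rewrite lerBrDr natr1 ler_nat.
Qed.

Theorem three_ranges_colourable (delta : R) : 0 < delta <= 1 / 10 ->
  exists (sigma : R) (n0 : nat), [/\ 0 < sigma <= 1 / 2, 1 <= sigma * n0%:R &
  forall (V E Col : finType) (c0 : Col) (vs : E -> {set V}) (A : E -> {set Col}) (t : nat),
    let n : R := #|V|%:R in let s := Num.sqrt n in
    (forall e, vs e != set0) -> codegree_le vs [set: E] t -> (0 < t)%N -> (n0 <= #|V|)%N ->
    (forall v, #|star vs [set: E] v|%:R <= (1 - delta) * (t%:R * n)) ->
    #|[set e in [set: E] | ((1 - delta) * s <= #|vs e|%:R) && (#|vs e|%:R <= (1 + delta) * s)]|%:R
      <= (1 - delta) * (t%:R * n) ->
    (forall e, (1 - 2 * sigma) * (t%:R * n) <= #|A e|%:R) ->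
  colourable (adj vs) [set: E] A].
Proof.
move=> d01; have /andP[d0 d1] := d01.
have [sB [rB [nB [sB0 sBd large]]]] := large_edges_colourable d01.
(* With sigma = sB / 8, (1 - 2 gam) (1 - 2 sigma) is at least 1 - 6 sigma, which together with
   rounding stays above 1 - sB. *)
pose gam := sB / 4; have g0 : 0 < gam by rewrite divr_gt0.
have g2 : 0 < gam <= 2^-1 by rewrite g0 /= /gam; clear -sBd d1; lra.
have B80 : 0 <= 8 :> R by [].
have [Lres reserve] := reserve_colours g2 B80.
have [r1 hr1] := @nat_ge R (8 / gam).
(* A medium star has at most D / r1 <= gam D / 8 edges, half of the gam D / 4 reserved colours. *)
have r1g : 8 <= r1%:R * gam by rewrite -ler_pdivrMr //; apply: hr1.
have r1_gt0 : (0 < r1)%N.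
  by rewrite lt0n; apply: contraTneq r1g => ->; rewrite mul0r -ltNge.
have [r2 hr2] := @nat_ge R (8 * r1%:R / delta).
pose r0 := maxn rB r2.
(* A small edge then meets at most r1 D / r0 <= delta D / 8 large ones, and still has nearly (1 -
   delta / 4) D colours against degree (1 - delta) D. *)
have r0d : 8 * r1%:R <= r0%:R * delta by rewrite -ler_pdivrMr //; apply: hr2; rewrite leq_maxr.
have r0_gt0 : (0 < r0)%N.
  rewrite lt0n; apply: contraTneq r0d => ->; rewrite mul0r -ltNge.
  by rewrite mulr_gt0 // ltr0n.
have half01 : 0 < (2^-1 : R) < 1 by apply/andP; split; clear; lra.
have Bm0 : 0 <= (4 / gam) ^+ 3 by rewrite exprn_ge0 // divr_ge0 // ltW.
have [em [Lm [em0 kahn_medium]]] := @kahn R r0 2^-1 ((4 / gam) ^+ 3) r0_gt0 half01 Bm0.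
have d401 : 0 < delta / 4 < 1 by apply/andP; split; clear -d0 d1; lra.
have [es [Ls [es0 kahn_small]]] := @kahn R r1 (delta / 4) 8 r1_gt0 d401 B80.
pose sigma := sB / 8.
have sig0 : 0 < sigma by rewrite divr_gt0.
have [N1 hN1] := @nat_ge R (1 / sigma).
have [N2 hN2] := @nat_ge R (2 * Lres%:R + 2).
have [N3 hN3] := @nat_ge R (4 / (em * gam)).
have [N4 hN4] := @nat_ge R (4 * Lm%:R / gam).
have [N5 hN5] := @nat_ge R (2 / es).
have [N6 hN6] := @nat_ge R (2 * Ls%:R).
have [N7 hN7] := @nat_ge R (8 / gam).
have [N8 hN8] := @nat_ge R (4 / delta).
pose n0 := maxn (maxn (maxn nB N1) (maxn N2 N3)) (maxn (maxn N4 N5) (maxn N6 (maxn N7 N8))).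
exists sigma, n0; split.
- by rewrite sig0 /= /sigma; clear -sBd d1; lra.
- by rewrite mulrC -ler_pdivrMr //; apply: hN1; rewrite /n0 !leq_max leqnn ?orbT.
move=> V E Col c0 vs A t n s vs0 cod t_gt0.
rewrite !geq_max => /andP[/andP[/andP[nBn _] /andP[/hN2 n2 /hN3 n3]] /andP[/andP[/hN4 n4 /hN5 n5] /andP[/hN6 n6 /andP[/hN7 n7 /hN8 n8]]]].
move=> deg win lists; rewrite -/n in n2 n3 n4 n5 n6 n7 n8.
clear N1 N2 N3 N4 N5 N6 N7 N8 n0 hN1 hN2 hN3 hN4 hN5 hN6 hN7 hN8.
have emg : 0 < em * gam by rewrite mulr_gt0.
move: n3 n4 n5 n7 n8; rewrite !ler_pdivrMr // => n3 n4 n5 n7 n8.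
pose D := t%:R * n; rewrite -/D in deg win lists.
have n_ge0 : 0 <= n by [].
have t1 : 1 <= t%:R :> R by rewrite ler1n.
have nD : n <= D by apply: ler_peMl.
have n_ge2 : 2 <= n.
  by have L00 : 0 <= Lres%:R :> R by []; clear -n2 L00; lra.
have D_gt0 : 0 < D by clear -n_ge2 nD; lra.
have D_ge0 := ltW D_gt0.
have D1 : 1 <= D by clear -n_ge2 nD; lra.
have gD : 8 <= gam * D by have := ler_wpM2l (ltW g0) nD; clear -n7; lra.
have dD : 4 <= delta * D by have := ler_wpM2l (ltW d0) nD; clear -n8; lra.
have deltaD : delta * D <= 1 / 10 * D by apply: ler_wpM2r.
have D40 : 40 <= D by clear -dD deltaD; lra.
have sigD : sigma * D <= 1 / 100 * D.
  by apply: ler_wpM2r => //; rewrite /sigma; clear -sBd d1; lra.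
have sigD0 : 0 <= sigma * D by rewrite mulr_ge0 // ltW.
have gsig : gam = 2 * sigma by rewrite /gam /sigma; clear; field.
have codS (X : {set E}) : codegree_le vs X t by apply: codegree_leS cod; apply: subsetT.
have starS (X : {set E}) v : #|star vs X v|%:R <= (1 - delta) * D.
  apply: le_trans (deg v); rewrite ler_nat; apply/subset_leq_card/subsetP => e.
  by rewrite !inE => /andP[_ ->].
have EX (X : {set E}) : #|X|%:R <= D * D.
  apply: (@le_trans _ _ (\sum_v #|star vs X v|%:R)); first exact: card_le_sum_star.
  apply: (@le_trans _ _ (\sum_(v : V) D)).
    by apply: ler_sum => v _; apply: le_trans (starS X v) _; apply: ler_piMl => //; clear -d0; lra.
  rewrite sumr_const -[_ *+ _]mulr_natl -/n; exact: ler_wpM2r.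
have EX3 (X : {set E}) : #|X|%:R <= D ^+ 3.
  apply: le_trans (EX X) _; have -> : D ^+ 3 = D * D * D by ring.
  by apply: ler_peMr => //; rewrite mulr_ge0.
pose l := Num.truncn ((1 - 2 * sigma) * D).
have lle : l%:R <= (1 - 2 * sigma) * D.
  by rewrite truncn_le mulr_ge0 //; rewrite /sigma; clear -sBd d1; lra.
have lgt : (1 - 2 * sigma) * D - 1 < l%:R by rewrite ltrBlDr natr1 truncnS_gt.
have l_half : D <= 2 * l%:R by clear -lgt sigD D40; lra.
have lA e : e \in [set: E] -> (l <= #|A e|)%N.
  by move=> _; rewrite -(ler_nat R); apply: le_trans lle (lists e).
have l3 (X : {set E}) : #|X|%:R <= 8 * l%:R ^+ 3 :> R.
  apply: le_trans (EX3 X) _; have -> : 8 * l%:R ^+ 3 = (2 * l%:R) ^+ 3 :> R by ring.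
  by apply: lerXn2r; rewrite ?nnegrE ?mulr_ge0.
have Lres_l : (Lres <= l)%N by rewrite -(ler_nat R); clear -n2 nD l_half; lra.
have [S hS] := reserve E Col [set: E] A l Lres_l lA (l3 _).
pose XL := [set e | (r0 < #|vs e|)%N].
pose XS := [set e | (#|vs e| <= r1)%N].
pose XM := [set e | (r1 < #|vs e| <= r0)%N].
have ASge e : (1 - sB) * D <= #|A e :\: S|%:R.
  apply: (le_trans _ (hS e (in_setT e)).2).
  have p0 : 0 <= 1 - 2 * gam by rewrite /gam; clear -sBd d1; lra.
  have h := ler_wpM2l p0 (ltW lgt).
  have h2 : 0 <= sigma * (sigma * D) by rewrite mulr_ge0 // ltW.
  have h3 : 0 <= gam by rewrite ltW.
  have sB8 : sB = 8 * sigma by rewrite /sigma; clear; field.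
  apply: le_trans h; rewrite gsig sB8; rewrite gsig in gD; clear -h2 gD sig0; lra.
have [phiL colL] : colourable (adj vs) XL (fun e => A e :\: S).
  apply: (large V E Col c0 vs XL _ t vs0 (codS XL) t_gt0 nBn).
  - by move=> e; rewrite inE => /ltnW; apply: leq_trans; rewrite leq_maxl.
  - apply: (le_trans _ win); rewrite ler_nat; apply/subset_leq_card/subsetP => e.
    by move=> /setIdP[_ h]; apply/setIdP.
  - by move=> e _; apply: ASge.
have [phiLS colLS] : colourable (adj vs) (XL :|: XS) (fun e => A e :\: S).
  apply: (colourable_extend (adjC vs) colL).
  pose L := Num.truncn ((1 - delta / 4) * D).
  have Lle : L%:R <= (1 - delta / 4) * D.
    by rewrite truncn_le mulr_ge0 //; clear -d1; lra.
  have Lgt : (1 - delta / 4) * D - 1 < L%:R by rewrite ltrBlDr natr1 truncnS_gt.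
  have L_half : D <= 2 * L%:R by clear -Lgt deltaD n_ge2 nD dD; lra.
  apply: (kahn_small V E Col c0 vs XS _ L t) => //.
  - by move=> e; rewrite inE.
  - have h : 2 * (t%:R * 1) <= t%:R * (n * es) * 1.
      have := ler_wpM2l (ler0n R t) n5; clear; lra.
    have h2 := ler_wpM2l (ltW es0) L_half.
    have h3 : t%:R * (n * es) = es * D by rewrite /D; ring.
    rewrite h3 in h; clear -h h2; lra.
  - by rewrite -(ler_nat R); clear -n6 nD L_half; lra.
  - move=> e; rewrite inE => er1; apply: leq_trans (card_avail _ _ _ _ _).
    have out : #|neighbours (adj vs) XL e|%:R <= delta / 8 * D.
      apply: le_trans (neighbours_le R vs _ e) _.
      have r0R : 0 < r0%:R :> R by rewrite ltr0n.
      rewrite -(ler_pM2l r0R) mulr_sumr.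
      apply: (@le_trans _ _ (\sum_(v in vs e) D)).
        apply: ler_sum => v _; apply: star_le_large (codS _) _ => f; by rewrite inE.
      rewrite sumr_const -[_ *+ _]mulr_natl.
      have -> : r0%:R * (delta / 8 * D) = (r0%:R * delta) / 8 * D by clear; field.
      apply: ler_wpM2r => //; apply: (@le_trans _ _ r1%:R); first by rewrite ler_nat.
      by clear -r0d; lra.
    have la := ASge e.
    have sBD : sB * D <= delta / 8 * D by apply: ler_wpM2r.
    have h : (L + #|neighbours (adj vs) XL e| <= #|A e :\: S|)%N.
      rewrite -(ler_nat R) natrD; apply: (le_trans _ la); clear -out Lle sBD; lra.
    by rewrite -(leq_add2r #|neighbours (adj vs) XL e|) subnK // (leq_trans _ h) // leq_addl.
  - move=> v; apply: le_trans (starS _ v) _.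
    have p0 : 0 <= 1 - delta / 4 by clear -d1; lra.
    have h := ler_wpM2l p0 (ltW Lgt).
    have h2 : 0 <= delta * (delta * D) by rewrite !mulr_ge0 // ltW.
    clear -h h2 dD d0; lra.
  - apply: le_trans (EX3 _) _; have -> : 8 * L%:R ^+ 3 = (2 * L%:R) ^+ 3 :> R by ring.
    by apply: lerXn2r; rewrite ?nnegrE ?mulr_ge0.
have [phiM colM] : colourable (adj vs) XM (fun e => A e :&: S).
  pose L := Num.truncn (gam / 2 * l%:R).
  have Lle : L%:R <= gam / 2 * l%:R.
    by rewrite truncn_le mulr_ge0 // divr_ge0 // ltW.
  have Lgt : gam / 2 * l%:R - 1 < L%:R by rewrite ltrBlDr natr1 truncnS_gt.
  have L_ge : gam / 4 * D <= L%:R.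
    have h := ler_wpM2l (ltW g0) (ltW lgt).
    have h2 := ler_wpM2l (ltW g0) sigD.
    have g1 : gam <= 1 by rewrite /gam; clear -sBd d1; lra.
    clear -h h2 gD Lgt g1; lra.
  apply: (kahn_medium V E Col c0 vs XM _ L t) => //.
  - by move=> e; rewrite inE => /andP[].
  - have h : 4 * (t%:R * 1) <= t%:R * (n * (em * gam)) * 1.
      have := ler_wpM2l (ler0n R t) n3; clear; lra.
    have h2 := ler_wpM2l (ltW em0) L_ge.
    have h3 : t%:R * (n * (em * gam)) = 4 * (em * (gam / 4 * D)) by rewrite /D; clear; field.
    rewrite h3 in h; clear -h h2; lra.
  - rewrite -(ler_nat R); apply: le_trans L_ge.
    have := ler_wpM2l (ltW g0) nD; clear -n4; lra.
  - by move=> e _; rewrite -(ler_nat R); apply: (le_trans Lle (hS e (in_setT e)).1).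
  - move=> v; have r1R : 0 < r1%:R :> R by rewrite ltr0n.
    rewrite -(ler_pM2l r1R); apply: (@le_trans _ _ D).
      by apply: star_le_large (codS _) _ => f; rewrite inE => /andP[].
    have -> : r1%:R * ((1 - 2^-1) * L%:R) = r1%:R / 2 * L%:R :> R by clear; field.
    apply: (@le_trans _ _ (r1%:R / 2 * (gam / 4 * D))); last by apply: ler_wpM2l L_ge; rewrite divr_ge0.
    have := ler_wpM2r D_ge0 r1g; clear; lra.
  - apply: le_trans (EX3 _) _.
    have -> : (4 / gam) ^+ 3 * L%:R ^+ 3 = (4 / gam * L%:R) ^+ 3 by rewrite -exprMn.
    have gL : D <= 4 / gam * L%:R.
      have gn0 := lt0r_neq0 g0.
      have -> : D = 4 / gam * (gam / 4 * D) by clear -gn0; field.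
      by apply: ler_wpM2l L_ge; rewrite divr_ge0 // ltW.
    by apply: lerXn2r; rewrite ?nnegrE //; apply: le_trans gL.
eexists; have -> : [set: E] = (XL :|: XS) :|: XM.
  apply/setP => e; rewrite !inE; case: (leqP #|vs e| r0) => //= _; by case: leqP.
have [phiA phiP] := colLS.
apply: (colours_union (adjC vs) (phi := phiLS) (psi := phiM) (B := fun e => A e :&: S)) => [|//|e _|e f _ fX _].
- by split=> // e /phiA; rewrite inE => /andP[].
- exact: subsetIl.
- by have := phiA f fX; rewrite !inE => /andP[/negbTE-> _]; rewrite andbF.
Qed.

End Glue.

Theorem theorem1p5 (R : realType) (delta : R) (hdelta : 0 < delta) :
  exists (n0 : nat) (sigma : R), (0 < n0)%N /\ 0 < sigma /\
  forall (n t : nat), (n0 <= n)%N ->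
  forall (V E : finType) (vs : E -> {set V}),
    hypergraph vs ->
    #|V| = n ->
    (forall v : V, (hdegree vs v)%:R <= (1 - delta) * t%:R * n%:R) ->
    (forall u v : V, u != v -> (hcodegree vs u v <= t)%N) ->
    (#|[set e : E | ((1 - delta) * Num.sqrt (n%:R : R) <= (#|vs e|)%:R)
                   && ((#|vs e|)%:R <= (1 + delta) * Num.sqrt (n%:R : R))]|)%:R
      <= (1 - delta) * t%:R * n%:R ->
    list_chromatic_index_le vs ((1 - sigma) * t%:R * n%:R).
Proof.
(* Decreasing delta weakens both upper bounds and narrows the window, so the hypotheses carry
   over. *)
pose d := Num.min delta (1 / 10).
have d01 : 0 < d <= 1 / 10 by rewrite lt_min hdelta ge_min lexx orbT /= divr_gt0.
have dd : d <= delta by rewrite ge_min lexx.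
have /andP[d0 d1] := d01.
have [sigma [n0 [/andP[s0 s2] sn0 col]]] := three_ranges_colourable d01.
exists n0.+1, sigma; split=> //; split=> // n t n0n V E vs vs0 Vn deg cod win.
(* For t = 0 all degrees vanish; since edges are nonempty there are none, and 0 colours suffice. *)
have [t0|t_gt0] := posnP t.
  exists 0%N; split; first by rewrite t0 mulr0 mul0r.
  have noE (e : E) : False.
    have /set0Pn[v ve] := vs0 e; have := deg v; rewrite t0 mulr0 mul0r.
    rewrite leNgt ltr0n; apply/negP/negPn; apply/card_gt0P; exists e; by rewrite inE.
  by move=> C _; exists (fun e => 0%N); split=> e; case: (noE e).
have n_le : (n0 <= #|V|)%N by rewrite Vn ltnW.
pose D : R := t%:R * #|V|%:R.
have DE (x : R) : x * t%:R * n%:R = x * D by rewrite /D Vn mulrA.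
have D0 : 0 <= D by rewrite mulr_ge0.
have dD : (1 - delta) * D <= (1 - d) * D by apply: ler_wpM2r => //; clear -dd; lra.
have sD : 1 <= sigma * D.
  apply: le_trans sn0 _; apply: ler_wpM2l; first exact: ltW.
  apply: (@le_trans _ _ #|V|%:R); first by rewrite ler_nat.
  by rewrite /D; apply: ler_peMl => //; rewrite ler1n.
(* Rounding down loses less than 1 <= sigma D, so the lists still have the (1 - 2 sigma) D colours
   that [three_ranges_colourable] asks for. *)
exists (Num.truncn ((1 - sigma) * D)); rewrite DE; split.
  by rewrite truncn_le mulr_ge0 //; clear -s2; lra.
apply: list_colourableW => Col c0 A lA.
apply: (col V E Col c0 vs A t vs0 _ t_gt0 n_le).
- move=> u v uv; apply: leq_trans (cod u v uv); apply/subset_leq_card/subsetP => e.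
  by rewrite !inE.
- move=> v; apply: le_trans dD; rewrite -DE; apply: le_trans (deg v).
  by rewrite ler_nat; apply/subset_leq_card/subsetP => e; rewrite !inE.
- apply: le_trans dD; rewrite -DE; apply: le_trans win; rewrite ler_nat.
  apply/subset_leq_card/subsetP => e; rewrite !inE Vn /= => /andP[h1 h2].
  have sq0 : 0 <= Num.sqrt (n%:R : R) := sqrtr_ge0 _.
  apply/andP; split; [apply: le_trans h1 | apply: le_trans h2 _];
    by apply: ler_wpM2r => //; clear -dd; lra.
- move=> e; apply: (@le_trans _ _ (Num.truncn ((1 - sigma) * D))%:R); last by rewrite ler_nat.
  have : (1 - sigma) * D - 1 < (Num.truncn ((1 - sigma) * D))%:R by rewrite ltrBlDr natr1 truncnS_gt.
  rewrite -/D; clear -sD; lra.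
Qed.
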